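(* \textsc{Rendezvous} and \textsc{Rendezvous in Time} are PSPACE-hard.
   Context: Rendezvous game with adversaries. Let $G$ be a finite, simple, undirected, connected graph, let $s,t\in V(G)$ and let $k\ge 1$ be an integer. Two players play: Facilitator, who controls two agents $R$ and $J$ initially placed on $s$ and $t$ respectively, and Divider, who controls $k$ agents $D_1,\dots,D_k$ which Divider initially places on vertices of $V(G)\setminus\{s,t\}$ of his choice (several agents may share a vertex). After the initial placement the players alternate moves, Facilitator moving first. In a move, the player moves each of his agents to an adjacent vertex or leaves it where it is; no agent may be moved to a vertex currently occupied by an agent of the opponent. Both players have full information. Facilitator wins if at some moment $R$ and $J$ occupy the same vertex; Divider wins if this never happens. For an integer $\tau\ge 1$, Facilitator wins in at most $\tau$ steps if he can force $R$ and $J$ to occupy the same vertex within his first $\tau$ moves (a step is a move of Facilitator followed by a move of Divider). \textsc{Rendezvous}: given $(G,s,t,k)$, decide whether Facilitator has a winning strategy against Divider with $k$ agents. \textsc{Rendezvous in Time}: given $(G,s,t,k,\tau)$ with positive integers $k,\tau$, decide whether Facilitator can win in at most $\tau$ steps against Divider with $k$ agents. *)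

(* Defs.v *)
From mathcomp Require Import all_boot.
Set Implicit Arguments. Unset Strict Implicit. Unset Printing Implicit Defensive.

(* A deterministic single-tape TM with a one-way infinite tape (cells 0,1,..)
   Input bits are written in cells 0..|w|-1 via [tm_in], the rest is blank;
   the head starts on cell 0.  [tm_delta q a = (q', a', right?)] : write a',
   go to state q', move right if the boolean is true, else left (staying on
   cell 0 when already there).  Halting states are absorbing.  *)
Record TM : Type := MkTM {
  tm_Q : finType;
  tm_S : finType;
  tm_blank : tm_S;
  tm_in : bool -> tm_S;
  tm_out : tm_S -> option bool;
  tm_q0 : tm_Q;
  tm_halt : pred tm_Q;
  tm_acc : pred tm_Q;
  tm_delta : tm_Q -> tm_S -> tm_Q * tm_S * bool
}.

Definition config (M : TM) : Type := (tm_Q M * (nat -> tm_S M) * nat)%type.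

Definition tm_init (M : TM) (w : seq bool) : config M :=
  (@tm_q0 M,
   fun i => if i < size w then @tm_in M (nth false w i) else @tm_blank M,
   0).

Definition tm_step (M : TM) (c : config M) : config M :=
  let: (q, tp, p) := c in
  if @tm_halt M q then c else
  let: (q', a, mv) := @tm_delta M q (tp p) in
  (q', fun i => if i == p then a else tp i, if mv then p.+1 else p.-1).

Definition tm_run (M : TM) (t : nat) (w : seq bool) : config M :=
  iter t (@tm_step M) (tm_init M w).

Definition tape_reads (M : TM) (tp : nat -> tm_S M) (s : seq bool) : Prop :=
  (forall i, i < size s -> @tm_out M (tp i) = Some (nth false s i)) /\
  @tm_out M (tp (size s)) = None.

Definition poly_bound (c k n : nat) : nat := c * n ^ k + c.

Definition poly_time_computable (f : seq bool -> seq bool) : Prop :=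
  exists (M : TM) (c k : nat), forall w : seq bool,
    let cf := tm_run M (poly_bound c k (size w)) w in
    @tm_halt M cf.1.1 /\ tape_reads cf.1.2 (f w).

Definition language := seq bool -> Prop.

Definition in_PSPACE (L : language) : Prop :=
  exists (M : TM) (c k : nat), forall w : seq bool,
    exists t : nat,
      @tm_halt M (tm_run M t w).1.1 /\
      (forall t', t' <= t -> (tm_run M t' w).2 <= poly_bound c k (size w)) /\
      (@tm_acc M (tm_run M t w).1.1 <-> L w).

Definition poly_reduces (L1 L2 : language) : Prop :=
  exists f, poly_time_computable f /\ forall w, L1 w <-> L2 (f w).

Definition PSPACE_hard (L : language) : Prop :=
  forall L' : language, in_PSPACE L' -> poly_reduces L' L.

(* little-endian binary digits of m (m = 0 gives [:: false]) *)
Definition bin_digits (m : nat) : seq bool :=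
  mkseq (fun i => odd (m %/ 2 ^ i)) (trunc_log 2 m).+1.

(* self-delimiting binary encoding: every digit doubled, then "01" *)
Definition enc_nat (m : nat) : seq bool :=
  flatten [seq [:: b; b] | b <- bin_digits m] ++ [:: false; true].

Definition mat_rel (n : nat) (A : seq bool) : rel 'I_n :=
  fun x y => nth false A (x * n + y).

Definition valid_graph (n : nat) (A : seq bool) : Prop :=
  size A = n * n /\ symmetric (@mat_rel n A) /\ irreflexive (@mat_rel n A) /\
  (forall x y : 'I_n, connect (@mat_rel n A) x y).

Section Game.
Variables (V : finType) (e : rel V) (s t : V) (k : nat).

Definition adj_or_eq (x y : V) : bool := (x == y) || e x y.

Definition dpos := {ffun 'I_k -> V}.

(* A Facilitator strategy chooses the new positions of (R, J) from the
   (full) history of Divider's positions.  [d 0] is Divider's initial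
   placement and [d m.+1] the positions after Divider's (m+1)-th move.
   [fac_pos sigma d i] = positions of (R, J) after Facilitator's i-th move
   (i = 0: initial positions (s, t)). *)
Definition fac_pos (sigma : seq dpos -> V * V) (d : nat -> dpos) (i : nat)
  : V * V :=
  if i is i'.+1 then sigma [seq d m | m <- iota 0 i] else (s, t).

Definition div_init_legal (d0 : dpos) : Prop :=
  forall a : 'I_k, d0 a != s /\ d0 a != t.

(* Facilitator's (i+1)-th move (from time i to time i+1) is legal *)
Definition fac_legal (sigma : seq dpos -> V * V) (d : nat -> dpos) (i : nat) : Prop :=
  let: (r, j) := fac_pos sigma d i in
  let: (r', j') := fac_pos sigma d i.+1 in
  adj_or_eq r r' /\ adj_or_eq j j' /\
  (forall a : 'I_k, r' != d i a /\ j' != d i a).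

(* Divider's (m+1)-th move (made after Facilitator's (m+1)-th move) is legal *)
Definition div_legal (sigma : seq dpos -> V * V) (d : nat -> dpos) (m : nat) : Prop :=
  forall a : 'I_k, adj_or_eq (d m a) (d m.+1 a) /\
    d m.+1 a != (fac_pos sigma d m.+1).1 /\
    d m.+1 a != (fac_pos sigma d m.+1).2.

Definition legal_strategy (sigma : seq dpos -> V * V) : Prop :=
  forall (d : nat -> dpos) (i : nat), div_init_legal (d 0) ->
    (forall m, m < i -> div_legal sigma d m) -> fac_legal sigma d i.

Definition div_fully_legal (sigma : seq dpos -> V * V) (d : nat -> dpos) : Prop :=
  div_init_legal (d 0) /\ forall m, div_legal sigma d m.

Definition facilitator_wins : Prop :=
  exists sigma, legal_strategy sigma /\
    forall d, div_fully_legal sigma d ->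
      exists i, (fac_pos sigma d i).1 = (fac_pos sigma d i).2.

Definition facilitator_wins_in (tau : nat) : Prop :=
  exists sigma, legal_strategy sigma /\
    forall d, div_fully_legal sigma d ->
      exists i, i <= tau /\ (fac_pos sigma d i).1 = (fac_pos sigma d i).2.

End Game.

Definition Rendezvous : language := fun w =>
  exists (n : nat) (s t : 'I_n) (k : nat) (A : seq bool),
    w = enc_nat n ++ enc_nat s ++ enc_nat t ++ enc_nat k ++ A /\
    valid_graph n A /\ 0 < k /\
    facilitator_wins (@mat_rel n A) s t k.

Definition Rendezvous_in_Time : language := fun w =>
  exists (n : nat) (s t : 'I_n) (k tau : nat) (A : seq bool),
    w = enc_nat n ++ enc_nat s ++ enc_nat t ++ enc_nat k ++ enc_nat tau ++ A /\
    valid_graph n A /\ 0 < k /\ 0 < tau /\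
    facilitator_wins_in (@mat_rel n A) s t k tau.

(* Main.v *)
From HB Require Import structures.
Require Import Defs.
From mathcomp Require Import all_boot zify.
From Stdlib Require Import ClassicalEpsilon FunctionalExtensionality.
Set Implicit Arguments. Unset Strict Implicit. Unset Printing Implicit Defensive.

(** R simulates the given machine [M], with space bound [n], by walking on a track
whose vertices record the state and the head position, while J waits at [t]. The tape
is kept by [n] of Divider's agents: the agent of cell [l] stands on [p a l] when the
cell holds [a]. At each step R announces the scanned symbol [b] and then the symbol [c]
to be written, and the agent of the scanned cell follows along [p b l], [m b l],
[m c l], [p c l]. Two further agents stay next to [t]. An agent that is not in its
place leaves a corridor to [t] open, and R meets J in at most five moves; if all agents
are in their places, a J that leaves [t] gets trapped in a corridor. If R announces a
wrong symbol, the agent of that cell turns into a joker, which guards the accepting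
vertices for the rest of the game, so that lying does not help. Hence Facilitator wins
if and only if [M] accepts, and then within about three moves per configuration. The
track is undirected, but since [M] is deterministic a step back does not change the
outcome. As Divider chooses the initial tape, [M] is preceded by a sweep over the tape
that writes its input.

The reduction is computed in polynomial time by a program with bounded loops over
counters. Each counter is a mark on the tape of a machine that repeatedly searches from
the left end for a cell, edits it and returns. *)

(** * Positional play *)

(** The track lets R walk back to [s], where every cell agent must again stand on the front of its
    start corridor, which a joker cannot reach in one move. This is why a sweep to the right
    precedes the sweep that writes: its state [u] is entered only within that sweep and left only at
    the last cell, so a return to [s] from outside [u] passes every cell in state [u]. There all
    tapes are equivalent, since the input is written later; so a joker may become a symbol again
    when R withdraws an announcement, and the cells ahead of the head stay free of jokers. Outside
    [u] a joker is final. The two agents next to [t] also stop J: when J enters a corridor, one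
    takes [t] and the other may need two moves, over a hub, to close the front. This is in time
    because R is never next to a front without an agent on it. A rejected word leaves Facilitator no
    win at all, so both problems share one graph, and the time bound need only be large: a power of
    two, exponential in value but printed in binary by a loop. *)

HB.lock Definition free (V : finType) (k : nat) (d : dpos V k) (r : V) : bool :=
  [forall a, r != d a].

Lemma freeP (V : finType) k (d : dpos V k) r :
  reflect (forall a, r != d a) (free d r).
Proof. by rewrite unlock; exact: forallP. Qed.

Section Win.
Variables (V : finType) (e : rel V) (k : nat).

Definition div_move (d d' : dpos V k) r j :=
  [forall a, [&& adj_or_eq e (d a) (d' a), d' a != r & d' a != j]].

Fixpoint win_rec m (r j : V) (d : dpos V k) : bool :=
  (r == j) ||
  (if m is m'.+1 then
     [exists p : V * V, [&& adj_or_eq e r p.1, adj_or_eq e j p.2,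
        free d p.1, free d p.2 &
        [forall d', div_move d d' p.1 p.2 ==> win_rec m' p.1 p.2 d']]]
   else false).
End Win.

(* [win e m r j d]: Facilitator, to move, can force a meeting within [m] moves *)
HB.lock Definition win (V : finType) (e : rel V) (k m : nat) (r j : V) (d : dpos V k) :=
  win_rec e m r j d.

Section GameCriteria.
Variables (V : finType) (e : rel V) (k : nat).
Implicit Types (r j : V) (d : dpos V k).

Lemma winE m r j d : win e m r j d = (r == j) ||
  (if m is m'.+1 then
     [exists p : V * V, [&& adj_or_eq e r p.1, adj_or_eq e j p.2,
        free d p.1, free d p.2 &
        [forall d', div_move e d d' p.1 p.2 ==> win e m' p.1 p.2 d']]]
   else false).
Proof.
by rewrite unlock; case: m.
Qed.

Definition win_move m r j d (p : V * V) :=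
  [&& adj_or_eq e r p.1, adj_or_eq e j p.2, free d p.1, free d p.2 &
        [forall d', div_move e d d' p.1 p.2 ==> win e m p.1 p.2 d']].

(** The third component counts the moves left. Standing still is the fallback: legality is demanded
    on every legal history, also after the meeting, and Divider never steps onto R or J. *)
Definition fac_next (x : V * V * nat) d : V * V * nat :=
  let: (r, j, m) := x in
  if (r != j) && [exists p, win_move m.-1 r j d p] then
    if [pick p | win_move m.-1 r j d p] is Some p then (p, m.-1) else x
  else x.

Lemma adj_or_eq_refl x : adj_or_eq e x x.
Proof. by rewrite /adj_or_eq eqxx. Qed.

Lemma fac_next_legal r j m d : free d r -> free d j ->
  [&& adj_or_eq e r (fac_next (r, j, m) d).1.1,
      adj_or_eq e j (fac_next (r, j, m) d).1.2,
      free d (fac_next (r, j, m) d).1.1 & free d (fac_next (r, j, m) d).1.2].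
Proof.
move=> hr hj; rewrite /fac_next; case: ifP => _; last first.
  by rewrite !adj_or_eq_refl hr hj.
case: pickP => [p /and5P[-> -> -> -> _]|_] //=.
by rewrite !adj_or_eq_refl hr hj.
Qed.

Lemma fac_next_win r j m d d' : win e m.+1 r j d -> r != j ->
  div_move e d d' (fac_next (r, j, m.+1) d).1.1 (fac_next (r, j, m.+1) d).1.2 ->
  (fac_next (r, j, m.+1) d).2 = m /\
  win e m (fac_next (r, j, m.+1) d).1.1 (fac_next (r, j, m.+1) d).1.2 d'.
Proof.
rewrite winE => /orP[-> //|ex] rj /=; rewrite rj.
have -> : [exists p, win_move m r j d p] by [].
case: pickP => [p /and5P[_ _ _ _ /forallP h]|h] /= hd.
  by split=> //; apply: (implyP (h d')).
by case/existsP: ex => p; move: (h p); rewrite /win_move => ->.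
Qed.

Lemma facilitator_wins_in_of_win s t tau :
  (forall d, div_init_legal s t d -> win e tau s t d) ->
  facilitator_wins_in e s t k tau.
Proof.
move=> hw; pose st h := foldl fac_next (s, t, tau) h.
pose sigma h := (st h).1; exists sigma.
have stS (d : nat -> dpos V k) i : st [seq d m | m <- iota 0 i.+1]
             = fac_next (st [seq d m | m <- iota 0 i]) (d i).
  by rewrite /st -addn1 iotaD map_cat foldl_cat add0n.
have posE (d : nat -> dpos V k) i : fac_pos s t sigma d i = (st [seq d m | m <- iota 0 i]).1.
  by case: i.
have free_pos (d : nat -> dpos V k) i : div_init_legal s t (d 0) ->
    (forall m, m < i -> div_legal e s t sigma d m) ->
    free (d i) (fac_pos s t sigma d i).1 /\ free (d i) (fac_pos s t sigma d i).2.
  case: i => [|i] h0 hm.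
    by split; apply/freeP=> a; case: (h0 a) => *; rewrite eq_sym.
  by split; apply/freeP=> a; case: (hm i (leqnn _) a) => _ [? ?]; rewrite eq_sym.
have legal : legal_strategy e s t sigma.
  move=> d i h0 hm; have [f1 f2] := free_pos d i h0 hm.
  rewrite /fac_legal !posE stS in f1 f2 *.
  case: (st _) f1 f2 => -[r j] m f1 f2.
  have := fac_next_legal m f1 f2; case: (fac_next _ _) => -[r' j'] m' /=.
  case/and4P=> -> -> /freeP g1 /freeP g2; do 2!split=> //.
split=> // d [h0 hm].
have [//|no] := classic (exists i, i <= tau /\ (fac_pos s t sigma d i).1 = (fac_pos s t sigma d i).2).
(* As long as the agents have not met, each move lowers the counter by one and stays winning; at
   [tau] the counter is 0, where [win] means a meeting. *)
suff key i : i <= tau ->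
    (st [seq d m | m <- iota 0 i]).2 = tau - i /\
    win e (tau - i) (fac_pos s t sigma d i).1 (fac_pos s t sigma d i).2 (d i).
  have [_] := key tau (leqnn _); rewrite subnn winE orbF => /eqP eq.
  by case: no; exists tau.
elim: i => [_|i IH lti]; first by rewrite /= subn0; split=> //; exact: hw.
have [h1 h2] := IH (ltnW lti).
have ne : (fac_pos s t sigma d i).1 != (fac_pos s t sigma d i).2.
  by apply/eqP=> eq; apply: no; exists i; split=> //; exact: ltnW.
have dm : div_move e (d i) (d i.+1) (fac_pos s t sigma d i.+1).1 (fac_pos s t sigma d i.+1).2.
  by apply/forallP=> a; have [-> [-> ->]] := hm i a.
move: h1 h2 ne dm; rewrite !posE stS.
case: (st _) => -[r j] m /= ->; rewrite -[tau - i]prednK ?subn_gt0 //.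
by rewrite -subnS => w ne dm; apply: fac_next_win.
Qed.

(** An invariant of positions with Facilitator to move suffices, although strategies depend on the
    history: against a given [sigma] a single infinite play is built by recursion, choosing each
    reply of Divider from the invariant. *)
Lemma not_facilitator_wins_of_safe s t (safe : V -> V -> dpos V k -> Prop) :
  (exists2 d, div_init_legal s t d & safe s t d) ->
  (forall r j d, safe r j d -> r != j) ->
  (forall r j d r' j', safe r j d -> adj_or_eq e r r' -> adj_or_eq e j j' ->
     free d r' -> free d j' -> exists2 d', div_move e d d' r' j' & safe r' j' d') ->
  ~ facilitator_wins e s t k.
Proof.
move=> [d0 init0 safe0] safe_ne safe_step [sigma [legal wins]].
pose nxt (h : seq (dpos V k)) := epsilon (inhabits d0)
  (fun d' => div_move e (last d0 h) d' (sigma h).1 (sigma h).2 /\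
             safe (sigma h).1 (sigma h).2 d').
pose hist i := iter i (fun h => rcons h (nxt h)) [:: d0].
pose d i := last d0 (hist i).
have histE i : [seq d m | m <- iota 0 i.+1] = hist i.
  elim: i => // i IH; rewrite -addn1 iotaD map_cat IH /= cats1 add0n.
  by rewrite /d /= last_rcons.
have posS i : fac_pos s t sigma d i.+1 = sigma (hist i).
  by rewrite /fac_pos histE.
suff key i : (forall m, m < i -> div_legal e s t sigma d m) /\
    safe (fac_pos s t sigma d i).1 (fac_pos s t sigma d i).2 (d i).
  have dl : div_fully_legal e s t sigma d.
    by split=> // m; apply: (proj1 (key m.+1)).
  by have [i eq] := wins d dl; have := safe_ne _ _ _ (proj2 (key i)); rewrite eq eqxx.
elim: i => [|i [IH1 IH2]]; first by split.
have := legal d i init0 IH1; rewrite /fac_legal.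
case p1: (fac_pos s t sigma d i) => [r j]; case p2: (fac_pos s t sigma d i.+1) => [r' j'].
case=> a1 [a2 fr]; rewrite p1 /= in IH2.
have f1 : free (d i) r' by apply/freeP=> a; case: (fr a).
have f2 : free (d i) j' by apply/freeP=> a; case: (fr a).
have [d' m' s'] := safe_step _ _ _ _ _ IH2 a1 a2 f1 f2.
have [|m1 s1] := epsilon_spec (inhabits d0)
  (fun d' => div_move e (last d0 (hist i)) d' (sigma (hist i)).1 (sigma (hist i)).2 /\
             safe (sigma (hist i)).1 (sigma (hist i)).2 d').
  by exists d'; rewrite -posS p2.
have dS : d i.+1 = nxt (hist i) by rewrite /d /= last_rcons.
have q : sigma (hist i) = (r', j') by rewrite -posS.
move: m1 s1; rewrite -/(nxt (hist i)) -dS q /= => m1 s1; split=> //.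
move=> l; rewrite ltnS leq_eqVlt => /orP[/eqP{l}->|]; last exact: IH1.
move=> a; move/forallP: m1 => /(_ a).
by rewrite p2 => /and3P[].
Qed.

Lemma facilitator_wins_inW s t tau :
  facilitator_wins_in e s t k tau -> facilitator_wins e s t k.
Proof. by case=> sg [h1 h2]; exists sg; split=> // d /h2[i [_ ?]]; exists i. Qed.

End GameCriteria.

(** * Transport of the game along a graph isomorphism *)

Section Transport.
Variables (V V' : finType) (e : rel V) (e' : rel V') (k : nat).
Variables (phi : V' -> V) (psi : V -> V').
Hypotheses (phiK : cancel phi psi) (psiK : cancel psi phi).
Hypothesis eE : forall x y, e' x y = e (phi x) (phi y).

Let phi_inj : injective phi := can_inj phiK.

Definition push_dpos (d : dpos V' k) : dpos V k := [ffun a => phi (d a)].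
Definition pull_dpos (d : dpos V k) : dpos V' k := [ffun a => psi (d a)].

Lemma pull_dposK : cancel pull_dpos push_dpos.
Proof. by move=> d; apply/ffunP=> a; rewrite !ffunE psiK. Qed.

Lemma adj_push x y : adj_or_eq e (phi x) (phi y) = adj_or_eq e' x y.
Proof. by rewrite /adj_or_eq eE (inj_eq phi_inj). Qed.

Lemma free_push d r : free (push_dpos d) (phi r) = free d r.
Proof. by rewrite !unlock; apply: eq_forallb => a; rewrite ffunE (inj_eq phi_inj). Qed.

Lemma div_move_push d d' r j :
  div_move e (push_dpos d) (push_dpos d') (phi r) (phi j) = div_move e' d d' r j.
Proof.
by apply: eq_forallb => a; rewrite !ffunE adj_push !(inj_eq phi_inj).
Qed.

Lemma win_push m r j d : win e m (phi r) (phi j) (push_dpos d) -> win e' m r j d.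
Proof.
elim: m r j d => [|m IH] r j d; rewrite !winE; first by rewrite (inj_eq phi_inj).
rewrite (inj_eq phi_inj) => /orP[->//|/existsP[[r' j'] /=]].
rewrite -[r'](psiK) -[j'](psiK) !adj_push !free_push.
move=> /and5P[a1 a2 f1 f2 /forallP h].
apply/orP; right; apply/existsP; exists (psi r', psi j') => /=.
rewrite a1 a2 f1 f2 /=; apply/forallP=> d'; apply/implyP=> dm.
by apply: IH; apply: (implyP (h _)); rewrite div_move_push.
Qed.

End Transport.

(** * The graph *)

Inductive track (Q S : Type) := Main of Q | W1 of Q & S | W2 of Q & S & S.
Arguments Main {Q S}. Arguments W1 {Q S}. Arguments W2 {Q S}.

Inductive gate (Q S : Type) := GS | GA | GX of track Q S & 'I_3.
Arguments GS {Q S}. Arguments GA {Q S}. Arguments GX {Q S}.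

(* [Kt] and [Ks] are the initial vertices; [Ktheta] and [Kgamma] the places of the two
   agents next to [t]; [Khub] and [Khubs] lead from [Kgamma] to the gates. [Kp a], [Km a],
   [KX a], [KY] hold the agents of the cells, jokers being on [KX a] and [KY]. [KT] is the
   track. From [KB x c], R threatens all gates [GX x c] of the scanned position at once;
   of its three copies, two agents cannot block all. The corridor of the gate [g] is
   [t - KV1 g - KV2 g - KE g]. *)
Inductive kind (Q S : Type) :=
| Kt | Ks | Ktheta | Kgamma | Khub | Khubs | KY
| Kp of S | Km of S | KX of S
| KT of track Q S
| KB of track Q S & 'I_3
| KE of gate Q S | KV2 of gate Q S | KV1 of gate Q S.
Arguments Kt {Q S}. Arguments Ks {Q S}. Arguments Ktheta {Q S}.
Arguments Kgamma {Q S}. Arguments Khub {Q S}. Arguments Khubs {Q S}.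
Arguments KY {Q S}. Arguments Kp {Q S}. Arguments Km {Q S}. Arguments KX {Q S}.
Arguments KT {Q S}. Arguments KB {Q S}. Arguments KE {Q S}.
Arguments KV2 {Q S}. Arguments KV1 {Q S}.

Section KindFinType.
Variables Q S : finType.

Definition track_code (x : track Q S) : Q + (Q * S) + (Q * S * S) :=
  match x with
  | Main q => inl (inl q) | W1 q b => inl (inr (q, b)) | W2 q b c => inr (q, b, c)
  end.
Definition track_decode (x : Q + (Q * S) + (Q * S * S)) : track Q S :=
  match x with
  | inl (inl q) => Main q | inl (inr (q, b)) => W1 q b | inr (q, b, c) => W2 q b c
  end.
Lemma track_codeK : cancel track_code track_decode. Proof. by case. Qed.
HB.instance Definition _ := Finite.copy (track Q S) (can_type track_codeK).

Definition gate_code (g : gate Q S) : option (option (track Q S * 'I_3)) :=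
  match g with GS => None | GA => Some None | GX x c => Some (Some (x, c)) end.
Definition gate_decode (g : option (option (track Q S * 'I_3))) : gate Q S :=
  match g with None => GS | Some None => GA | Some (Some (x, c)) => GX x c end.
Lemma gate_codeK : cancel gate_code gate_decode. Proof. by case. Qed.
HB.instance Definition _ := Finite.copy (gate Q S) (can_type gate_codeK).

Definition kind_code (x : kind Q S) :
  (bool * bool * bool) + (option bool * S) +
  (track Q S + track Q S * 'I_3) + (option bool * gate Q S) :=
  match x with
  | Kt => inl (inl (inl (false, false, false)))
  | Ks => inl (inl (inl (false, false, true)))
  | Ktheta => inl (inl (inl (false, true, false)))
  | Kgamma => inl (inl (inl (false, true, true)))
  | Khub => inl (inl (inl (true, false, false)))
  | Khubs => inl (inl (inl (true, false, true)))
  | KY => inl (inl (inl (true, true, false)))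
  | Kp a => inl (inl (inr (None, a)))
  | Km a => inl (inl (inr (Some true, a)))
  | KX a => inl (inl (inr (Some false, a)))
  | KT x => inl (inr (inl x))
  | KB x c => inl (inr (inr (x, c)))
  | KE g => inr (None, g)
  | KV2 g => inr (Some true, g)
  | KV1 g => inr (Some false, g)
  end.
Definition kind_decode x : kind Q S :=
  match x with
  | inl (inl (inl (false, false, false))) => Kt
  | inl (inl (inl (false, false, true))) => Ks
  | inl (inl (inl (false, true, false))) => Ktheta
  | inl (inl (inl (false, true, true))) => Kgamma
  | inl (inl (inl (true, false, false))) => Khub
  | inl (inl (inl (true, false, true))) => Khubs
  | inl (inl (inl (true, true, _))) => KY
  | inl (inl (inr (None, a))) => Kp a
  | inl (inl (inr (Some true, a))) => Km a
  | inl (inl (inr (Some false, a))) => KX a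
  | inl (inr (inl x)) => KT x
  | inl (inr (inr (x, c))) => KB x c
  | inr (None, g) => KE g
  | inr (Some true, g) => KV2 g
  | inr (Some false, g) => KV1 g
  end.
Lemma kind_codeK : cancel kind_code kind_decode. Proof. by case. Qed.
HB.instance Definition _ := Finite.copy (kind Q S) (can_type kind_codeK).

(* the symbol that the agent of the scanned cell must show *)
Definition shown (x : track Q S) : option S :=
  match x with Main _ => None | W1 _ b => Some b | W2 _ _ b => Some b end.

Definition gate_arity (g : gate Q S) := match g with GS => 1 | GA => 0 | GX _ _ => 2 end.

Definition arity (x : kind Q S) : nat :=
  match x with
  | Kp _ | Km _ | KX _ | KT _ | KB _ _ => 1
  | KE g | KV2 g | KV1 g => gate_arity g
  | _ => 0
  end.
End KindFinType.

Section Graph.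
Variables (Q S : finType) (n' : nat).
Notation n := n'.+1.
Variables (rule : Q -> 'I_n -> S -> option (Q * S * 'I_n)) (u : Q) (acc : pred Q).

(** All kinds carry two indices, so that nested loops can enumerate the vertices. The first is a
    cell or a head position; for the corridors of [GX], the first is the head position and the
    second the guarded cell. *)
Definition vertex := (kind Q S * 'I_n * 'I_n)%type.
HB.instance Definition _ := Finite.on vertex.

Definition wfv (v : vertex) : bool :=
  let: (x, i, j) := v in ((0 < arity x) || (i == ord0)) && ((1 < arity x) || (j == ord0)).

Definition acc_main (x : track Q S) := if x is Main q then acc q else false.

(** One orientation of each edge. A cell agent reaches a gate [GX y] exactly from its proper places:
    [Km a] or [KX a] if its cell is quoted with the symbol [a], and [Kp] or [KY] otherwise. Since
    [KX a] is joined to [Kp b] only for distinct symbols, a symbol turns into a joker only by a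
    wrong quotation, and since [Km] and [KX] are not joined, neither role changes while a quotation
    stands. *)
Definition darc (v v' : vertex) : bool :=
  let: (x, i, j) := v in let: (x', i', j') := v' in
  match x, x' with
  | Kt, Ktheta | Kt, Kgamma | Kt, KV1 _ => true
  | KV1 g, KV2 g' | KV2 g, KE g' => [&& g == g', i == i' & j == j']
  | Ktheta, KB _ _ | Ktheta, Ks | Kgamma, KB _ _ | Kgamma, Ks
  | Kgamma, Khub | Kgamma, Khubs
  | Khub, KE (GX _ _) | Khub, KE GA | Khubs, KE GS
  | Ks, KE GS => true
  | Ks, KT (Main q) => (q == u) && (i' == ord0)
  | KE GS, Kp _ => i == i'
  | KT y, KB y' _ => [&& y == y', i == i' & ~~ acc_main y]
  | KB y c, KE (GX y' c') => [&& y == y', c == c' & i == i']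
  | KE (GX y _), Kp _ => (j == i') && ((shown y == None) || (i != j))
  | KE (GX y _), KY => (shown y == None) || (i != j)
  | KE (GX y _), Km a | KE (GX y _), KX a => [&& j == i', i == j & shown y == Some a]
  | KE GA, KY | KE GA, KX _ => true
  | KE GA, KT y => acc_main y
  | Km a, Kp b => (a == b) && (i == i')
  | KX a, Kp b | Km a, Km b | KX a, KX b => (a != b) && (i == i')
  | KX _, KY => true
  | KT (Main q), KT (W1 q' _) => (q == q') && (i == i')
  | KT (W1 q b), KT (W2 q' b' _) => [&& q == q', b == b' & i == i']
  | KT (W2 q b c), KT (Main q') => rule q i b == Some (q', c, i')
  | _, _ => false
  end.

(* improper vertices (superfluous indices) are pendant vertices at the hub *)
Definition edge : rel vertex := fun v v' =>
  if wfv v && wfv v' then darc v v' || darc v' v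
  else (wfv v && (v == (Khub, ord0, ord0))) || (wfv v' && (v' == (Khub, ord0, ord0))).

Lemma edge_sym : symmetric edge.
Proof. by move=> v v'; rewrite /edge andbC orbC [_ && (v == _) || _]orbC. Qed.

Lemma edge_irr : irreflexive edge.
Proof.
move=> [[x i] j]; rewrite /edge orbb !orbb andbb.
case pr: (wfv _); last by [].
by case: x {pr} => //= [a|a|[]|[]] *; rewrite ?eqxx.
Qed.

Definition vt : vertex := (Kt, ord0, ord0).
Definition vs : vertex := (Ks, ord0, ord0).
Definition vtheta : vertex := (Ktheta, ord0, ord0).
Definition vgamma : vertex := (Kgamma, ord0, ord0).
Definition vhub : vertex := (Khub, ord0, ord0).
Definition vhubs : vertex := (Khubs, ord0, ord0).
Definition vY : vertex := (KY, ord0, ord0).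
Definition vp a (l : 'I_n) : vertex := (Kp a, l, ord0).
Definition vm a (l : 'I_n) : vertex := (Km a, l, ord0).
Definition vX a (l : 'I_n) : vertex := (KX a, l, ord0).
Definition vT x (i : 'I_n) : vertex := (KT x, i, ord0).
Definition vB x c (i : 'I_n) : vertex := (KB x c, i, ord0).

End Graph.

Ltac vcase := case; case; case=> [|||||||?|?|?|[?|? ?|? ? ?]|[?|? ?|? ? ?] ?
  |[||[?|? ?|? ? ?] ?]|[||[?|? ?|? ? ?] ?]|[||[?|? ?|? ? ?] ?]] ? ?.
Ltac bsplit := repeat match goal with
  H : is_true (_ && _) |- _ => let H1 := fresh in let H2 := fresh in case/andP: H => H1 H2
  end.
Ltac bdone := intros; bsplit; first [done | by rewrite eq_sym].

(** * Facilitator's strategy *)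

Section Facilitator.
Variables (Q S : finType) (n' : nat).
Notation n := n'.+1.
Variables (rule : Q -> 'I_n -> S -> option (Q * S * 'I_n)) (u : Q) (acc : pred Q).
Notation vertex := (vertex Q S n').
Notation edge := (edge rule u acc).
Notation darc := (darc rule u acc).
Notation k := n.+2.
Notation win := (win edge).
Notation vt := (vt Q S n').
Notation vs := (vs Q S n').
Notation vtheta := (vtheta Q S n').
Notation vgamma := (vgamma Q S n').
Implicit Types (d : dpos vertex k) (v y r : vertex) (x : track Q S).

Lemma edgeE v v' : wfv v -> wfv v' -> edge v v' = darc v v' || darc v' v.
Proof. by rewrite /edge => -> ->. Qed.

Lemma edge_darc v v' : edge v v' -> wfv v -> v != vhub Q S n' ->
  wfv v' && (darc v v' || darc v' v).
Proof.
rewrite /edge => + pv0 /negbTE nh; rewrite pv0 nh /=.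
by case: ifP => //= pv; rewrite ?pv //= andbF.
Qed.

Lemma edge_TB x c i : ~~ acc_main acc x -> edge (vT x i) (vB x c i).
Proof. by move=> nacc; rewrite edgeE //= !eqxx nacc; case: x nacc. Qed.

Lemma winW m m' r j d : m <= m' -> win m r j d -> win m' r j d.
Proof.
elim: m m' r j d => [|m IH] [|m'] r j d //; rewrite !winE; first by move=> _ /orP[->|].
rewrite ltnS => le /orP[->//|/existsP[p /and5P[a1 a2 f1 f2 h]]].
apply/orP; right; apply/existsP; exists p; rewrite a1 a2 f1 f2 /=.
by apply/forallP=> d'; apply/implyP=> dm; apply: IH le _; apply: (implyP (forallP h d')).
Qed.

Lemma win_eq m r d : win m r r d.
Proof. by rewrite winE eqxx. Qed.

Lemma win_step m r j r' j' d :
  adj_or_eq edge r r' -> adj_or_eq edge j j' -> free d r' -> free d j' ->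
  (forall d', (forall a, [/\ adj_or_eq edge (d a) (d' a), d' a != r' & d' a != j']) ->
     win m r' j' d') ->
  win m.+1 r j d.
Proof.
move=> a1 a2 f1 f2 h; rewrite winE; apply/orP; right; apply/existsP; exists (r', j') => /=.
rewrite a1 a2 f1 f2 /=; apply/forallP=> d'; apply/implyP=> /forallP dm.
by apply: h => a; have /and3P[] := dm a.
Qed.

Lemma adj_edge v v' : edge v v' -> adj_or_eq edge v v'.
Proof. by rewrite /adj_or_eq => ->; rewrite orbT. Qed.

Lemma win1 r j d : edge r j -> free d j -> win 1 r j d.
Proof.
move=> e1 f; apply: (@win_step 0 r j j j) => //; first exact: adj_edge.
  exact: adj_or_eq_refl.
by move=> d' _; apply: win_eq.
Qed.

Lemma adj_V2 g i j v : adj_or_eq edge v (KV2 g, i, j) -> wfv (KV2 g, i, j) ->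
  v \in [:: (KE g, i, j); (KV2 g, i, j); (KV1 g, i, j)].
Proof.
move=> /orP[/eqP-> _|]; first by rewrite !inE eqxx orbT.
rewrite edge_sym => + pg => /edge_darc /(_ pg isT) /andP[_ /orP[]].
  by case: v => [[[]] //= g' i' j'] /and3P[/eqP-> /eqP-> /eqP->]; rewrite inE eqxx.
case: v => [[[||||||||||[]|[]|[]||g'] i'] j'] //= /and3P[/eqP-> /eqP-> /eqP->].
by rewrite !inE eqxx !orbT.
Qed.

Lemma adj_V1 g i j v : adj_or_eq edge v (KV1 g, i, j) -> wfv (KV1 g, i, j) ->
  v \in [:: (KV2 g, i, j); (KV1 g, i, j); vt].
Proof.
move=> /orP[/eqP-> _|]; first by rewrite !inE eqxx orbT.
rewrite edge_sym => + pg => /edge_darc /(_ pg isT) /andP[pv /orP[]].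
  by case: v pv => [[[]] //= g' i' j'] _ /and3P[/eqP-> /eqP-> /eqP->]; rewrite inE eqxx.
case: v pv => [[[||||||||||[]|[]|[]||g'] i'] j'] //= /andP[/eqP-> /eqP->].
by rewrite !inE eqxx !orbT.
Qed.

Definition corridor g i j : seq vertex := [:: (KE g, i, j); (KV2 g, i, j); (KV1 g, i, j)].

(** A corridor can be entered only at its two ends. Once R is on the front and J stays at [t], both
    ends are held, so an empty corridor remains empty. R needs four moves: [KE], [KV2], [KV1],
    [t]. *)
Lemma corridor_walk g i j r d : wfv (KE g, i, j) -> edge r (KE g, i, j) ->
  free d vt -> (forall a, d a \notin corridor g i j) -> win 4 r vt d.
Proof.
move=> pg er ft fc.
have e1 : edge (KE g, i, j) (KV2 g, i, j) by rewrite edgeE //= !eqxx ?orbT.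
have e2 : edge (KV2 g, i, j) (KV1 g, i, j) by rewrite edgeE //= !eqxx ?orbT.
have e3 : edge (KV1 g, i, j) vt by rewrite edgeE //= !eqxx ?orbT.
have ft' (d1 d2 : dpos vertex k) r' :
    (forall a, [/\ adj_or_eq edge (d1 a) (d2 a), d2 a != r' & d2 a != vt]) -> free d2 vt.
  by move=> h; apply/freeP=> a; have [_ _] := h a; rewrite eq_sym.
apply: (@win_step 3 r vt (KE g, i, j) vt) ; rewrite ?adj_or_eq_refl ?adj_edge //.
- by apply/freeP=> a; apply/eqP=> eq; have := fc a; rewrite -eq inE eqxx.
move=> d1 h1.
have f2 a : d1 a != (KV2 g, i, j).
  apply/eqP=> eq; have [ad _ _] := h1 a; rewrite eq in ad.
  by have := fc a; rewrite (adj_V2 ad).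
have f1 a : d1 a != (KV1 g, i, j).
  apply/eqP=> eq; have [ad _ _] := h1 a; rewrite eq in ad.
  have := fc a; move: (adj_V1 ad (pg : wfv (KV1 g, i, j))).
  rewrite !inE => /or3P[->|->|/eqP eqt]; rewrite ?orbT //.
  by move/freeP: ft => /(_ a); rewrite eqt eqxx.
have {}ft := ft' _ _ _ h1.
apply: (@win_step 2 _ vt (KV2 g, i, j) vt) ; rewrite ?adj_or_eq_refl ?adj_edge //.
- by apply/freeP=> a; rewrite eq_sym.
move=> d2 h2.
have g1 a : d2 a != (KV1 g, i, j).
  apply/eqP=> eq; have [ad _ _] := h2 a; rewrite eq in ad.
  have := adj_V1 ad (pg : wfv (KV1 g, i, j)).
  rewrite !inE (negbTE (f1 a)) (negbTE (f2 a)) /= => /eqP eqt.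
  by move/freeP: ft => /(_ a); rewrite eqt eqxx.
have {}ft := ft' _ _ _ h2.
apply: (@win_step 1 _ vt (KV1 g, i, j) vt) ; rewrite ?adj_or_eq_refl ?adj_edge //.
- by apply/freeP=> a; rewrite eq_sym.
move=> d3 h3; apply: win1 => //.
exact: ft' h3.
Qed.

(* [near l v]: vertices an honest agent of cell [l] may occupy one move later *)
Definition near (l : 'I_n) (v : vertex) : bool :=
  let: (x, i, j) := v in
  match x with
  | Kp _ | Km _ | KX _ | KE GS | KV2 GS | KV1 GS => i == l
  | KE (GX _ _) => j == l
  | Kt | Ks | Khubs => true
  | _ => false
  end.

Lemma near_p a l v : adj_or_eq edge (vp Q a l) v -> near l v.
Proof.
move=> /orP[/eqP<-|/edge_darc /(_ isT isT) /andP[_ /orP[]]]; first by rewrite /= eqxx.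
  by move: v; vcase.
by move: v; vcase => //=; bdone.
Qed.

Lemma near_m a l v : adj_or_eq edge (vm Q a l) v -> near l v.
Proof.
move=> /orP[/eqP<-|/edge_darc /(_ isT isT) /andP[_ /orP[]]]; first by rewrite /= eqxx.
  by move: v; vcase => //=; bdone.
by move: v; vcase => //=; bdone.
Qed.

Lemma near_s l v0 v : v0 \in corridor GS l ord0 -> adj_or_eq edge v0 v -> near l v.
Proof.
rewrite !inE => /or3P[] /eqP-> /orP[/eqP<-|]; rewrite ?eqxx //= ?eqxx //.
- by move=> /edge_darc /(_ isT isT) /andP[_ /orP[]]; move: v; vcase => //=; bdone.
- by move=> /edge_darc /(_ isT isT) /andP[_ /orP[]]; move: v; vcase => //=; bdone.
- by move=> /edge_darc /(_ isT isT) /andP[_ /orP[]]; move: v; vcase => //=; bdone.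
Qed.

Definition nearT v := match v.1.1 with Ktheta | Kt | Ks | KB _ _ => true | _ => false end.
Definition nearG v :=
  match v.1.1 with Kgamma | Kt | Ks | KB _ _ | Khub | Khubs => true | _ => false end.

Lemma nearT_theta v : adj_or_eq edge vtheta v -> nearT v.
Proof.
move=> /orP[/eqP<- //|/edge_darc /(_ isT isT) /andP[_ /orP[]]].
  by case: v => [[[]]].
by case: v => [[[|||||||b|b|b|[]|y c|[]|[]|[||y c]] i] j].
Qed.

Lemma nearG_gamma v : adj_or_eq edge vgamma v -> nearG v.
Proof.
move=> /orP[/eqP<- //|/edge_darc /(_ isT isT) /andP[_ /orP[]]].
  by case: v => [[[]]].
by case: v => [[[|||||||b|b|b|[]|y c|[]|[]|[||y c]] i] j].
Qed.

(** Of the neighbours of a gate only [KB] and [KV2] depend on the copy, and neither is [near]. *)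
Lemma edge_GX_near x c c' i l v : near l v ->
  edge (KE (GX x c), i, l) v -> edge (KE (GX x c'), i, l) v.
Proof.
move=> nv /edge_darc /(_ isT isT) /andP[pv h]; rewrite edgeE; [|by []|exact: pv].
by move: v nv h {pv}; vcase.
Qed.

(** Every [near] neighbour of a gate carries a cell index; [KY], which serves all cells at once, is
    out of reach of an honest agent. *)
Lemma edge_GX_other x c i l l' v : l' != l -> near l' v ->
  ~~ edge (KE (GX x c), i, l) v.
Proof.
move=> ne nv; apply/negP=> /edge_darc /(_ isT isT) /andP[pv].
move: v nv pv; vcase => //= /eqP-> _; rewrite ?orbF eq_sym (negbTE ne) ?andbF //.
Qed.

Section Agents.
(* [None] and [Some None] are the agents with homes theta and gamma *)
Notation label := (option (option 'I_n)).
Variable ag : label -> 'I_k.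
Hypothesis ag_surj : forall a, exists lb, a = ag lb.
Implicit Types D : label -> vertex.

Definition located d D := forall lb, d (ag lb) = D lb.

Lemma locate d : exists D, located d D.
Proof. by exists (fun lb => d (ag lb)). Qed.

Definition near_all D :=
  [/\ nearT (D None), nearG (D (Some None)) & forall l, near l (D (Some (Some l)))].

Definition pinned x i D :=
  [/\ D None = vtheta, D (Some None) = vgamma &
      forall l c, edge (KE (GX x c), i, l) (D (Some (Some l)))].

Lemma free_of d D v : located d D -> D None != v -> D (Some None) != v ->
  (forall l, D (Some (Some l)) != v) -> free d v.
Proof.
move=> loc h1 h2 h3; apply/freeP=> a; rewrite eq_sym.
have [[[l|]|] ->] := ag_surj a; rewrite loc; [exact: h3 | exact: h2 | exact: h1].
Qed.

Lemma free_located d D v lb : located d D -> free d v -> D lb != v.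
Proof. by move=> loc /freeP /(_ (ag lb)); rewrite loc eq_sym. Qed.

Lemma moved_located d D d' D' r j : located d D -> located d' D' ->
  (forall a, [/\ adj_or_eq edge (d a) (d' a), d' a != r & d' a != j]) ->
  forall lb, adj_or_eq edge (D lb) (D' lb).
Proof. by move=> loc loc' h lb; have [] := h (ag lb); rewrite loc loc'. Qed.

Lemma free_moved d d' r j :
  (forall a, [/\ adj_or_eq edge (d a) (d' a), d' a != r & d' a != j]) ->
  free d' j.
Proof. by move=> h; apply/freeP=> a; have [_ _] := h a; rewrite eq_sym. Qed.

Lemma nearT_E v v' : nearT v -> ~~ nearT v' -> v != v'.
Proof. by move=> h1 h2; apply: contraNneq h2 => <-. Qed.
Lemma nearG_E v v' : nearG v -> ~~ nearG v' -> v != v'.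
Proof. by move=> h1 h2; apply: contraNneq h2 => <-. Qed.
Lemma near_E l v v' : near l v -> ~~ near l v' -> v != v'.
Proof. by move=> h1 h2; apply: contraNneq h2 => <-. Qed.

Lemma free_copy x i D : exists c, D None != vB x c i /\ D (Some None) != vB x c i.
Proof.
have inj : injective (fun c => vB x c i) by move=> c c' [].
have : ~~ [forall c, vB x c i \in [:: D None; D (Some None)]].
  apply/negP => /forallP h; suff: #|'I_3| <= 2 by rewrite card_ord.
  rewrite cardE -(size_map (fun c => vB x c i)).
  apply: (@uniq_leq_size _ _ [:: D None; D (Some None)]).
    by rewrite map_inj_uniq ?enum_uniq.
  by move=> v /mapP[c _ ->]; exact: h.
rewrite negb_forall => /existsP[c]; rewrite !inE negb_or => /andP[h1 h2].
by exists c; rewrite eq_sym h1 eq_sym h2.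
Qed.

(** J steps onto the abandoned vertex while R steps to a copy of [KB] next to it. No agent may enter
    a vertex held by J, so R joins J there. *)
Lemma unpinned_theta x i d D c : ~~ acc_main acc x -> located d D -> near_all D ->
  free d (vB x c i) -> D None != vtheta -> win 2 (vT x i) vt d.
Proof.
move=> nacc loc [nT nG nl] fB ne.
apply: (@win_step 1 _ _ (vB x c i) vtheta).
- exact/adj_edge/edge_TB.
- by apply: adj_edge; rewrite edgeE.
- exact: fB.
- apply: (free_of loc ne); first exact: nearG_E nG _.
  by move=> l; exact: near_E (nl l) _.
by move=> d' h; apply: win1; [rewrite edgeE //= ?orbT | exact: free_moved h].
Qed.

Lemma unpinned_gamma x i d D c : ~~ acc_main acc x -> located d D -> near_all D ->
  free d (vB x c i) -> D (Some None) != vgamma -> win 2 (vT x i) vt d.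
Proof.
move=> nacc loc [nT nG nl] fB ne.
apply: (@win_step 1 _ _ (vB x c i) vgamma).
- exact/adj_edge/edge_TB.
- by apply: adj_edge; rewrite edgeE.
- exact: fB.
- apply: (free_of loc _ ne); first exact: nearT_E nT _.
  by move=> l; exact: near_E (nl l) _.
by move=> d' h; apply: win1; [rewrite edgeE //= ?orbT | exact: free_moved h].
Qed.

(** From [KB] one move and a corridor remain. The agent of cell [l] is not next to the gate and the
    other agents are too far away, so none of them is in the corridor when R starts the walk: five
    moves in all. *)
Lemma unpinned_cell x i l d D : ~~ acc_main acc x -> located d D -> near_all D ->
  D None = vtheta -> D (Some None) = vgamma -> free d vt ->
  (forall c, ~~ edge (KE (GX x c), i, l) (D (Some (Some l)))) ->
  win 5 (vT x i) vt d.
Proof.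
move=> nacc loc [nT nG nl] eT eG ft nZ.
(* An agent standing on a copy of the gate is not adjacent to that copy, yet blocks it; it blocks
   only one, and another copy serves. *)
have [c hc] : exists c : 'I_3, D (Some (Some l)) != (KE (GX x c), i, l).
  have [e0|] := eqVneq (D (Some (Some l))) (KE (GX x ord0), i, l); last by exists ord0.
  by exists (lift ord0 ord0); rewrite e0; apply/eqP=> -[].
apply: (@win_step 4 _ _ (vB x c i) vt).
- exact/adj_edge/edge_TB.
- exact: adj_or_eq_refl.
- apply: (free_of loc); rewrite ?eT ?eG //.
  by move=> l'; exact: near_E (nl l') _.
- exact: ft.
move=> d' h; apply: (@corridor_walk (GX x c) i l).
- by [].
- by rewrite edgeE //= !eqxx.
- exact: free_moved h.
have [D' loc'] := locate d'.
have ad := moved_located loc loc' h.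
move=> a; have [[[l'|]|] ->] := ag_surj a; rewrite {a}loc'; last first.
- have := ad None; rewrite eT => /nearT_theta nT'.
  by rewrite !inE !negb_or !(nearT_E nT').
- have := ad (Some None); rewrite eG => /nearG_gamma nG'.
  by rewrite !inE !negb_or !(nearG_E nG').
have nvt := free_located (Some (Some l')) loc ft.
have nE : D (Some (Some l')) != (KE (GX x c), i, l).
  have [->//|nell] := eqVneq l' l.
  by apply: near_E (nl l') _; rewrite /= eq_sym.
have {}nZ : ~~ edge (KE (GX x c), i, l) (D (Some (Some l'))).
  by have [->|nell] := eqVneq l' l; [exact: nZ | exact: edge_GX_other nell (nl l')].
have {}ad := ad (Some (Some l')); have {}nl := nl l'.
apply/negP; rewrite !inE => /or3P[] /eqP eq; rewrite {}eq in ad.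
- case/orP: ad => [ad|]; first by rewrite ad in nE.
  by rewrite edge_sym (negbTE nZ).
- have := adj_V2 ad isT; rewrite !inE (negbTE nE) /=.
  by case/orP=> /eqP e2; rewrite e2 in nl.
- have := adj_V1 ad isT; rewrite !inE (negbTE nvt) /=.
  by case/or3P=> // /eqP e2; rewrite e2 in nl.
Qed.

(** The forcing dichotomy behind every move of R along the track: whichever agent is out of place,
    the matching threat is carried out. The bound 6 covers all threats, which take at most five
    moves. *)
Lemma near_pinned x i d D : ~~ acc_main acc x -> located d D -> near_all D ->
  free d vt -> win 6 (vT x i) vt d \/ pinned x i D.
Proof.
move=> nacc loc na ft; have [nT nG nl] := na.
have [c [hT hG]] := free_copy x i D.
have fB : free d (vB x c i).
  by apply: (free_of loc hT hG) => l; exact: near_E (nl l) _.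
have [eT|neT] := eqVneq (D None) vtheta; last first.
  by left; apply: winW (unpinned_theta nacc loc na fB neT).
have [eG|neG] := eqVneq (D (Some None)) vgamma; last first.
  by left; apply: winW (unpinned_gamma nacc loc na fB neG).
have [/forallP hZ|] := boolP [forall l, edge (KE (GX x ord0), i, l) (D (Some (Some l)))].
  by right; split=> // l c'; exact: edge_GX_near (nl l) (hZ l).
rewrite negb_forall => /existsP[l nZ].
left; apply: (@winW 5); first by [].
apply: (unpinned_cell nacc loc na eT eG ft) => c'.
by apply: contra nZ; apply: edge_GX_near; exact: nl.
Qed.

Definition honest_pos x i (tp : 'I_n -> S) l : vertex :=
  if i == l then if shown x is Some b then vm Q b l else vp Q (tp l) l
  else vp Q (tp l) l.

Definition honest x i tp D :=
  [/\ D None = vtheta, D (Some None) = vgamma &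
      forall l, D (Some (Some l)) = honest_pos x i tp l].

Lemma near_honest x i tp D D' : honest x i tp D ->
  (forall lb, adj_or_eq edge (D lb) (D' lb)) -> near_all D'.
Proof.
case=> hT hG hl ad; split.
- by apply: nearT_theta; rewrite -hT.
- by apply: nearG_gamma; rewrite -hG.
move=> l; have := ad (Some (Some l)); rewrite hl /honest_pos.
case: eqP => _; last exact: near_p.
by case: (shown x) => [b|]; [exact: near_m | exact: near_p].
Qed.

Lemma honest_free x i tp d D x' i' : located d D -> honest x i tp D ->
  free d (vT x' i').
Proof.
move=> loc [hT hG hl]; apply: (free_of loc); rewrite ?hT ?hG //.
by move=> l; rewrite hl /honest_pos; case: ifP => _ //; case: (shown x).
Qed.

(** The premise on [honest_pos] says that the only reply which is both possible and pinned is the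
    honest one; any other reply loses within the six moves kept in reserve. *)
Lemma honest_move x i tp x' i' tp' m d D :
  located d D -> honest x i tp D -> free d vt -> edge (vT x i) (vT x' i') ->
  ~~ acc_main acc x' ->
  (forall l y, adj_or_eq edge (honest_pos x i tp l) y ->
     (forall c, edge (KE (GX x' c), i', l) y) -> y = honest_pos x' i' tp' l) ->
  6 <= m ->
  (forall d' D', located d' D' -> honest x' i' tp' D' -> free d' vt ->
     win m (vT x' i') vt d') ->
  win m.+1 (vT x i) vt d.
Proof.
move=> loc hon ft ex nacc compat m6 hw; have [hT hG hl] := hon.
apply: (@win_step m _ _ (vT x' i') vt).
- exact: adj_edge.
- exact: adj_or_eq_refl.
- exact: honest_free loc hon.
- exact: ft.
move=> d' h; have ft' := free_moved h.
have [D' loc'] := locate d'; have ad := moved_located loc loc' h.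
have na := near_honest hon ad.
have [w|[pT pG pl]] := near_pinned i' nacc loc' na ft'; first exact: winW m6 w.
apply: (hw _ _ loc' _ ft'); split; [exact: pT | exact: pG |].
by move=> l; apply: compat; [rewrite -hl | exact: pl].
Qed.

(** When the quotation is correct, the escape to [KX] is closed, because [Kp a] borders [KX b] only
    for [b] different from [a]; so the agent has to follow to [Km a], or stay if its cell is not
    quoted. *)
Lemma hit_p x i l a y : adj_or_eq edge (vp Q a l) y ->
  (forall c, edge (KE (GX x c), i, l) y) -> (i = l -> forall b, shown x = Some b -> b = a) ->
  y = honest_pos x i (fun=> a) l.
Proof.
move=> ad /(_ ord0) /edge_darc /(_ isT isT) /andP[_] ez hb; rewrite /honest_pos.
case/orP: ad => [/eqP ey|].
  move: ez; rewrite -ey /= orbF eqxx /=.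
  have [_|_] := eqVneq i l; last by [].
  by case: (shown x).
move=> /edge_darc /(_ isT isT) /andP[].
move: y ez; vcase => //=; rewrite ?orbF ?andbT // => /and3P[_ /eqP eil /eqP sh] /eqP->.
- by move=> /andP[_ /eqP->]; rewrite sh eil eqxx (hb eil _ sh).
- by move=> /andP[ne _]; rewrite (hb eil _ sh) eqxx in ne.
Qed.

(** [Km] borders neither [KX] nor [KY], so a correctly quoted agent can no longer become a joker: it
    follows to the next quoted symbol, or shows [a] once the quotation ends. *)
Lemma hit_m x i l a y : adj_or_eq edge (vm Q a l) y ->
  (forall c, edge (KE (GX x c), i, l) y) ->
  y = if i == l then (if shown x is Some b then vm Q b l else vp Q a l) else vp Q a l.
Proof.
move=> ad /(_ ord0) /edge_darc /(_ isT isT) /andP[_] ez.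
case/orP: ad => [/eqP ey|].
  by move: ez; rewrite -ey /= orbF => /and3P[_ /eqP-> /eqP->]; rewrite eqxx.
move=> /edge_darc /(_ isT isT) /andP[].
move: y ez; vcase => //=; rewrite ?orbF ?andbT // => ez /eqP->.
- move=> /andP[/eqP-> /eqP <-]; move: ez => /andP[_].
  by have [_|_] := eqVneq i l; case: (shown x).
- by move=> _; move: ez => /and3P[/eqP<- /eqP-> /eqP->]; rewrite eqxx.
Qed.

Definition cfg := (Q * {ffun 'I_n -> S} * 'I_n)%type.

Definition cfg_write (tp : {ffun 'I_n -> S}) i b : {ffun 'I_n -> S} :=
  [ffun l => if l == i then b else tp l].

Definition cfg_step (c : cfg) : cfg :=
  let: (q, tp, i) := c in
  if rule q i (tp i) is Some (q', b, i') then (q', cfg_write tp i b, i') else c.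

Lemma cfg_step_halted m q (tp : {ffun 'I_n -> S}) i : rule q i (tp i) = None ->
  iter m cfg_step (q, tp, i) = (q, tp, i).
Proof. by move=> er; elim: m => //= m ->; rewrite /cfg_step er. Qed.

(** One move after an honest position no agent is in the corridor of [GA]: its front borders jokers,
    the hub and accepting vertices only, and no agent was there. One move and the corridor make
    five. *)
Lemma accept_walk x i tp q' i' d D : located d D -> honest x i tp D -> free d vt ->
  edge (vT x i) (vT (Main q') i') -> acc q' -> win 5 (vT x i) vt d.
Proof.
move=> loc hon ft e2 acq.
apply: (@win_step _ _ _ (vT (Main q') i') vt).
- exact: adj_edge.
- exact: adj_or_eq_refl.
- exact: honest_free loc hon.
- exact: ft.
move=> d' h; have ft' := free_moved h.
have [D' loc'] := locate d'; have ad := moved_located loc loc' h.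
have [nT nG nl] := near_honest hon ad.
apply: (@corridor_walk GA ord0 ord0).
- by [].
- by rewrite edgeE //= acq ?orbT.
- exact: ft'.
move=> a; have [[[l|]|] ->] := ag_surj a; rewrite {a}loc' !inE !negb_or.
- by rewrite !(near_E (nl l)).
- by rewrite !(nearG_E nG).
- by rewrite !(nearT_E nT).
Qed.

Lemma honest_run m q (tp : {ffun 'I_n -> S}) i d D : ~~ acc q ->
  acc (iter m cfg_step (q, tp, i)).1.1 ->
  located d D -> honest (Main q) i tp D -> free d vt ->
  win (3 * m + 10) (vT (Main q) i) vt d.
Proof.
elim: m q tp i d D => [|m IH] q tp i d D nacc.
  by move=> /= h; rewrite h in nacc.
rewrite iterSr => am loc hon ft.
move: am; rewrite {2}/cfg_step; case er: (rule q i (tp i)) => [[[q' b] i']|]; last first.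
  by rewrite cfg_step_halted // => h; rewrite h in nacc.
(* Three track moves per machine step; the constant 10 keeps the reserve required by [honest_move]
   and [accept_walk] at every point of the run. *)
move=> am; have -> : 3 * m.+1 + 10 = (3 * m + 10).+3 by rewrite mulnS !addSn add0n.
apply: (@honest_move _ _ _ (W1 q (tp i)) i tp _ _ _ loc hon ft).
- by rewrite edgeE //= !eqxx.
- by [].
- move=> l y ad ez.
  have /(_ i) hp := @hit_p (W1 q (tp i)) _ l (tp l) y.
  apply: hp ez _; first by move: ad; rewrite /honest_pos; case: ifP.
  by move=> <- b' /= [].
- by rewrite !ltnS addnC.
move=> d1 D1 loc1 hon1 ft1.
apply: (@honest_move _ _ _ (W2 q (tp i) b) i (cfg_write tp i b) _ _ _ loc1 hon1 ft1).
- by rewrite edgeE //= !eqxx.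
- by [].
- move=> l y ad ez; move: ad; rewrite /honest_pos /=.
  have [eil|nil] := eqVneq i l => ad.
    by have := hit_m ad ez; rewrite eil eqxx.
  rewrite ffunE eq_sym (negbTE nil).
  have := hit_p ad ez; rewrite /honest_pos (negbTE nil); apply.
  by move=> eil; rewrite eil eqxx in nil.
- by rewrite !ltnS addnC.
move=> d2 D2 loc2 hon2 ft2.
have e2 : edge (vT (W2 q (tp i) b) i) (vT (Main q') i').
  by rewrite edgeE //= er eqxx.
have [acq'|nacq'] := boolP (acc q').
  apply: (@winW 5); first by rewrite addnC.
  exact: accept_walk loc2 hon2 ft2 e2 acq'.
apply: (honest_move (tp' := cfg_write tp i b) loc2 hon2 ft2 e2 nacq').
- move=> l y ad ez; move: ad; rewrite /honest_pos /= if_same.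
  have [eil|nil] := eqVneq i l => ad.
    by have := hit_m ad ez; rewrite /= if_same /cfg_write ffunE eil eqxx.
  have := hit_p ad ez; rewrite /honest_pos /= if_same; exact.
- by rewrite addnC.
by move=> d3 D3 loc3 hon3 ft3; apply: IH loc3 hon3 ft3.
Qed.

End Agents.

Definition start_region (lb : option (option 'I_n)) (v : vertex) : bool :=
  match lb with
  | None => v == vtheta
  | Some None => v == vgamma
  | Some (Some l) => v \in corridor GS l ord0
  end.

Lemma start_region_inj lb lb' v : start_region lb v -> start_region lb' v -> lb = lb'.
Proof.
have key l v0 : v0 \in corridor GS l ord0 -> (v0.1.2 = l) /\ (v0 != vtheta) && (v0 != vgamma).
  by rewrite !inE => /or3P[] /eqP->.
case: lb lb' => [[l|]|] [[l'|]|] //.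
- by move=> /key[<- _] /key[<- _].
- by move=> /key[_ /andP[_ /negbTE h]] /= h'; rewrite h' in h.
- by move=> /key[_ /andP[/negbTE h _]] /= h'; rewrite h' in h.
- by move=> /= h' /key[_ /andP[_ /negbTE h]]; rewrite h' in h.
- by move=> /eqP->.
- by move=> /= h' /key[_ /andP[/negbTE h _]]; rewrite h' in h.
- by move=> /eqP->.
Qed.

(** There are as many agents as pairwise disjoint regions, so if every region is occupied, each
    contains exactly one agent and the labelling is a bijection. *)
Lemma agents_exist d : (forall lb, exists a, start_region lb (d a)) ->
  exists2 ag : option (option 'I_n) -> 'I_k,
    forall a, exists lb, a = ag lb & forall lb, start_region lb (d (ag lb)).
Proof.
move=> hl; pose ag lb := xchoose (hl lb).
have agP lb : start_region lb (d (ag lb)) := xchooseP (hl lb).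
have ag_inj : injective ag.
  by move=> lb lb' e; apply: start_region_inj (agP lb) _; rewrite e.
have ag_bij : bijective ag.
  by apply: inj_card_bij ag_inj _; rewrite !card_option !card_ord.
by exists ag => // a; have [ag' _ K] := ag_bij; exists (ag' a).
Qed.

Theorem facilitator_strategy m : ~~ acc u ->
  (forall tp, acc (iter m cfg_step (u, tp, ord0)).1.1) ->
  forall d, div_init_legal vs vt d -> win (3 * m + 11) vs vt d.
Proof.
move=> nacc am d hinit.
have ft : free d vt by apply/freeP=> a; have [_] := hinit a; rewrite eq_sym.
(* [s] and [t] have theta and gamma as common neighbours; if either is unoccupied, both agents step
   onto it. *)
have meet v : edge vs v -> edge vt v -> ~~ [exists a, d a == v] -> win (3 * m + 11) vs vt d.
  move=> e1 e2 f; apply: (@winW 1); first by rewrite addnC.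
  have f' : free d v.
    by apply/freeP=> a; move: f; rewrite negb_exists => /forallP /(_ a); rewrite eq_sym.
  apply: (@win_step 0 _ _ v v); [exact: adj_edge|exact: adj_edge|exact: f'|exact: f'|].
  by move=> d' _; apply: win_eq.
have [/existsP[aT /eqP hT]|noT] := boolP [exists a, d a == vtheta]; last first.
  by apply: (meet vtheta _ _ noT); rewrite edgeE.
have [/existsP[aG /eqP hG]|noG] := boolP [exists a, d a == vgamma]; last first.
  by apply: (meet vgamma _ _ noG); rewrite edgeE.
have [/forallP hl|] := boolP [forall l, exists a, d a \in corridor GS l ord0]; last first.
  rewrite negb_forall => /existsP[l]; rewrite negb_exists => /forallP nol.
  apply: (@winW 4); first by rewrite addnC.
  by apply: corridor_walk ft nol; [|rewrite edgeE].
have [lb|ag surj region] := @agents_exist d.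
  case: lb => [[l|]|]; [|by exists aG; apply/eqP | by exists aT; apply/eqP].
  by have /existsP[a ha] := hl l; exists a; exact: ha.
have [D loc] := locate ag d.
have {}region lb : start_region lb (D lb) by rewrite -loc.
have /eqP pT := region None; have /eqP pG := region (Some None).
have pl l := region (Some (Some l)).
rewrite addnS; apply: (@win_step _ _ _ (vT (Main u) ord0) vt).
- by apply: adj_edge; rewrite edgeE //= !eqxx.
- exact: adj_or_eq_refl.
- apply: (free_of surj loc); rewrite ?pT ?pG // => l.
  by apply/eqP=> e; move: (pl l); rewrite e.
- exact: ft.
move=> d' h; have ft' := free_moved h.
have [D' loc'] := locate ag d'; have ad := moved_located loc loc' h.
have na : near_all D'.
  split.
  - by apply: nearT_theta; rewrite -pT.
  - by apply: nearG_gamma; rewrite -pG.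
  by move=> l; apply: (near_s (pl l)).
have [w|[qT qG ql]] := near_pinned surj (x := Main u) ord0 nacc loc' na ft'.
  by apply: winW w; rewrite addnC.
(* Coming from its start corridor, a pinned cell agent must stand on some [Kp a] of its cell, which
   fixes the tape. This is why the start gates have the separate hub [Khubs]: from [Khub] an agent
   would be next to every gate without showing a symbol. *)
have symb l : exists a, D' (Some (Some l)) == vp Q a l.
  have [_ _ nl] := na.
  have := ql l ord0; move=> /edge_darc /(_ isT isT) /andP[].
  move: (D' _) (nl l); vcase => //=; rewrite ?andbF // => /eqP-> /eqP-> _.
  by eexists; apply/eqP; reflexivity.
pose tp : {ffun 'I_n -> S} := [ffun l => xchoose (symb l)].
apply: (honest_run surj nacc (am tp) loc' _ ft'); split; [exact: qT|exact: qG|].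
by move=> l; rewrite /honest_pos if_same ffunE; apply/eqP/(xchooseP (symb l)).
Qed.

End Facilitator.

(** * Divider's strategy *)

Section Divider.
Variables (Q S : finType) (n' : nat).
Notation n := n'.+1.
Variables (rule : Q -> 'I_n -> S -> option (Q * S * 'I_n)) (u : Q) (acc : pred Q).
Notation vertex := (vertex Q S n').
Notation edge := (edge rule u acc).
Notation adj := (adj_or_eq edge).
Notation k := n.+2.
Notation vt := (vt Q S n').
Notation vs := (vs Q S n').
Notation vtheta := (vtheta Q S n').
Notation vgamma := (vgamma Q S n').
Notation vY := (vY Q S n').
Notation vGA := ((KE GA, ord0, ord0) : vertex).
Implicit Types (d : dpos vertex k) (v y r : vertex) (x : track Q S).

Variables (a0 : S) (oth : S -> S).
Hypothesis oth_neq : forall b, oth b != b.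

Definition bad (c : cfg Q S n') := forall m, ~~ acc (iter m (cfg_step rule) c).1.1.

(** Any tape and any head position are lost for R in the state [u]. The next two hypotheses make [u]
    a sweep to the right over the whole tape, so that no cell lies ahead of the head when R
    re-enters [u] backwards. *)
Hypothesis bad_u : forall tp i, bad (u, tp, i).
Hypothesis rule_into_u : forall q i b c i',
  rule q i b = Some (u, c, i') -> q = u /\ i' = i.+1 :> nat.
Hypothesis rule_from_u : forall q i b c i',
  rule u i b = Some (q, c, i') -> q != u -> i = n' :> nat.
Hypothesis acc_halts : forall q i a, acc q -> rule q i a = None.

Lemma bad_step c : bad c -> bad (cfg_step rule c).
Proof. by move=> h m; have := h m.+1; rewrite iterSr. Qed.

(** For moves of R against the direction of the machine. An accepting configuration halts and equals
    its own successor, so a predecessor of a bad configuration is bad, whether or not it occurred in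
    the run. *)
Lemma bad_of_step c : bad (cfg_step rule c) -> bad c.
Proof.
move=> h [|m]; last by rewrite iterSr.
apply/negP => /= ac; have /negP[] := h 0.
by move: c ac {h} => [[q tp] i] /= ac; rewrite acc_halts.
Qed.

Definition tstate x := match x with Main q => q | W1 q _ => q | W2 q _ _ => q end.

(* A cell agent shows a symbol, or is a joker ([None]) after R misquoted its cell. *)
Implicit Types cs : {ffun 'I_n -> option S}.

Definition cell_pos x (i : 'I_n) cs l : vertex :=
  if i == l then
    match shown x, cs l with
    | Some b, Some _ => vm Q b l
    | Some b, None => vX Q b l
    | None, Some a => vp Q a l
    | None, None => vY
    end
  else if cs l is Some a then vp Q a l else vY.

Definition shown_tape cs : {ffun 'I_n -> S} := [ffun l => odflt a0 (cs l)].

(** During an announcement the scanned symbol is taken from the track vertex, because at [W2] the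
    agent already shows the symbol to be written; the configuration is the one before the step. *)
Definition cfg_of x i cs : cfg Q S n' :=
  match x with
  | Main q => (q, shown_tape cs, i)
  | W1 q b | W2 q b _ => (q, cfg_write (shown_tape cs) i b, i)
  end.

(** A joker anywhere makes the configuration immaterial. The second clause looks after a return to
    [s]: at cell 0 in [Main u] it says that no agent is a joker. *)
Definition good x (i : 'I_n) cs :=
  [/\ (exists l, cs l = None) \/ bad (cfg_of x i cs),
      tstate x = u -> forall l : 'I_n, (shown x == None) && (i == l) || (i < l) -> cs l != None &
      forall b, shown x = Some b -> cs i = Some b \/ cs i = None].

Lemma adjE v v' : wfv v -> wfv v' ->
  adj v v' = [|| v == v', darc rule u acc v v' | darc rule u acc v' v].
Proof. by move=> p p'; rewrite /adj_or_eq edgeE. Qed.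

Lemma adj_sym v v' : adj v v' = adj v' v.
Proof. by rewrite /adj_or_eq eq_sym edge_sym. Qed.

Lemma adj_refl v : adj v v. Proof. exact: adj_or_eq_refl. Qed.

Lemma adj_YX b l : adj vY (vX Q b l).
Proof. by rewrite adjE. Qed.
Lemma adj_pm a l : adj (vp Q a l) (vm Q a l).
Proof. by rewrite adjE //= !eqxx ?orbT. Qed.
Lemma adj_pX a b l : a != b -> adj (vp Q a l) (vX Q b l).
Proof. by move=> ne; rewrite adjE //= eq_sym ne eqxx ?orbT. Qed.
Lemma adj_mm a b l : adj (vm Q a l) (vm Q b l).
Proof. by have [->|ne] := eqVneq a b; [exact: adj_refl | rewrite adjE //= ne eqxx ?orbT]. Qed.
Lemma adj_XX a b l : adj (vX Q a l) (vX Q b l).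
Proof. by have [->|ne] := eqVneq a b; [exact: adj_refl | rewrite adjE //= ne eqxx ?orbT]. Qed.
Lemma adj_GAY : adj vGA vY.
Proof. by rewrite adjE. Qed.
Lemma adj_GAX b l : adj vGA (vX Q b l).
Proof. by rewrite adjE. Qed.

Lemma track_edge x i x' i' : edge (vT x i) (vT x' i') ->
  match x, x' with
  | Main q, W1 q' _ | W1 q _, Main q' => q = q' /\ i = i'
  | W1 q b, W2 q' b' _ | W2 q b _, W1 q' b' => [/\ q = q', b = b' & i = i']
  | W2 q b c, Main q' => rule q i b = Some (q', c, i')
  | Main q, W2 q' b c => rule q' i' b = Some (q, c, i)
  | _, _ => False
  end.
Proof.
move=> /edge_darc /(_ isT isT) /andP[_] /=.
case: x x' => [q|q b|q b c] [q'|q' b'|q' b' c'] //=; rewrite ?orbF.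
- by case/andP=> /eqP-> /eqP->.
- by move/eqP.
- by case/andP=> /eqP-> /eqP->.
- by case/and3P=> /eqP-> /eqP-> /eqP->.
- by move/eqP.
- by case/and3P=> /eqP-> /eqP-> /eqP->.
Qed.

(* A misquoted cell becomes a joker; a joker misquoted in the state [u], where the tape
   is still irrelevant, turns back into a symbol when R withdraws the announcement. *)
Definition recast x (i : 'I_n) x' (i' : 'I_n) cs : {ffun 'I_n -> option S} :=
  match x, x' with
  | Main _, W1 _ b | Main _, W2 _ _ b =>
    [ffun l => if l == i' then (if cs l == Some b then Some b else None) else cs l]
  | W1 _ _, W2 _ _ b | W2 _ _ _, W1 _ b =>
    [ffun l => if l == i then (if cs l is Some _ then Some b else None) else cs l]
  | W1 q b, Main _ =>
    [ffun l => if (l == i) && (q == u) then Some (odflt (oth b) (cs l)) else cs l]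
  | _, _ => cs
  end.

Lemma recast_good x i cs x' i' : good x i cs -> edge (vT x i) (vT x' i') ->
  good x' i' (recast x i x' i' cs).
Proof.
move=> [sem hu hs] /track_edge.
have tape_set (b : S) j : cs j = Some b -> cfg_write (shown_tape cs) j b = shown_tape cs.
  by move=> e; apply/ffunP=> l; rewrite !ffunE; case: eqP => // ->; rewrite e.
case: x x' sem hu hs => [q|q b|q b c] [q'|q' b'|q' b' c'] //= sem hu hs.
- case=> <- <-; split=> /=.
  + case e: (cs i == Some b'); last by left; exists i; rewrite ffunE eqxx e.
    case: sem => [[l el]|sem].
      by left; exists l; rewrite ffunE el /= if_same.
    right; have -> : [ffun l => if l == i then if cs l == Some b' then Some b' else None else cs l] = cs.
      by apply/ffunP=> l; rewrite ffunE; have [->|//] := eqVneq l i; rewrite e (eqP e).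
    by rewrite tape_set //; apply/eqP.
  + move=> qu l il; rewrite ffunE; have [eli|_] := eqVneq l i; first by rewrite eli ltnn in il.
    by apply: hu; rewrite // il orbT.
  + by move=> _ [<-]; rewrite ffunE eqxx; case: ifP; [left | right].
(* R steps back from [Main] to some [W2]. If the cell does not show the symbol supposed to have been
   written, its agent becomes a joker; otherwise the new configuration is a predecessor of the old
   one. *)
- move=> er; split=> /=.
  + case e: (cs i' == Some c'); last by left; exists i'; rewrite ffunE eqxx e.
    case: sem => [[l el]|sem].
      by left; exists l; rewrite ffunE el /= if_same.
    right; have -> : [ffun l => if l == i' then if cs l == Some c' then Some c' else None else cs l] = cs.
      by apply/ffunP=> l; rewrite ffunE; have [->|//] := eqVneq l i'; rewrite e (eqP e).
    apply: bad_of_step; rewrite /= {1}/cfg_write ffunE eqxx er.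
    suff -> : cfg_write (cfg_write (shown_tape cs) i' b') i' c' = shown_tape cs by [].
    apply/ffunP=> l; rewrite /cfg_write !ffunE; case: eqP => // ->.
    by rewrite (eqP e).
  + move=> qu l il; rewrite ffunE; have [eli|_] := eqVneq l i'; first by rewrite eli ltnn in il.
    subst q'; have [eq|neq] := eqVneq q u.
      subst q; have [_ ei] := rule_into_u er.
      apply: hu => //; move: il; rewrite -ei -val_eqE /=.
      by rewrite leq_eqVlt.
    (* Re-entering [u] from another state takes place at the last cell, so no cell lies ahead. *)
    have ei := rule_from_u er neq.
    by have := ltn_ord l; rewrite ltnS leqNgt -[X in X < _]ei il.
  + by move=> _ [<-]; rewrite ffunE eqxx; case: ifP; [left | right].
- case=> <- <-; have [qu|nqu] := eqVneq q u; split=> /=.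
  (* In state [u] every tape is bad, so even the last joker may be given up. *)
  + by right; rewrite qu; exact: bad_u.
  + move=> _ l; rewrite ffunE andbT eq_sym; case: eqP => //= _ il.
    by apply: hu; rewrite // -qu.
  + by [].
  + case: sem => [[l el]|sem].
      by left; exists l; rewrite ffunE andbF.
    case: (hs _ erefl) => ei; last by left; exists i; rewrite ffunE andbF.
    right; have -> : [ffun l => if (l == i) && false then Some (odflt (oth b) (cs l)) else cs l] = cs.
      by apply/ffunP=> l; rewrite ffunE andbF.
    by rewrite -(tape_set b i).
  + by move=> qu; rewrite qu eqxx in nqu.
  + by [].
- case=> <- <- <-; split=> /=.
  + case: sem => [[l el]|sem].
      by left; exists l; rewrite ffunE el if_same.
    case: (hs _ erefl) => ei; last by left; exists i; rewrite ffunE eqxx ei.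
    right; suff -> : cfg_write (shown_tape [ffun l => if l == i then if cs l is Some _ then Some c' else None else cs l]) i b
       = cfg_write (shown_tape cs) i b by [].
    by apply/ffunP=> l; rewrite /cfg_write !ffunE; case: eqP.
  + move=> qu l il; rewrite ffunE; have [eli|_] := eqVneq l i; first by rewrite eli ltnn in il.
    exact: hu.
  + by move=> _ [<-]; rewrite ffunE eqxx; case: (cs i); [left | right].
(* The machine step is completed: the agents now show the successor configuration, unless there is a
   joker. *)
- move=> er; split=> /=; last by [].
  + case: sem => [|sem]; first by left.
    case: (hs _ erefl) => ei; last by left; exists i.
    right; have := bad_step sem; rewrite /= {1}/cfg_write ffunE eqxx er.
    suff -> : cfg_write (cfg_write (shown_tape cs) i b) i c = shown_tape cs by [].
    apply/ffunP=> l; rewrite /cfg_write !ffunE; case: eqP => // ->.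
    by rewrite ei.
  + move=> qu l; rewrite qu in er; have [qu' ei] := rule_into_u er.
    by rewrite -val_eqE /= ei -leq_eqVlt; exact: hu.
- case=> <- <- <-; split=> /=.
  + case: sem => [[l el]|sem].
      by left; exists l; rewrite ffunE el if_same.
    case: (hs _ erefl) => ei; last by left; exists i; rewrite ffunE eqxx ei.
    right; suff -> : cfg_write (shown_tape [ffun l => if l == i then if cs l is Some _ then Some b else None else cs l]) i b
       = cfg_write (shown_tape cs) i b by [].
    by apply/ffunP=> l; rewrite /cfg_write !ffunE; case: eqP.
  + move=> qu l il; rewrite ffunE; have [eli|_] := eqVneq l i; first by rewrite eli ltnn in il.
    exact: hu.
  + by move=> _ [<-]; rewrite ffunE eqxx; case: (cs i); [left | right].
Qed.

Lemma adj_requote a b l :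
  adj (if a is Some a' then vp Q a' l else vY)
      (if (if a == Some b then Some b else None) is Some _ then vm Q b l else vX Q b l).
Proof.
case: a => [a|]; last exact: adj_YX.
by case: eqP => [[->]|/eqP ne]; [exact: adj_pm | apply: adj_pX; apply: contra ne => /eqP->].
Qed.

Lemma recast_adj x i cs x' i' : good x i cs -> edge (vT x i) (vT x' i') ->
  forall l, adj (cell_pos x i cs l) (cell_pos x' i' (recast x i x' i' cs) l).
Proof.
move=> [_ _ hs] /track_edge + l.
case: x x' hs => [q|q b|q b c] [q'|q' b'|q' b' c'] //= hs.
- case=> _ <-; rewrite /cell_pos /= ffunE if_same (eq_sym l i).
  by case: (i == l); [exact: adj_requote | exact: adj_refl].
- move=> _; rewrite /cell_pos /= ffunE if_same (eq_sym l i').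
  by case: (i' == l); [exact: adj_requote | exact: adj_refl].
- case=> _ <-; rewrite /cell_pos /= ffunE if_same (eq_sym l i).
  have [<-|_] /= := eqVneq i l; last exact: adj_refl.
  case: (hs _ erefl) => ->; first by rewrite if_same adj_sym adj_pm.
  case: (q == u) => /=; first by rewrite adj_sym adj_pX.
  by rewrite adj_sym adj_YX.
- case=> _ _ <-; rewrite /cell_pos /= ffunE (eq_sym l i).
  case: (i == l); last exact: adj_refl.
  by case: (cs l) => [a|]; [exact: adj_mm | exact: adj_XX].
- move=> _; rewrite /cell_pos /= if_same.
  have [<-|_] /= := eqVneq i l; last exact: adj_refl.
  by case: (hs _ erefl) => ->; rewrite adj_sym ?adj_pm ?adj_YX.
- case=> _ _ <-; rewrite /cell_pos /= ffunE (eq_sym l i).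
  case: (i == l); last exact: adj_refl.
  by case: (cs l) => [a|]; [exact: adj_mm | exact: adj_XX].
Qed.

(** The [Main] case is used on arrival at an accepting vertex: the joker found there was a joker one
    move earlier, hence already next to the front of [GA]. *)
Lemma recast_joker x i cs x' i' l : edge (vT x i) (vT x' i') ->
  if x' is Main _ then recast x i x' i' cs l = None -> cs l = None
  else cs l = None -> recast x i x' i' cs l = None.
Proof.
move=> /track_edge.
case: x x' => [q|q b|q b c] [q'|q' b'|q' b' c'] //= _; rewrite !ffunE.
- by move=> ->; rewrite if_same.
- by move=> ->; rewrite if_same.
- by case: ifP.
- by move=> ->; rewrite if_same.
- by move=> ->; rewrite if_same.
Qed.

(** Where R is next to gate fronts (at [s], on [KB], on an accepting vertex), agents stand on all of
    these fronts. Elsewhere on the track it is enough that each agent is next to the gates of its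
    cell. *)
Inductive guarded r (f : 'I_n -> vertex) : Prop :=
| Guard_s of r = vs & forall l, f l = (KE GS, l, ord0)
| Guard_T x i cs of r = vT x i & ~~ acc_main acc x & good x i cs &
    forall l, f l = cell_pos x i cs l
| Guard_A x i cs l0 of r = vT x i & acc_main acc x & good x i cs & cs l0 = None &
    forall l, f l = if l == l0 then vGA else cell_pos x i cs l
| Guard_B x c i cs of r = vB x c i & ~~ acc_main acc x & good x i cs &
    forall l, f l = (KE (GX x c), i, l).

Definition cell_place v := match v.1.1 with
  | Kp _ | Km _ | KX _ | KY | KE _ => true | _ => false end.
Definition runner_place v := match v.1.1 with
  | Ks | KT _ | KB _ _ => true | _ => false end.

Lemma cell_posP x i cs l : cell_place (cell_pos x i cs l).
Proof.
by rewrite /cell_pos; case: (i == l); case: (shown x) => [b|]; case: (cs l).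
Qed.

Lemma guarded_cells r f l : guarded r f -> cell_place (f l).
Proof.
case=> [_ h|x i cs _ _ _ h|x i cs l0 _ _ _ _ h|x c i cs _ _ _ h]; rewrite h //.
  exact: cell_posP.
by case: (l == l0) => //; exact: cell_posP.
Qed.

Lemma guarded_runner r f : guarded r f -> runner_place r && wfv r.
Proof. by case=> [->|x i cs ->|x i cs l0 ->|x c i cs ->]. Qed.

(** An accepting state refutes [bad] after 0 steps, which leaves the alternative of a joker. *)
Lemma acc_main_joker x i cs : acc_main acc x -> good x i cs -> exists l, cs l = None.
Proof. by case: x => //= q aq [[//|/(_ 0)] /=]; rewrite aq. Qed.

Lemma edge_GX_pos x c i cs l : good x i cs -> edge (KE (GX x c), i, l) (cell_pos x i cs l).
Proof.
move=> [_ _ hs]; rewrite /cell_pos; have [eil|nil] := eqVneq i l.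
  subst l; case e: (shown x) hs => [b|] hs.
    by case: (cs i) => [a|]; rewrite edgeE //= e !eqxx.
  by case: (cs i) => [a|]; rewrite edgeE //= e !eqxx.
by case: (cs l) => [a|]; rewrite edgeE //= nil orbT ?eqxx.
Qed.

Lemma guarded_stay r f : guarded r f -> exists2 f', guarded r f' & forall l, adj (f l) (f' l).
Proof. by move=> g; exists f => // l; exact: adj_refl. Qed.

Lemma edge_T x i r : edge (vT x i) r ->
  [\/ exists x' i', r = vT x' i', exists2 c, ~~ acc_main acc x & r = vB x c i,
      [/\ r = vs, x = Main u & i = ord0] | r = vGA /\ acc_main acc x].
Proof.
move=> /edge_darc /(_ isT isT) /andP[]; case: r; case; case=> [|||||||a|a|a|x'|x' c|[||x' c]|g|g] i' j' //=;
  rewrite ?orbF; try by case: (x).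
- by move=> /andP[/eqP-> /eqP->]; case: x => //= q /andP[/eqP-> /eqP->]; constructor 3.
- by move=> /eqP-> _; constructor 1; exists x', i'.
- move=> /eqP-> h; constructor 2; exists c.
    by move: h; case: x => [q|q b|q b d] /and3P[].
  by move: h; case: x => [q|q b|q b d] /and3P[/eqP<- /eqP<-].
- by move=> /andP[/eqP-> /eqP->] h; constructor 4; split=> //; case: x h.
Qed.

Lemma edge_s r : edge vs r ->
  [\/ r = vtheta, r = vgamma, exists l, r = (KE GS, l, ord0) | r = vT (Main u) ord0].
Proof.
move=> /edge_darc /(_ isT isT) /andP[].
move: r; vcase => //=; rewrite ?orbF.
- by move=> /andP[/eqP-> /eqP->]; constructor 1.
- by move=> /andP[/eqP-> /eqP->]; constructor 2.
- by move=> /eqP-> /andP[/eqP-> /eqP->]; constructor 4.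
- by move=> /eqP-> _; constructor 3; eexists.
Qed.

Lemma edge_B x c i r : edge (vB x c i) r ->
  [\/ r = vtheta, r = vgamma, r = vT x i | exists l, r = (KE (GX x c), i, l)].
Proof.
move=> /edge_darc /(_ isT isT) /andP[]; case: r; case;
  case=> [|||||||a|a|a|x'|x' c'|[||x' c']|g|g] i' j' //=; rewrite ?orbF.
- by move=> /andP[/eqP-> /eqP->]; constructor 1.
- by move=> /andP[/eqP-> /eqP->]; constructor 2.
- move=> /eqP->; case: x' => [q|q b|q b d] /and3P[/eqP<- /eqP<- _]; by constructor 3.
- by move=> _ /and3P[/eqP<- /eqP<- /eqP<-]; constructor 4; exists j'.
Qed.

Lemma nacc_u : ~~ acc u.
Proof. exact: (bad_u [ffun=> a0] ord0 0). Qed.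

Lemma adj_GA_joker x i cs l : cs l = None -> adj vGA (cell_pos x i cs l).
Proof.
rewrite /cell_pos => ->; case: (i == l); last exact: adj_GAY.
by case: (shown x) => [b|]; [exact: adj_GAX | exact: adj_GAY].
Qed.

Lemma guarded_track x i cs f x' i' : good x i cs -> edge (vT x i) (vT x' i') ->
  (forall l, adj (f l) (cell_pos x' i' (recast x i x' i' cs) l)) ->
  (forall l, acc_main acc x' -> cs l = None -> adj (f l) vGA) ->
  exists2 f', guarded (vT x' i') f' & forall l, adj (f l) (f' l).
Proof.
move=> hg ex had hacc; have hg' := recast_good hg ex.
have [aq|naq] := boolP (acc_main acc x'); last first.
  exists (cell_pos x' i' (recast x i x' i' cs)) => //.
  exact: (@Guard_T _ _ x' i' (recast x i x' i' cs)).
have [l0 e0] := acc_main_joker aq hg'.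
exists (fun l => if l == l0 then vGA else cell_pos x' i' (recast x i x' i' cs) l).
  exact: (@Guard_A _ _ x' i' (recast x i x' i' cs) l0).
move=> l; case: eqP => [->|_]; last exact: had.
apply: hacc => //; have := recast_joker cs l0 ex.
by case: (x') aq e0 => // q _ e0 /(_ e0).
Qed.

Lemma guarded_step r f r' : guarded r f -> adj r r' -> r' != vtheta -> r' != vgamma ->
  (forall l, r' != f l) -> exists2 f', guarded r' f' & forall l, adj (f l) (f' l).
Proof.
move=> gd /orP[/eqP<-|er] nT nG nf; first exact: guarded_stay.
move: er; case: gd => [-> hf|x i cs -> nacc hg hf|x i cs l0 -> aq hg e0 hf|x c i cs -> nacc hg hf].
- case/edge_s => [e|e|[l e]|e]; [by rewrite e eqxx in nT|by rewrite e eqxx in nG| |].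
    by have := nf l; rewrite hf e eqxx.
  (* Divider starts from the constant tape; any tape would do, by [bad_u]. *)
  rewrite e; exists (vp Q a0); last first.
    by move=> l; rewrite hf adjE //= !eqxx ?orbT.
  pose cs : {ffun 'I_n -> option S} := [ffun l => Some a0].
  apply: (@Guard_T _ _ (Main u) ord0 cs) => //; first exact: nacc_u.
    split=> //; first by right; exact: bad_u.
    by move=> _ l _; rewrite ffunE.
  by move=> l; rewrite /cell_pos ffunE /= if_same.
- move=> er; case/edge_T: (er) => [[x' [i' e]]|[c _ e]|[e ex ei]|[_ aq]].
  + rewrite e in er *; apply: (guarded_track hg er) => l; rewrite hf.
      exact: recast_adj.
    by move=> _ el; rewrite adj_sym; exact: adj_GA_joker.
  + rewrite e; exists (fun l => (KE (GX x c), i, l)).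
      exact: (@Guard_B _ _ x c i cs).
    by move=> l; rewrite hf adj_sym; apply/adj_edge/edge_GX_pos.
  (* R returns to [s]. With the head on cell 0 and nothing announced, the clause of [good] on [u]
     covers all cells, so every agent stands on some [Kp] and can step to its start gate. *)
  + rewrite e; exists (fun l => (KE GS, l, ord0)); first exact: Guard_s.
    move=> l; rewrite hf adj_sym; subst x i; have [_ hu _] := hg.
    have /= := hu erefl l; rewrite /cell_pos /= if_same -leq_eqVlt leq0n => /(_ isT).
    by case: (cs l) => // a _; rewrite adjE //= eqxx.
  + by rewrite aq in nacc.
- move=> er; case/edge_T: (er) => [[x' [i' e]]|[c nacc e]|[e ex ei]|[e _]].
  + rewrite e in er *.
    have nq : ~~ acc_main acc x'.
      by case: (x) aq er => // q _ /track_edge; case: (x').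
    apply: (guarded_track hg er) => l; last by rewrite (negbTE nq).
    rewrite hf; case: eqP => [->|_]; last exact: recast_adj.
    apply: adj_GA_joker; have := recast_joker cs l0 er.
    case: (x') nq er => [q|q b|q b c]; [|by move=> _ _; apply..].
    by case: (x) aq => // q0 _ _ /track_edge.
  + by rewrite aq in nacc.
  + by move: aq; rewrite ex /= (negbTE nacc_u).
  + by have := nf l0; rewrite hf eqxx e eqxx.
- case/edge_B => [e|e|e|[l e]]; [by rewrite e eqxx in nT|by rewrite e eqxx in nG| |].
    rewrite e; exists (cell_pos x i cs); first exact: (@Guard_T _ _ x i cs).
    by move=> l; rewrite hf; apply/adj_edge/edge_GX_pos.
  by have := nf l; rewrite hf e eqxx.
Qed.

(** This gives Divider the time to close a corridor behind J: R cannot enter an unoccupied front in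
    its next move. *)
Lemma guarded_front r f g i j : guarded r f -> edge r (KE g, i, j) ->
  exists l, f l = (KE g, i, j).
Proof.
case=> [-> hf|x i0 cs -> nacc hg hf|x i0 cs l0 -> aq hg e0 hf|x c i0 cs -> nacc hg hf].
- by case/edge_s=> [//|//|[l [-> -> ->]]|//]; exists l.
- case/edge_T=> [[x' [i' e]]|[c _ e]|[e ex ei]|[_ aq]] //.
  by rewrite aq in nacc.
- case/edge_T=> [[x' [i' e]]|[c _ e]|[e ex ei]|[[-> -> ->] _]] //.
  by exists l0; rewrite hf eqxx.
- by case/edge_B => [//|//|//|[l [-> -> ->]]]; exists l.
Qed.

Lemma edge_t v : edge vt v ->
  [\/ v = vtheta, v = vgamma | exists g i j, wfv (KV1 g, i, j) /\ v = (KV1 g, i, j)].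
Proof.
move=> /edge_darc /(_ isT isT) /andP[pv]; move: v pv; case; case;
  case=> [|||||||a|a|a|[q|q b|q b c]|x' c'|[||x' c']|[||x' c']|g] i' j' //=; rewrite ?orbF.
- by move=> /andP[/eqP-> /eqP->]; constructor 1.
- by move=> /andP[/eqP-> /eqP->]; constructor 2.
- by move=> h _; constructor 3; exists g, i', j'.
Qed.

Definition hub_of (g : gate Q S) : vertex :=
  if g is GS then vhubs Q S n' else vhub Q S n'.

Lemma hub_ofE g i j : wfv (KE g, i, j) -> edge (hub_of g) (KE g, i, j).
Proof. by move=> pg; rewrite edgeE //; case: g {pg}. Qed.

Lemma adj_hub_of g : adj vgamma (hub_of g).
Proof. by case: g => [||x c]; rewrite adjE. Qed.

Definition team (f : 'I_n -> vertex) y y' : dpos vertex k :=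
  [ffun a : 'I_k => if insub (val a) is Some l then f l else if val a == n then y else y'].

Lemma team_all2 (P : vertex -> vertex -> Prop) f f' y y' z z' :
  (forall l, P (f l) (f' l)) -> P y y' -> P z z' ->
  forall a, P (team f y z a) (team f' y' z' a).
Proof. by move=> h1 h2 h3 a; rewrite !ffunE; case: insubP => [l _ _|_] //; case: eqP. Qed.

Lemma team_cell f y y' l : exists a, team f y y' a = f l.
Proof.
have lt : l < k by apply: ltn_trans (ltn_ord l) _; rewrite ltnS leqnSn.
by exists (Ordinal lt); rewrite ffunE /= valK.
Qed.

Lemma team_theta f y y' : exists a, team f y y' a = y.
Proof.
by exists (Ordinal (leqnSn n.+1)); rewrite ffunE insubF /= ?eqxx // ltnn.
Qed.

Lemma team_gamma f y y' : exists a, team f y y' a = y'.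
Proof.
exists ord_max; rewrite ffunE insubF /=; last by rewrite ltnNge leqW.
by rewrite eqn_leq ltnn.
Qed.

Definition post g i j : seq vertex := [:: vt; (KE g, i, j); (KV2 g, i, j); (KV1 g, i, j)].

(** [Safe_closing] lasts for one round: J stands at the [t] end of its corridor, hence two moves
    away from the front, while an agent is one move away. In [Safe_closed] both ends are occupied
    for good and Divider stands still. *)
Inductive safe r j d : Prop :=
| Safe_home f of j = vt & guarded r f & d = team f vtheta vgamma
| Safe_closed g i l of wfv (KE g, i, l) & (exists a, d a = vt) &
    (exists a, d a = (KE g, i, l)) & j \in [:: (KV2 g, i, l); (KV1 g, i, l)] &
    r \notin post g i l
| Safe_closing g i l aG of wfv (KE g, i, l) & (exists a, d a = vt) &
    edge (d aG) (KE g, i, l) & d aG != vt & j = (KV1 g, i, l) &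
    ~~ edge r (KE g, i, l) & r \notin post g i l.

Lemma safe_ne r j d : safe r j d -> r != j.
Proof.
case=> [f -> /guarded_runner/andP[h _] _|g i l _ _ _ hj|g i l aG _ _ _ _ -> _].
- by apply: contraTneq h => ->.
- rewrite !inE !negb_or => /and4P[_ _ h1 h2].
  by move: hj; rewrite !inE => /orP[] /eqP->.
- by rewrite !inE !negb_or => /and4P[].
Qed.

Lemma stay_move d r j : free d r -> free d j -> div_move edge d d r j.
Proof.
move=> /freeP h1 /freeP h2; apply/forallP=> a.
by rewrite adj_refl eq_sym h1 eq_sym h2.
Qed.

(* the trapped J cannot leave the middle of its corridor, and R cannot enter it *)
Lemma post_closed d g i l r r' : wfv (KE g, i, l) -> adj r r' ->
  r \notin post g i l -> r' != vt -> r' != (KE g, i, l) -> r' \notin post g i l.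
Proof.
move=> pg ad nr nt nE; apply/negP; rewrite !inE (negbTE nt) (negbTE nE) /=.
move: nr; rewrite !inE !negb_or => /and4P[n1 n2 n3 n4].
case/orP=> /eqP e; rewrite e in ad.
  have := adj_V2 ad pg; rewrite !inE (negbTE n2) (negbTE n3) (negbTE n4); by [].
have := adj_V1 ad pg; rewrite !inE (negbTE n1) (negbTE n3) (negbTE n4); by [].
Qed.

Lemma trapped_move g i l j j' : wfv (KE g, i, l) -> adj j j' ->
  j \in [:: (KV2 g, i, l); (KV1 g, i, l)] -> j' != vt -> j' != (KE g, i, l) ->
  j' \in [:: (KV2 g, i, l); (KV1 g, i, l)].
Proof.
move=> pg ad hj nt nE; rewrite adj_sym in ad.
move: hj; rewrite !inE => /orP[] /eqP e; rewrite e in ad.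
  by have := adj_V2 ad pg; rewrite !inE (negbTE nE).
by have := adj_V1 ad pg; rewrite !inE (negbTE nt) orbF.
Qed.

Lemma cell_E v v' : cell_place v -> ~~ cell_place v' -> v != v'.
Proof. by move=> h1 h2; apply: contraNneq h2 => <-. Qed.

Lemma runner_E v v' : runner_place v -> ~~ runner_place v' -> v != v'.
Proof. by move=> h1 h2; apply: contraNneq h2 => <-. Qed.

Lemma cell_runner v v' : cell_place v -> runner_place v' -> v != v'.
Proof. by move=> h1 h2; apply: cell_E h1 _; move: v' h2; vcase. Qed.

Lemma runner_post r g i l : runner_place r -> r \notin post g i l.
Proof. by move=> h; rewrite !inE !negb_or !(runner_E h). Qed.

Lemma team_move f f' y y' z z' r j :
  (forall l, adj (f l) (f' l)) -> adj y y' -> adj z z' ->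
  (forall l, cell_place (f' l)) -> runner_place r -> ~~ cell_place j ->
  y' != r -> z' != r -> y' != j -> z' != j ->
  div_move edge (team f y z) (team f' y' z') r j.
Proof.
move=> h1 h2 h3 hc hr hj n1 n2 n3 n4; apply/forallP.
apply: (team_all2 (P := fun v v' => is_true [&& adj v v', v' != r & v' != j])).
- by move=> l; rewrite h1 (cell_runner (hc l) hr) (cell_E (hc l) hj).
- by rewrite h2 n1.
- by rewrite h3 n2.
Qed.

Lemma safe_step_home f r r' j' : guarded r f -> adj r r' -> adj vt j' ->
  free (team f vtheta vgamma) r' -> free (team f vtheta vgamma) j' ->
  exists2 d', div_move edge (team f vtheta vgamma) d' r' j' & safe r' j' d'.
Proof.
move=> gd ar aj fr fj.
have [aT eT] := team_theta f vtheta vgamma.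
have [aG eG] := team_gamma f vtheta vgamma.
have nTr : r' != vtheta by rewrite -eT; exact: (freeP _ _ fr).
have nGr : r' != vgamma by rewrite -eG; exact: (freeP _ _ fr).
have nTj : j' != vtheta by rewrite -eT; exact: (freeP _ _ fj).
have nGj : j' != vgamma by rewrite -eG; exact: (freeP _ _ fj).
have nf l : r' != f l.
  by have [a <-] := team_cell f vtheta vgamma l; exact: (freeP _ _ fr).
have [f' gd' had] := guarded_step gd ar nTr nGr nf.
have hc l := guarded_cells l gd'.
have /andP[hr pr] := guarded_runner gd'.
have adT : adj vtheta vt by rewrite adjE.
have nTr' : vtheta != r' by rewrite eq_sym.
have nGr' : vgamma != r' by rewrite eq_sym.
have ntr' : vt != r' by rewrite eq_sym; exact: runner_E hr _.
case/orP: aj => [/eqP<-|].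
  exists (team f' vtheta vgamma); last exact: Safe_home gd' _.
  have := team_move had (adj_refl vtheta) (adj_refl vgamma) hc hr (isT : ~~ cell_place vt) nTr' nGr'.
  exact.
case/edge_t => [e|e|[g [i [l [pg e]]]]]; [by rewrite e eqxx in nTj|by rewrite e eqxx in nGj|].
have hpost := runner_post g i l hr.
(* J has entered the corridor of [g] and the agent of theta takes [t]. If a cell agent is already on
   the front, the trap is complete; otherwise the agent of gamma goes to the hub next to it. *)
have [/existsP[l' /eqP el']|nE] := boolP [exists l', f' l' == (KE g, i, l)].
  exists (team f' vt vgamma).
    rewrite e.
    have := team_move had adT (adj_refl vgamma) hc hr (isT : ~~ cell_place (KV1 g, i, l)) ntr' nGr'.
    exact.
  apply: (@Safe_closed _ _ _ g i l pg).
  - exact: team_theta.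
  - by rewrite -el'; exact: team_cell.
  - by rewrite e !inE eqxx orbT.
  - exact: hpost.
have [aG' eG'] := team_gamma f' vt (hub_of g).
exists (team f' vt (hub_of g)).
  have nhub v : v != vhub Q S n' -> v != vhubs Q S n' -> hub_of g != v.
    move=> h1 h2; rewrite eq_sym /hub_of; clear -h1 h2.
    by case: g => [||x c]; [exact: h2 | exact: h1 | exact: h1].
  have h1 : hub_of g != r' by apply: nhub; exact: runner_E hr _.
  have h2 : hub_of g != (KV1 g, i, l) by exact: nhub.
  rewrite e.
  have := team_move had adT (adj_hub_of g) hc hr (isT : ~~ cell_place (KV1 g, i, l)) ntr' h1.
  by apply; [exact: isT | exact: h2].
apply: (@Safe_closing _ _ _ g i l aG' pg).
- exact: team_theta.
- by rewrite eG'; exact: hub_ofE.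
- rewrite eG'; clear; by case: g.
- exact: e.
- apply: contra nE => er; have [l' el'] := guarded_front gd' er.
  by apply/existsP; exists l'; rewrite el'.
- exact: hpost.
Qed.

Lemma safe_step r j d r' j' : safe r j d -> adj r r' -> adj j j' ->
  free d r' -> free d j' -> exists2 d', div_move edge d d' r' j' & safe r' j' d'.
Proof.
case=> [f -> gd ->|g i l pg hT hE hj hr|g i l aG pg hT eG nG -> nr hr] ar aj fr fj.
- exact: safe_step_home gd ar aj fr fj.
- exists d; first exact: stay_move.
  have nEr : r' != (KE g, i, l) by have [a <-] := hE; exact: (freeP _ _ fr).
  have nEj : j' != (KE g, i, l) by have [a <-] := hE; exact: (freeP _ _ fj).
  have ntr : r' != vt by have [a <-] := hT; exact: (freeP _ _ fr).
  have ntj : j' != vt by have [a <-] := hT; exact: (freeP _ _ fj).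
  apply: (Safe_closed pg hT hE); first exact: trapped_move hj ntj nEj.
  exact: post_closed hr ntr nEr.
- have ntr : r' != vt by have [a <-] := hT; exact: (freeP _ _ fr).
  have ntj : j' != vt by have [a <-] := hT; exact: (freeP _ _ fj).
  have nEr : r' != (KE g, i, l).
    apply: contra nr => /eqP e; move: ar; rewrite e => /orP[/eqP e2|//].
    by move: hr; rewrite e2 !inE eqxx orbT.
  have hj : (KV1 g, i, l) \in [:: (KV2 g, i, l); (KV1 g, i, l)] by rewrite !inE eqxx orbT.
  have nEj : j' != (KE g, i, l).
    apply/eqP=> e; rewrite e adj_sym in aj.
    by have := adj_V1 aj pg; rewrite !inE.
  exists [ffun a => if a == aG then (KE g, i, l) : vertex else d a].
    apply/forallP=> a; rewrite ffunE; case: eqP => [->|_].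
      by rewrite adj_edge //= eq_sym nEr eq_sym nEj.
    by have /forallP /(_ a) := stay_move fr fj.
  apply: (@Safe_closed _ _ _ g i l pg).
  + have [a ha] := hT; exists a; rewrite ffunE; case: eqP => // e.
    by rewrite -e ha eqxx in nG.
  + by exists aG; rewrite ffunE eqxx.
  + exact: trapped_move hj ntj nEj.
  + exact: post_closed hr ntr nEr.
Qed.

Lemma safe_start : exists2 d, div_init_legal vs vt d & safe vs vt d.
Proof.
exists (team (fun l => (KE GS, l, ord0)) vtheta vgamma).
  by apply: (team_all2 (P := fun _ v => v != vs /\ v != vt) (f := fun l => vt) (y := vt) (z := vt)).
by apply: Safe_home => //; apply: Guard_s.
Qed.

End Divider.

(** * Connectedness of the graph *)

Section Connected.
Variables (Q S : finType) (n' : nat).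
Notation n := n'.+1.
Variables (rule : Q -> 'I_n -> S -> option (Q * S * 'I_n)) (u : Q) (acc : pred Q).
Notation edge := (edge rule u acc).
Notation vt := (vt Q S n').
Notation vtheta := (vtheta Q S n').
Notation vgamma := (vgamma Q S n').
Notation vhub := (vhub Q S n').
Notation vhubs := (vhubs Q S n').
Notation vY := (vY Q S n').
Notation vs := (vs Q S n').

Lemma edge_connected v w : connect edge v w.
Proof.
have step a b : edge a b -> connect edge b vt -> connect edge a vt.
  by move=> /connect1; apply: connect_trans.
have tT : connect edge vtheta vt by apply: connect1; rewrite edgeE.
have tG : connect edge vgamma vt by apply: connect1; rewrite edgeE.
have tH : connect edge vhub vt by apply: (step _ vgamma _ tG); rewrite edgeE.
have tHs : connect edge vhubs vt by apply: (step _ vgamma _ tG); rewrite edgeE.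
have tS : connect edge vs vt by apply: (step _ vtheta _ tT); rewrite edgeE.
have tE g i j : wfv (KE g, i, j) -> connect edge (KE g, i, j) vt.
  case: g => [||x c] pg; first by apply: (step _ vhubs); rewrite ?edgeE.
    by apply: (step _ vhub); rewrite ?edgeE.
  by apply: (step _ vhub); rewrite ?edgeE.
have tY : connect edge vY vt by apply: (step _ _ _ (tE GA ord0 ord0 isT)); rewrite edgeE.
have tp a l : connect edge (vp Q a l) vt.
  by apply: (step _ _ _ (tE GS l ord0 isT)); rewrite edgeE //= eqxx.
have tX a l : connect edge (vX Q a l) vt by apply: (step _ vY _ tY); rewrite edgeE.
have tm a l : connect edge (vm Q a l) vt.
  by apply: (step _ (vp Q a l) _ (tp _ _)); rewrite edgeE //= !eqxx ?orbT.
have tB x c i : connect edge (vB x c i) vt by apply: (step _ vtheta _ tT); rewrite edgeE.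
have tx x i : connect edge (vT x i) vt.
  have [ax|nax] := boolP (acc_main acc x); last exact: (step _ (vB x ord0 i) (edge_TB _ _ _ _ nax)).
  apply: (step _ _ _ (tE GA ord0 ord0 isT)).
  by case: x ax => // q aq; rewrite edgeE //= aq ?orbT.
suff key a : connect edge a vt.
  apply: connect_trans (key v) _.
  by rewrite (sym_connect_sym (@edge_sym _ _ _ rule u acc)).
have [pa|npa] := boolP (wfv a); last first.
  by apply: (step _ vhub _ tH); rewrite /edge (negbTE npa) /=.
case: a pa => -[x i] j.
case: x => [|||||||b|b|b|x|x c|g|g|g] /= pa.
all: try (move: pa => /andP[/eqP-> /eqP->] //; exact: connect0).
all: try (move: pa => /eqP->; by [exact: tp | exact: tm | exact: tX | exact: tx | exact: tB]).
- exact: tE.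
- by apply: (step _ (KE g, i, j) _ (tE _ _ _ pa)); rewrite edgeE //= !eqxx ?orbT.
- have pt : wfv (KV1 g, i, j) by [].
  by apply: connect1; rewrite edgeE.
Qed.

End Connected.

(** * The game of a machine *)

Section Machine.
Variables (M : TM) (w : seq bool) (n' : nat).
Notation n := n'.+1.

(* [inr true]: sweep to the right, leaving the tape unchanged;
   [inr false]: sweep back to the left, writing the input of [M] *)
Definition mstate : finType := (tm_Q M + bool)%type.
(** The additional symbol provides, for each symbol, a different one, even if the alphabet of [M] is
    a singleton; [mother] returns it. *)
Definition msym : finType := option (tm_S M).
Definition minit : mstate := inr true.

Definition input_sym (i : nat) : tm_S M :=
  if i < size w then @tm_in M (nth false w i) else @tm_blank M.

(** A left move on cell 0 stays there because [0.-1] is 0, as in [tm_step]. Running off the right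
    end of the board halts without accepting; the space bound excludes it on the simulated run. *)
Definition mrule (q : mstate) (i : 'I_n) (b : msym) : option (mstate * msym * 'I_n) :=
  match q with
  | inr true => if i == n' :> nat then Some (inr false, b, i)
                else Some (inr true, b, inord i.+1)
  | inr false => if i == 0 :> nat then Some (inl (@tm_q0 M), Some (input_sym i), i)
                 else Some (inr false, Some (input_sym i), inord i.-1)
  | inl q =>
    if @tm_halt M q then None
    else if b is Some a then
      let: (q', a', mv) := @tm_delta M q a in
      let i' := if mv then i.+1 else i.-1 in
      if i' < n then Some (inl q', Some a', inord i') else None
    else None
  end.

Definition macc : pred mstate := fun q =>
  if q is inl q then @tm_halt M q && @tm_acc M q else false.

Definition mother (b : msym) : msym := if b is None then Some (@tm_blank M) else None.

Lemma mother_neq b : mother b != b. Proof. by case: b. Qed.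

Lemma macc_halts q i b : macc q -> mrule q i b = None.
Proof. by case: q => //= q /andP[->]. Qed.

Lemma mrule_into q i b c i' : mrule q i b = Some (minit, c, i') -> q = minit /\ i' = i.+1 :> nat.
Proof.
case: q => [q|[]] /=.
- case: ifP => // _; case: b => // a; case: (tm_delta _ _) => -[q' a'] mv.
  by case: ifP.
- case: eqP => // ne [_ <-]; split=> //; rewrite inordK // ltnS.
  by move: (ltn_ord i); rewrite ltnS leq_eqVlt => /orP[/eqP|].
- by case: eqP.
Qed.

Lemma mrule_from q i b c i' : mrule minit i b = Some (q, c, i') -> q != minit -> i = n' :> nat.
Proof. by rewrite /=; case: eqP => // _ [<-]. Qed.

Notation mcfg := (cfg mstate msym n').
Notation step := (cfg_step mrule).
Implicit Types tp : {ffun 'I_n -> msym}.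

Definition start_cfg : mcfg := (inl (@tm_q0 M), [ffun l : 'I_n => Some (input_sym l)], ord0).

Lemma cfg_write_id tp i : cfg_write tp i (tp i) = tp.
Proof. by apply/ffunP=> l; rewrite ffunE; case: eqP => [->|]. Qed.

Lemma write_sweep tp (i : 'I_n) : (forall l : 'I_n, i < l -> tp l = Some (input_sym l)) ->
  exists m, iter m step (inr false, tp, i) = start_cfg.
Proof.
case: i => i; elim: i tp => [|i IH] tp lt h.
  exists 1; rewrite /= /start_cfg; congr (_, _, _); last exact: val_inj.
  apply/ffunP=> l; rewrite !ffunE; case: eqP => [->//|/eqP].
  by rewrite -val_eqE /= -lt0n => /h.
have lt' : i < n by exact: ltnW lt.
have [l /= il|m hm] := IH (cfg_write tp (Ordinal lt) (Some (input_sym i.+1))) lt'.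
  rewrite ffunE -val_eqE /=; have [->//|ne] := eqVneq (val l) i.+1.
  by apply: h; rewrite /= ltn_neqAle eq_sym ne.
exists m.+1; rewrite iterSr -hm /=; congr (iter _ _ (_, _, _)).
by apply: val_inj; rewrite /= inordK.
Qed.

(** Both the tape and the head position are arbitrary: Divider relies on [bad_u] wherever R
    withdraws an announcement during the sweep. *)
Lemma first_sweep tp (i : 'I_n) : exists m, iter m step (minit, tp, i) = start_cfg.
Proof.
have [j] := ubnP (n' - i); elim: j i => // j IH i; rewrite ltnS => hj.
have [ei|ne] := eqVneq (val i) n'.
  have [l il|m hm] := @write_sweep tp i.
    by have := ltn_ord l; rewrite ltnS leqNgt -[X in X < _]ei il.
  by exists m.+1; rewrite iterSr /= ei eqxx cfg_write_id.
have lt : i < n' by rewrite ltn_neqAle ne -ltnS ltn_ord.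
have [|m hm] := IH (inord i.+1).
  by rewrite inordK // subnS; case: (n' - i) (subn_gt0 i n') hj => //; rewrite lt.
by exists m.+1; rewrite iterSr /= (negbTE ne) cfg_write_id.
Qed.

Definition encode_cfg (c : config M) : mcfg :=
  let: (q, tp, p) := c in (inl q, [ffun l : 'I_n => Some (tp l)], inord p).

Lemma simulation t : (forall t', t' <= t -> (tm_run M t' w).2 <= n') ->
  iter t step start_cfg = encode_cfg (tm_run M t w).
Proof.
elim: t => [|t IH] h.
  rewrite /tm_run /= /start_cfg; congr (_, _, _).
  by apply: val_inj; rewrite /= inordK.
rewrite iterS IH; last by move=> t' le; apply: h; apply: leqW.
have := h t.+1 (leqnn _); have := h t (leqnSn _).
rewrite /tm_run iterS -/(tm_run M t w); case: (tm_run M t w) => -[q tp] p /= hp.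
case: ifP => // _; rewrite ffunE inordK //.
case: (tm_delta q (tp p)) => -[q' a] mv /= hp'.
rewrite ltnS hp'; congr (_, _, _).
by apply/ffunP=> l; rewrite !ffunE -val_eqE /= inordK //; case: ifP.
Qed.

Lemma iter_past (T : Type) (f : T -> T) (x y : T) m : iter m f x = y -> f y = y ->
  forall m', m <= m' -> iter m' f x = y.
Proof. by move=> e fy m' /subnK <-; rewrite iterD e; elim: (m' - m) => //= j ->. Qed.

Lemma step_acc c : macc c.1.1 -> step c = c.
Proof. by case: c => [[q tp] i] /= h; rewrite macc_halts. Qed.

Variable t : nat.
Hypothesis t_halts : @tm_halt M (tm_run M t w).1.1.
Hypothesis t_space : forall t', t' <= t -> (tm_run M t' w).2 <= n'.

Lemma reach_end tp i : exists m, iter m step (minit, tp, i) = encode_cfg (tm_run M t w).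
Proof.
have [m hm] := first_sweep tp i.
by exists (t + m); rewrite iterD hm simulation.
Qed.

Lemma step_end : step (encode_cfg (tm_run M t w)) = encode_cfg (tm_run M t w).
Proof. by move: t_halts; case: (tm_run M t w) => -[q tp] p /= ->. Qed.

(** The orbit meets its final fixed point within as many steps as there are configurations, which
    gives a bound independent of the running time [t]. *)
Lemma machine_accepts : @tm_acc M (tm_run M t w).1.1 ->
  forall tp, macc (iter #|{: mcfg}| step (minit, tp, ord0)).1.1.
Proof.
move=> ac tp; have [m hm] := reach_end tp ord0.
have := fconnect_iter step m (minit, tp, ord0); rewrite hm => hc.
have le : findex step (minit, tp, ord0) (encode_cfg (tm_run M t w)) <= #|{: mcfg}|.
  by apply: leq_trans (max_card (fconnect step (minit, tp, ord0))); apply/ltnW/findex_max.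
rewrite (iter_past (iter_findex hc) step_end le).
by move: t_halts ac; case: (tm_run M t w) => -[q tp'] p /= -> ->.
Qed.

(** An accepting configuration and the final one are both fixed by the step; a common later iterate
    identifies them. *)
Lemma machine_rejects : ~ @tm_acc M (tm_run M t w).1.1 ->
  forall tp i, bad mrule macc (minit, tp, i).
Proof.
move=> nac tp i m; apply/negP=> am; have [m' hm'] := reach_end tp i.
case: nac; have := iter_past hm' step_end (leq_maxr m m').
rewrite (iter_past erefl (step_acc am) (leq_maxl m m')) => e.
by move: am; rewrite e; case: (tm_run M t w) => -[q tp'] p /= /andP[].
Qed.

End Machine.

(** * From machine runs to outcomes of the game on an isomorphic graph *)

Section Reduction.
Variables (M : TM) (w : seq bool) (n' t : nat).
Notation n := n'.+1.
Hypothesis t_halts : @tm_halt M (tm_run M t w).1.1.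
Hypothesis t_space : forall t', t' <= t -> (tm_run M t' w).2 <= n'.

Notation V := (vertex (mstate M) (msym M) n').
Notation cfg_card := #|{: cfg (mstate M) (msym M) n'}|.
Definition medge : rel V := edge (@mrule M w n') (minit M) (@macc M).
Variables (V' : finType) (e' : rel V') (phi : V' -> V) (psi : V -> V').
Hypotheses (phiK : cancel phi psi) (psiK : cancel psi phi).
Hypothesis eE : forall x y, e' x y = medge (phi x) (phi y).
Variables s' t' : V'.
Hypothesis s'E : phi s' = vs _ _ _.
Hypothesis t'E : phi t' = vt _ _ _.

Lemma reduction_accepts tau : 3 * cfg_card + 11 <= tau ->
  @tm_acc M (tm_run M t w).1.1 -> facilitator_wins_in e' s' t' n.+2 tau.
Proof.
move=> le ac; apply: facilitator_wins_in_of_win => d init.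
apply: (win_push phiK psiK eE); rewrite s'E t'E; apply: winW le _.
apply: facilitator_strategy; [by [] | exact: (machine_accepts t_halts t_space ac) | move=> a].
rewrite -s'E -t'E ffunE !(inj_eq (can_inj phiK)).
exact: init.
Qed.

Lemma reduction_rejects : ~ @tm_acc M (tm_run M t w).1.1 ->
  ~ facilitator_wins e' s' t' n.+2.
Proof.
move=> nac; have bad_u := machine_rejects t_halts t_space nac.
pose sf := safe (@mrule M w n') (minit M) (@macc M) (None : msym M).
have st := @safe_step _ _ _ _ _ _ (None : msym M) _ (@mother_neq M) bad_u
  (@mrule_into M w n') (@mrule_from M w n') (@macc_halts M w n').
have [d0 init0 safe0] := @safe_start _ _ _ (@mrule M w n') (minit M) (@macc M) (None : msym M).
have pullE d : push_dpos phi (pull_dpos psi d) = d by exact: (pull_dposK psiK).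
apply: (@not_facilitator_wins_of_safe _ _ _ _ _
  (fun r j d => sf (phi r) (phi j) (push_dpos phi d))).
- exists (pull_dpos psi d0); last by rewrite pullE s'E t'E.
  move=> a; rewrite -!(inj_eq (can_inj phiK)) ffunE psiK s'E t'E; exact: init0.
- by move=> r j d /safe_ne; rewrite (inj_eq (can_inj phiK)).
move=> r j d r' j' hs a1 a2 f1 f2.
have [||||d' dm hs'] := st _ _ _ (phi r') (phi j') hs.
- by rewrite (adj_push phiK eE).
- by rewrite (adj_push phiK eE).
- by rewrite (free_push phiK).
- by rewrite (free_push phiK).
exists (pull_dpos psi d'); last by rewrite pullE.
by rewrite -(div_move_push phiK eE) pullE.
Qed.

Lemma medge_sym : symmetric medge. Proof. exact: edge_sym. Qed.
Lemma medge_irr : irreflexive medge. Proof. exact: edge_irr. Qed.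
Lemma medge_connected v v' : connect medge v v'. Proof. exact: edge_connected. Qed.

End Reduction.

(** * Sweeping machines *)

Section Sweeping.
Variable nv : nat.
Notation var := 'I_nv.

(* left-end mark, input track, output track, counter marks: a counter is
   represented by the position of its mark *)
Definition cell : finType := (bool * option bool * option bool * {ffun var -> bool})%type.
Definition at_left (c : cell) : bool := c.1.1.1.
Definition in_track (c : cell) : option bool := c.1.1.2.
Definition out_track (c : cell) : option bool := c.1.2.
Definition mark (c : cell) (x : var) : bool := c.2 x.
Definition set_mark (x : var) (b : bool) (c : cell) : cell :=
  (c.1, [ffun y => if y == x then b else c.2 y]).
Definition set_out (b : bool) (c : cell) : cell := (c.1.1, Some b, c.2).
(** All counters start at 0, so all their marks lie on the cell at the left end. *)
Definition first_cell (c : cell) : cell := (true, in_track c, None, [ffun=> true]).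

(* Search from the left end for the first cell satisfying [i_stop], edit it and the
   next cell, return to the left end and branch. *)
Record instr := Instr {
  i_stop : cell -> bool;
  i_edit : cell -> cell;
  i_next : cell -> cell;
  i_goto : cell -> cell -> nat }.

Definition idle := Instr xpredT id id (fun _ _ => 0).

Variable code : seq instr.
Notation m := (size code).+1.

(** [None] is the start. Then come the search; the moment after the first edit, with the old
    contents of that cell kept for the branching; and the return, which carries the next
    instruction. *)
Definition sweep_state : finType := option ('I_m + 'I_m * cell + 'I_m)%type.
Definition scanning (a : nat) : sweep_state := Some (inl (inl (inord a))).

Definition sweep_delta (q : sweep_state) (c : cell) : sweep_state * cell * bool :=
  match q with
  | None => (scanning 0, first_cell c, false)
  | Some (inl (inl a)) =>
    let I := nth idle code a in
    if i_stop I c then (Some (inl (inr (a, c))), i_edit I c, true) else (q, c, true)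
  | Some (inl (inr (a, c0))) =>
    let I := nth idle code a in
    (Some (inr (inord (i_goto I c0 c))), i_next I c, false)
  | Some (inr a) => if at_left c then (Some (inl (inl a)), c, false) else (q, c, false)
  end.

Definition sweep_TM : TM :=
  @MkTM sweep_state cell (false, None, None, [ffun=> false])
    (fun b => (false, Some b, None, [ffun=> false])) out_track None
    (fun q => if q is Some (inl (inl a)) then a == size code :> nat else false)
    pred0 sweep_delta.

Notation step := (@tm_step sweep_TM).
Notation tape := (nat -> cell).

Definition edited (I : instr) (tp : tape) i : tape :=
  fun p => if p == i then i_edit I (tp i) else if p == i.+1 then i_next I (tp i.+1) else tp p.

Lemma same_write (tp : tape) p : (fun i => if i == p then tp p else tp i) = tp.
Proof. by apply: functional_extensionality => i; case: eqP => [->|]. Qed.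

Lemma scan_phase a (tp : tape) i : a < size code ->
  (forall p, p < i -> ~~ i_stop (nth idle code a) (tp p)) ->
  iter i step (scanning a, tp, 0) = (scanning a, tp, i).
Proof.
move=> lta; elim: i => // i IH h; rewrite iterS IH => [|p ltp]; last by apply: h; apply: ltnW.
have ea : (inord a : 'I_m) = a :> nat by rewrite inordK // ltnW.
by rewrite /= ea ltn_eqF //= (negbTE (h i _)) //= same_write.
Qed.

Lemma back_phase a (tp : tape) i : (forall p, at_left (tp p) = (p == 0)) ->
  iter i.+1 step (Some (inr a), tp, i) = (Some (inl (inl a)), tp, 0).
Proof.
move=> hl; elim: i => [|i IH]; first by rewrite /= hl /= same_write.
by rewrite iterSr /= hl /= same_write -IH.
Qed.

Lemma sweep a (tp : tape) i (I := nth idle code a) : a < size code ->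
  (forall p, at_left (tp p) = (p == 0)) ->
  (forall c, at_left (i_edit I c) = at_left c) ->
  (forall c, at_left (i_next I c) = at_left c) ->
  (forall p, p < i -> ~~ i_stop I (tp p)) -> i_stop I (tp i) ->
  iter (2 * i + 3) step (scanning a, tp, 0) =
    (scanning (i_goto I (tp i) (tp i.+1)), edited I tp i, 0).
Proof.
move=> lta hl h1 h2 hlt hi.
(* The search takes [i] steps, the edits at [i] and [i.+1] two, and the return [i.+1], including the
   turn on cell 0. *)
have -> : 2 * i + 3 = i.+1 + (2 + i) by rewrite mul2n -addnn !addnS addn0 addSn.
rewrite iterD (iterD 2) scan_phase //.
have ea : (inord a : 'I_m) = a :> nat by rewrite inordK // ltnW.
rewrite [iter 2 _ _]/= ea ltn_eqF //= hi /= ea -/I gtn_eqF //=.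
set tp' := (X in (_, X, i)).
have -> : tp' = edited I tp i.
  apply: functional_extensionality => p; rewrite /tp' /edited.
  by have [->|_] := eqVneq p i; first rewrite ltn_eqF.
apply: back_phase => p; rewrite /edited.
by case: eqP => [->|_]; [rewrite h1 hl | case: eqP => [->|]; rewrite ?h2 ?hl].
Qed.

Lemma tm_halted (M : TM) (c : config M) j : @tm_halt M c.1.1 -> iter j (@tm_step M) c = c.
Proof. by case: c => -[q tp] p /= h; elim: j => //= j ->; rewrite /= h. Qed.

End Sweeping.

(** * A language of counter programs *)

Section Language.
Variable nv : nat.
Notation var := 'I_nv.
Notation cell := (cell nv).
Variables (vzero vtop : var).

Inductive atom := AEq of var & var | ASucc of var & var | AIn of var & option bool.

(* [CSet x None] sets [x] to the length of the input; the number of iterations of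
   [CFor i b c] is capped by the counter [vtop], which bounds the running time. *)
Inductive cmd :=
| CSkip | CInc of var | CSet of var & option var | CEmit of bool
| CSeq of cmd & cmd | CIf of atom & cmd & cmd | CFor of var & var & cmd.

Definition env := var -> nat.
Definition state := (env * seq bool)%type.
Implicit Types (s : state) (e : env) (c : cmd).

Definition upd e x v : env := fun y => if y == x then v else e y.
Definition setv s x v : state := (upd s.1 x v, s.2).

Variable w : seq bool.

Definition onth_in (p : nat) : option bool := if p < size w then Some (nth false w p) else None.

Definition aeval (t : atom) e : bool :=
  match t with
  | AEq x y => e x == e y
  | ASucc x y => e y == (e x).+1
  | AIn x o => onth_in (e x) == o
  end.

Definition source s (o : option var) : nat := if o is Some y then s.1 y else size w.

Fixpoint exec c s : state :=
  match c with
  | CSkip => s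
  | CInc x => setv s x (s.1 x).+1
  | CSet x o => setv s x (source s o)
  | CEmit b => (s.1, rcons s.2 b)
  | CSeq c1 c2 => exec c2 (exec c1 s)
  | CIf t c1 c2 => if aeval t s.1 then exec c1 s else exec c2 s
  | CFor i b c1 =>
    iter (minn (s.1 b) (s.1 vtop))
      (fun s' => let s'' := exec c1 s' in setv s'' i (s''.1 i).+1) (setv s i 0)
  end.

Fixpoint writes c (x : var) : bool :=
  match c with
  | CSkip | CEmit _ => false
  | CInc y | CSet y _ => x == y
  | CSeq c1 c2 | CIf _ c1 c2 => writes c1 x || writes c2 x
  | CFor i _ c1 => (x == i) || writes c1 x
  end.

(** [CSet] deletes the old mark before it looks for the source, so the two variables must differ. A
    loop body may change neither the loop counter nor the two bounds, which fixes the number of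
    iterations in advance. *)
Fixpoint wf c : bool :=
  match c with
  | CSkip | CInc _ | CEmit _ => true
  | CSet x o => o != Some x
  | CSeq c1 c2 | CIf _ c1 c2 => wf c1 && wf c2
  | CFor i b c1 =>
    [&& wf c1, ~~ writes c1 i, ~~ writes c1 b, ~~ writes c1 vtop,
        i != b, i != vtop & i != vzero]
  end.

(** Counts executed instructions, hence sweeps, when [B] bounds [vtop]. A loop pays two tests and
    one increment per round, and two instructions for the initialization and two final tests. *)
Fixpoint cost c (B : nat) : nat :=
  match c with
  | CSkip => 0
  | CInc _ | CEmit _ => 1
  | CSet _ _ => 2
  | CSeq c1 c2 => cost c1 B + cost c2 B
  | CIf _ c1 c2 => cost c1 B + cost c2 B + 2
  | CFor _ _ c1 => B * (cost c1 B + 3) + 4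
  end.

Lemma exec_frame c s x : ~~ writes c x -> (exec c s).1 x = s.1 x.
Proof.
elim: c s => [|y|y o|b|c1 IH1 c2 IH2|t c1 IH1 c2 IH2|i b c IH] s //=.
- by rewrite /upd => /negbTE ->.
- by rewrite /upd => /negbTE ->.
- by rewrite negb_or => /andP[h1 h2]; rewrite IH2 ?IH1.
- by rewrite negb_or => /andP[h1 h2]; case: ifP; rewrite ?IH1 ?IH2.
rewrite negb_or => /andP[/negbTE xi nw].
elim: (minn _ _) => [|j IHj]; first by rewrite /= /upd xi.
by rewrite iterS /= /upd xi IH.
Qed.

Definition goto (a : nat) : cell -> cell -> nat := fun _ _ => a.
Definition marked (x : var) : pred cell := fun k => mark k x.
Definition I_jump a := Instr xpredT id id (goto a) : instr nv.
Definition I_inc x a := Instr (marked x) (set_mark x false) (set_mark x true) (goto a).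
Definition I_del x a := Instr (marked x) (set_mark x false) id (goto a).
Definition src_stop (o : option var) : pred cell :=
  if o is Some y then marked y else fun k => in_track k == None.
Definition I_put x o a := Instr (src_stop o) (set_mark x true) id (goto a).
Definition I_emit b a := Instr (fun k : cell => out_track k == None) (set_out b) id (goto a).
Definition I_test t a1 a0 : instr nv :=
  match t with
  | AEq x y => Instr (marked x) id id (fun k _ => if mark k y then a1 else a0)
  | ASucc x y => Instr (marked x) id id (fun _ k => if mark k y then a1 else a0)
  | AIn x o => Instr (marked x) id id (fun k _ => if in_track k == o then a1 else a0)
  end.

Fixpoint csize c : nat :=
  match c with
  | CSkip => 0
  | CInc _ | CEmit _ => 1
  | CSet _ _ => 2
  | CSeq c1 c2 => csize c1 + csize c2
  | CIf _ c1 c2 => (csize c1 + (csize c2).+1).+1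
  | CFor _ _ c1 => (csize c1 + 1).+4
  end.

Fixpoint comp c a : seq (instr nv) :=
  match c with
  | CSkip => [::]
  | CInc x => [:: I_inc x a.+1]
  | CSet x o => [:: I_del x a.+1; I_put x o a.+2]
  | CEmit b => [:: I_emit b a.+1]
  | CSeq c1 c2 => comp c1 a ++ comp c2 (a + csize c1)
  | CIf t c1 c2 =>
    let a2 := (a.+1 + csize c1).+1 in
    I_test t a.+1 a2 :: comp c1 a.+1 ++ I_jump (a2 + csize c2) :: comp c2 a2
  | CFor i b c1 =>
    let a1 := a.+2 in let stop := (a1.+2 + csize c1).+1 in
    [:: I_del i a.+1, I_put i (Some vzero) a1,
        I_test (AEq i b) stop a1.+1, I_test (AEq i vtop) stop a1.+2 &
        comp c1 a1.+2 ++ [:: I_inc i a1]]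
  end.

Lemma size_comp c a : size (comp c a) = csize c.
Proof.
elim: c a => [|x|x o|b|c1 IH1 c2 IH2|t c1 IH1 c2 IH2|i b c IH] a //=;
  by rewrite size_cat /= ?IH ?IH1 ?IH2.
Qed.

Section Running.
Variable code : seq (instr nv).
Notation step := (@tm_step (sweep_TM code)).

(** A variable may have no mark, as happens between the two instructions of [CSet]. *)
Definition tape_at (e : var -> option nat) (out : seq bool) : nat -> cell := fun p =>
  (p == 0, onth_in p, if p < size out then Some (nth false out p) else None,
   [ffun x => e x == Some p]).

Definition tape_of s := tape_at (fun x => Some (s.1 x)) s.2.

Definition fits B s := [/\ size w <= B, forall x, s.1 x <= B & size s.2 <= B].

(** One instruction raises the maximum of the counters and the output length by at most one. So all
    cells visited during [T] sweeps lie within the bound [B + T], which also bounds the length of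
    each sweep. *)
Definition runs a s a' s' T := forall B, fits B s -> fits (B + T) s' /\
  exists2 t, t <= T * (2 * (B + T) + 3) &
    iter t step (scanning code a, tape_of s, 0) = (scanning code a', tape_of s', 0).

Lemma fitsW B B' s : B <= B' -> fits B s -> fits B' s.
Proof.
by move=> le [h1 h2 h3]; split=> [|x|]; [exact: leq_trans le|exact: leq_trans (h2 x) le|exact: leq_trans le].
Qed.

Lemma runs_trans a1 s1 a2 s2 a3 s3 T1 T2 :
  runs a1 s1 a2 s2 T1 -> runs a2 s2 a3 s3 T2 -> runs a1 s1 a3 s3 (T1 + T2).
Proof.
move=> h1 h2 B /h1[/h2[f3 [t2 le2 e2]] [t1 le1 e1]]; rewrite addnA; split=> //.
exists (t2 + t1); last by rewrite iterD e1.
rewrite addnC mulnDl leq_add //; apply: leq_trans le1 _.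
by rewrite leq_mul2l leq_add2r leq_mul2l leq_addr !orbT.
Qed.

Lemma runsW a s a' s' T T' : T <= T' -> runs a s a' s' T -> runs a s a' s' T'.
Proof.
move=> le h B /h[f [t let_ e]]; split; first by apply: fitsW f; rewrite leq_add2l.
exists t => //; apply: leq_trans let_ _; apply: leq_mul => //.
by rewrite leq_add2r leq_mul2l leq_add2l le.
Qed.

Lemma runs_refl a s : runs a s a s 0.
Proof. by move=> B f; rewrite addn0; split=> //; exists 0. Qed.

Definition code_at a (seg : seq (instr nv)) :=
  a + size seg <= size code /\ forall i, i < size seg -> nth (idle nv) code (a + i) = nth (idle nv) seg i.

Lemma code_at_cat a l1 l2 : code_at a (l1 ++ l2) -> code_at a l1 /\ code_at (a + size l1) l2.
Proof.
rewrite /code_at size_cat addnA => -[le h]; split; split=> //.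
- by apply: leq_trans le; apply: leq_addr.
- by move=> i lt; rewrite h ?nth_cat ?lt // ltn_addr.
- by move=> i lt; rewrite -addnA h ?ltn_add2l // nth_cat ltnNge leq_addr /= addKn.
Qed.

Lemma code_at_cons a I seg : code_at a (I :: seg) ->
  [/\ nth (idle nv) code a = I, a < size code & code_at a.+1 seg].
Proof.
rewrite -cat1s => /code_at_cat[[/= le h] h2]; rewrite addn1 in le h2.
by split=> //; rewrite -[a]addn0 h.
Qed.

Definition keeps_left (I : instr nv) :=
  (forall k, at_left (i_edit I k) = at_left k) /\ (forall k, at_left (i_next I k) = at_left k).

Lemma instr_step a I (oe : var -> option nat) out i : nth (idle nv) code a = I -> a < size code -> keeps_left I ->
  (forall p, p < i -> ~~ i_stop I (tape_at oe out p)) -> i_stop I (tape_at oe out i) ->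
  iter (2 * i + 3) step (scanning code a, tape_at oe out, 0) =
  (scanning code (i_goto I (tape_at oe out i) (tape_at oe out i.+1)), edited I (tape_at oe out) i, 0).
Proof. by move=> <- lta [h1 h2] hl hi; apply: sweep. Qed.

Lemma instr_runs a I e e' out out' i a' T :
  nth (idle nv) code a = I -> a < size code -> keeps_left I ->
  (forall p, p < i -> ~~ i_stop I (tape_of (e, out) p)) -> i_stop I (tape_of (e, out) i) ->
  edited I (tape_of (e, out)) i = tape_of (e', out') ->
  i_goto I (tape_of (e, out) i) (tape_of (e, out) i.+1) = a' ->
  (forall B, fits B (e, out) -> i <= B /\ fits (B + 1) (e', out')) -> T = 1 ->
  runs a (e, out) a' (e', out') T.
Proof.
move=> eI lta kl hl hi he ha hf -> B /hf[le f]; split=> //.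
exists (2 * i + 3); first by rewrite mul1n leq_add2r leq_mul2l addn1 ltnW.
by rewrite -ha -he; exact: instr_step.
Qed.

Lemma edited_id I (tp : nat -> cell) i : i_edit I =1 id -> i_next I =1 id ->
  edited I tp i = tp.
Proof.
move=> h1 h2; apply: functional_extensionality => p; rewrite /edited h1 h2.
by case: eqP => [->|_] //; case: eqP => [->|].
Qed.

Lemma edited_one I (tp : nat -> cell) i : i_next I =1 id ->
  edited I tp i = fun p => if p == i then i_edit I (tp i) else tp p.
Proof.
move=> h; apply: functional_extensionality => p; rewrite /edited h.
by case: eqP => // _; case: eqP => [->|].
Qed.

Lemma fits1 B s : fits B s -> fits (B + 1) s.
Proof. by apply: fitsW; rewrite addn1. Qed.

Lemma run_jump a a' s : nth (idle nv) code a = I_jump a' -> a < size code -> runs a s a' s 1.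
Proof.
case: s => e out h lta; apply: (instr_runs (i := 0) h lta) => //; last by move=> B /fits1.
exact: edited_id.
Qed.

Lemma marked_at (oe : var -> option nat) out x p :
  marked x (tape_at oe out p) = (oe x == Some p).
Proof. by rewrite /marked /mark ffunE. Qed.

Lemma run_test a t a1 a0 s : nth (idle nv) code a = I_test t a1 a0 -> a < size code ->
  runs a s (if aeval t s.1 then a1 else a0) s 1.
Proof.
case: s => e out h lta.
pose x := match t with AEq x _ => x | ASucc x _ => x | AIn x _ => x end.
have st k : i_stop (I_test t a1 a0) k = marked x k by rewrite /x; case: (t).
apply: (instr_runs (i := e x) h lta) => //.
- by case: (t).
- by move=> p lt; rewrite st marked_at /=; apply/eqP=> -[eq]; rewrite eq ltnn in lt.
- by rewrite st marked_at.
- by apply: edited_id => k; case: (t).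
- rewrite /x; case: (t) => [y z|y z|y o] /=; rewrite /mark ?ffunE //=.
  by rewrite (inj_eq (@Some_inj _)) eq_sym.
- by move=> B f; split; [case: f => _ /(_ x) | apply: fits1].
Qed.

Lemma run_inc a x a' s : nth (idle nv) code a = I_inc x a' -> a < size code ->
  runs a s a' (setv s x (s.1 x).+1) 1.
Proof.
case: s => e out h lta; apply: (instr_runs (i := e x) h lta) => //.
- by move=> p lt; rewrite /= marked_at /=; apply/eqP=> -[eq]; rewrite eq ltnn in lt.
- by rewrite /= marked_at.
- apply: functional_extensionality => p; rewrite /edited /= /upd /tape_of /tape_at /set_mark /=.
  have [->|ne] := eqVneq p (e x).
    congr (_, _); apply/ffunP=> y; rewrite !ffunE; have [_|_] //= := eqVneq y x.
    by rewrite (inj_eq (@Some_inj _)) gtn_eqF.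
  have [->|ne'] := eqVneq p (e x).+1.
    by congr (_, _); apply/ffunP=> y; rewrite !ffunE; have [_|_] //= := eqVneq y x; rewrite eqxx.
  congr (_, _); apply/ffunP=> y; rewrite !ffunE; have [->|_] //= := eqVneq y x.
  by rewrite !(inj_eq (@Some_inj _)) ![_ == p]eq_sym (negbTE ne) (negbTE ne').
- move=> B [f1 f2 f3]; split; first exact: f2.
  split=> [|y|]; try by rewrite /= addn1 leqW.
  rewrite /= /upd; case: eqP => _; rewrite addn1 ?ltnS; first exact: f2.
  exact: leqW (f2 y).
Qed.

Lemma run_emit a b a' s : nth (idle nv) code a = I_emit b a' -> a < size code ->
  runs a s a' (s.1, rcons s.2 b) 1.
Proof.
case: s => e out h lta; apply: (instr_runs (i := size out) h lta) => //.
- by move=> p lt; rewrite /= /out_track /= lt.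
- by rewrite /= /out_track /= ltnn.
- apply: functional_extensionality => p; rewrite /edited /= /tape_of /tape_at /set_out /=.
  rewrite size_rcons nth_rcons ltnS.
  have [->|ne] := eqVneq p (size out); first by rewrite leqnn ltnn ?eqxx.
  rewrite [p <= size out]leq_eqVlt (negbTE ne) /=.
  by have [->|_] := eqVneq p (size out).+1; case: (_ < size out).
- move=> B [f1 f2 f3]; split; first exact: f3.
  split=> [|y|]; rewrite /= ?size_rcons addn1 ?ltnS ?leqW //; exact: f2.
Qed.

Lemma run_set a x o a' s : nth (idle nv) code a = I_del x a.+1 -> a.+1 < size code ->
  nth (idle nv) code a.+1 = I_put x o a' -> o != Some x ->
  runs a s a' (setv s x (source s o)) 2.
Proof.
case: s => e out h1 lt h2 nox B [f1 f2 f3].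
have src_le : source (e, out) o <= B by case: (o) => [y|] //; exact: f2.
split.
  split=> [|y|] /=; [exact: leq_trans f1 (leq_addr _ _) | | exact: leq_trans f3 (leq_addr _ _)].
  by rewrite /upd; case: eqP => _; [exact: leq_trans src_le (leq_addr _ _) | exact: leq_trans (f2 y) (leq_addr _ _)].
exists ((2 * source (e, out) o + 3) + (2 * e x + 3)).
  have bnd v : v <= B -> 2 * v + 3 <= 2 * (B + 2) + 3.
    by move=> le; rewrite leq_add2r leq_mul2l (leq_trans le (leq_addr _ _)).
  by rewrite [X in _ <= X]mul2n -addnn leq_add ?bnd.
pose oe y := if y == x then None else Some (e y).
rewrite iterD (instr_step h1 (ltnW lt)) //; first last.
- by rewrite /= marked_at.
- by move=> p ltp; rewrite /= marked_at /=; apply/eqP=> -[eq]; rewrite eq ltnn in ltp.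
rewrite edited_one //.
set tp1 := (X in (_, X, 0)); have -> : tp1 = tape_at oe out.
  apply: functional_extensionality => p; rewrite /tp1 /= /tape_at /set_mark /oe /=.
  have [->|ne] := eqVneq p (e x).
    by congr (_, _); apply/ffunP=> y; rewrite !ffunE; case: (y == x).
  congr (_, _); apply/ffunP=> y; rewrite !ffunE; have [->|//] := eqVneq y x.
  by rewrite (inj_eq (@Some_inj _)) eq_sym (negbTE ne).
have stopE p : src_stop o (tape_at oe out p) =
    if o is Some y then e y == p else size w <= p.
  case: o nox {h2 src_le} => [y|] /= nox; last by rewrite /in_track /= /onth_in ltnNge; case: leqP.
  rewrite marked_at /oe ifN //; by apply: contra nox => /eqP->.
rewrite (instr_step h2 lt) //; first last.
- by rewrite /= stopE; case: (o).
- move=> p; rewrite /= stopE; case: (o) => [y|] /=; last by rewrite ltnNge.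
  by move=> ltp; rewrite gtn_eqF.
rewrite edited_one //; congr (_, _, _).
apply: functional_extensionality => p; rewrite /= /tape_of /tape_at /set_mark /oe /upd /=.
have [->|ne] := eqVneq p (source (e, out) o).
  congr (_, _); apply/ffunP=> y; rewrite !ffunE /upd; have [_|//] := eqVneq y x.
  by rewrite eqxx.
congr (_, _); apply/ffunP=> y; rewrite !ffunE /upd; have [_|//] := eqVneq y x.
by rewrite (inj_eq (@Some_inj _)) [_ == p]eq_sym (negbTE ne).
Qed.

(** The loop has two exits, at [b] and at [vtop]; since [N] is the smaller of the two values, both
    tests fail below [N] and one succeeds at [N]. *)
Lemma loop_runs i b c1 a stop B j N s :
  nth (idle nv) code a = I_test (AEq i b) stop a.+1 -> a.+1 < size code ->
  nth (idle nv) code a.+1 = I_test (AEq i vtop) stop a.+2 ->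
  nth (idle nv) code (a.+2 + csize c1) = I_inc i a -> a.+2 + csize c1 < size code ->
  wf (CFor i b c1) -> ~~ writes c1 vzero ->
  (forall s', s'.1 vzero = 0 -> s'.1 vtop <= B ->
     runs a.+2 s' (a.+2 + csize c1) (exec c1 s') (cost c1 B)) ->
  s.1 vzero = 0 -> s.1 vtop <= B -> N = minn (s.1 b) (s.1 vtop) -> s.1 i + j = N ->
  runs a s stop (iter j (fun s' => let s'' := exec c1 s' in setv s'' i (s''.1 i).+1) s)
    (j * (cost c1 B + 3) + 2).
Proof.
move=> h1 lt1 h2 h3 lt3 /and5P[wc ni nb nt /and3P[ib it iz]] nz hc.
elim: j s => [|j IH] s s0 sB eN si.
  rewrite mul0n add0n /=; rewrite addn0 in si.
  have := run_test (s := s) h1 (ltnW lt1); rewrite /= si; case: eqP => [_|ne]; first exact: runsW.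
  move=> r1; have := run_test (s := s) h2 lt1; rewrite /= si.
  rewrite (_ : _ == _) => [r2|]; first exact: runs_trans r1 r2.
  by move: ne; rewrite eN /minn; case: ifP.
rewrite iterSr; set s1 := (X in iter j _ X).
have lt : s.1 i < N by rewrite -si addnS ltnS leq_addr.
move: (lt); rewrite eN leq_min => /andP[lb ltop].
have := run_test (s := s) h1 (ltnW lt1); rewrite /= ltn_eqF // => r1.
have := run_test (s := s) h2 lt1; rewrite /= ltn_eqF // => r2.
have r3 := hc s s0 sB.
have r4 := run_inc (s := exec c1 s) h3 lt3.
have fr x : x != i -> ~~ writes c1 x -> s1.1 x = s.1 x.
  by move=> xi nx; rewrite /s1 /= /upd (negbTE xi) exec_frame.
have r5 : runs a s1 stop (iter j (fun s' => let s'' := exec c1 s' in setv s'' i (s''.1 i).+1) s1)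
    (j * (cost c1 B + 3) + 2).
  apply: IH.
  - by rewrite fr // eq_sym.
  - by rewrite fr // eq_sym.
  - by rewrite !fr // eq_sym.
  - by rewrite -si /s1 /= /upd eqxx exec_frame // addSn addnS.
have := runs_trans r1 (runs_trans r2 (runs_trans r3 (runs_trans r4 r5))).
by apply: runsW; rewrite mulSn; lia.
Qed.

Theorem comp_runs c a s B : wf c -> code_at a (comp c a) ->
  s.1 vzero = 0 -> ~~ writes c vzero -> s.1 vtop <= B -> ~~ writes c vtop ->
  runs a s (a + csize c) (exec c s) (cost c B).
Proof.
elim: c a s => [|x|x o|b|c1 IH1 c2 IH2|t c1 IH1 c2 IH2|i b c1 IH] a s /=.
- by move=> *; rewrite addn0; exact: runs_refl.
- by move=> _ /code_at_cons[h lt _] *; rewrite addn1; exact: run_inc.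
- move=> ox /code_at_cons[h1 _ /code_at_cons[h2 lt _]] *; rewrite addn2.
  exact: run_set.
- by move=> _ /code_at_cons[h lt _] *; rewrite addn1; exact: run_emit.
- move=> /andP[w1 w2] /code_at_cat[h1]; rewrite size_comp => h2 s0.
  rewrite !negb_or => /andP[z1 z2] sB /andP[t1 t2]; rewrite addnA.
  by apply: runs_trans (IH1 _ _ _ _ _ _ _ _) (IH2 _ _ _ _ _ _ _ _); rewrite ?exec_frame.
- move=> /andP[w1 w2] /code_at_cons[h lt /code_at_cat[k1]].
  rewrite size_comp => /code_at_cons[hj ltj]; rewrite -addSn => k2 s0.
  rewrite !negb_or => /andP[z1 z2] sB /andP[t1 t2].
  have r0 := run_test (s := s) h lt; rewrite addnS -addSn addnA addnS -addSn.
  case: ifP r0 => _ r0.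
    have r1 := IH1 a.+1 s w1 k1 s0 z1 sB t1.
    apply: runsW (runs_trans r0 (runs_trans r1 (run_jump hj ltj))).
    by lia.
  have r2 := IH2 _ s w2 k2 s0 z2 sB t2.
  apply: runsW (runs_trans r0 r2).
  by lia.
- move=> wfor /code_at_cons[h1 _ /code_at_cons[h2 lt2 /code_at_cons[h3 lt3 /code_at_cons[h4 lt4]]]].
  move=> /code_at_cat[k1]; rewrite size_comp => /code_at_cons[h5 lt5 _] s0.
  rewrite !negb_or => /andP[zi z1] sB /andP[ti t1].
  have iz : Some vzero != Some i by [].
  have r0 := run_set (s := s) h1 lt2 h2 iz; rewrite /= s0 in r0.
  have /and5P[wc ni nb nt /and3P[ib it _]] := wfor.
  have frame x : x != i -> (setv s i 0).1 x = s.1 x by rewrite /= /upd => /negbTE->.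
  have r1 := @loop_runs i b c1 a.+2 _ B (minn (s.1 b) (s.1 vtop)) _ (setv s i 0)
    h3 lt4 h4 h5 lt5 wfor z1.
  have eN : minn (s.1 b) (s.1 vtop) = minn ((setv s i 0).1 b) ((setv s i 0).1 vtop).
    by rewrite !frame // eq_sym.
  have -> : a + (csize c1 + 1).+4 = (a.+4 + csize c1).+1 by rewrite addn1 !addnS !addSn.
  have {r1} r1 : runs a.+2 (setv s i 0) (a.+4 + csize c1).+1 (exec (CFor i b c1) s)
      (minn (s.1 b) (s.1 vtop) * (cost c1 B + 3) + 2).
    apply: r1 eN _.
    + by move=> s' z' t'; apply: IH.
    + by rewrite frame // eq_sym.
    + by rewrite frame // eq_sym.
    + by rewrite /= /upd eqxx.
  have rr := runs_trans r0 r1; apply: (runsW _ rr).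
  have le : minn (s.1 b) (s.1 vtop) <= B by exact: leq_trans (geq_minr _ _) sB.
  have : minn (s.1 b) (s.1 vtop) * (cost c1 B + 3) <= B * (cost c1 B + 3) by rewrite leq_mul2r le orbT.
  by rewrite addnCA => h; exact: leq_add h (leqnn 4).
Qed.

End Running.

(** [comp_runs] needs a command that leaves [vtop] alone, but the whole program first raises [vtop].
    Tying the time to the state [s] allows parts with different values of [vtop] to be joined. *)
Definition prog_runs c s T := forall code a, code_at code a (comp c a) ->
  runs code a s (a + csize c) (exec c s) T.

Lemma prog_runs_seq c1 c2 s T1 T2 : prog_runs c1 s T1 -> prog_runs c2 (exec c1 s) T2 ->
  prog_runs (CSeq c1 c2) s (T1 + T2).
Proof.
move=> h1 h2 code a /= /code_at_cat[k1]; rewrite size_comp => k2.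
by rewrite addnA; exact: runs_trans (h1 _ _ k1) (h2 _ _ k2).
Qed.

Lemma prog_runs_cost c s B : wf c -> s.1 vzero = 0 -> ~~ writes c vzero ->
  s.1 vtop <= B -> ~~ writes c vtop -> prog_runs c s (cost c B).
Proof. by move=> *; move=> code a ?; apply: comp_runs. Qed.

Lemma prog_runs_set x o s : o != Some x -> prog_runs (CSet x o) s 2.
Proof.
move=> ox code a /= /code_at_cons[h1 _ /code_at_cons[h2 lt _]]; rewrite addn2.
exact: run_set.
Qed.

Lemma prog_runs_inc x s : prog_runs (CInc x) s 1.
Proof. by move=> code a /= /code_at_cons[h lt _]; rewrite addn1; exact: run_inc. Qed.

Definition state0 : state := (fun=> 0, [::]).

Lemma program_halts c T : prog_runs c state0 T ->
  let M := sweep_TM (comp c 0) in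
  exists2 t, t <= T * (2 * (size w + T) + 3) + 1 &
    let cf := tm_run M t w in @tm_halt M cf.1.1 /\ tape_reads cf.1.2 (exec c state0).2.
Proof.
move=> h; have ca : code_at (comp c 0) 0 (comp c 0) by split=> // i; rewrite add0n.
have [|_ [t le e]] := h _ _ ca (size w); first by split.
(* The additional step is the one that prepares the left-end cell. *)
exists t.+1; first by rewrite addn1 ltnS.
rewrite /tm_run iterSr /tm_init /=.
set tp := (X in (_, X, 0)); have -> : tp = tape_of state0.
  apply: functional_extensionality => p; rewrite /tp /tape_of /tape_at /onth_in /=.
  case: p => [|p] /=; last first.
    by case: ifP => _; congr (_, _); apply/ffunP=> x; rewrite !ffunE.
  by case: ifP => _; congr (_, _); apply/ffunP=> x; rewrite !ffunE.
rewrite e /= add0n inordK size_comp ?ltnS ?leqnn // eqxx; split=> //.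
by split=> [i lt|]; rewrite /tm_out /= /out_track /tape_of /tape_at /= ?lt ?ltnn.
Qed.

End Language.

(** * Polynomial bounds *)

Definition polyb (f : nat -> nat) := exists k, forall n, f n <= (n + 2) ^ k.

Lemma polyb_bound f : polyb f -> exists c k, forall n, f n <= poly_bound c k n.
Proof.
move=> [k h]; exists (3 ^ k), k => n; apply: leq_trans (h n) _; rewrite /poly_bound.
case: k {h} => [|k]; first by rewrite !expn0.
case: n => [|n]; first by apply: leq_trans (leq_addl _ _); rewrite add0n leq_exp2r.
by apply: leq_trans (leq_addr _ _); rewrite -expnMn leq_exp2r //; lia.
Qed.

Lemma polyb_le f g : (forall n, f n <= g n) -> polyb g -> polyb f.
Proof. by move=> h [k hk]; exists k => n; apply: leq_trans (h n) (hk n). Qed.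

(** The base [n + 2] is at least 2, so constants are absorbed by the exponent, since [c < 2 ^ c]. *)
Lemma polyb_const c : polyb (fun=> c).
Proof.
exists c => n; apply: leq_trans (ltnW (ltn_expl c (ltnSn 1))) _.
by case: c => // c; rewrite leq_exp2r // addn2.
Qed.

Lemma polyb_id : polyb id.
Proof. by exists 1 => n; rewrite expn1 leq_addr. Qed.

Lemma polyb_add f g : polyb f -> polyb g -> polyb (fun n => f n + g n).
Proof.
move=> [k1 h1] [k2 h2]; exists (k1 + k2).+1 => n.
have p m : 0 < (n + 2) ^ m by rewrite expn_gt0 addn2.
rewrite expnS; apply: leq_trans (_ : 2 * (n + 2) ^ (k1 + k2) <= _); last first.
  by rewrite leq_mul2r addn2 orbT.
rewrite mul2n -addnn leq_add //.
  by apply: leq_trans (h1 n) _; rewrite expnD leq_pmulr.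
by apply: leq_trans (h2 n) _; rewrite expnD leq_pmull.
Qed.

Lemma polyb_mul f g : polyb f -> polyb g -> polyb (fun n => f n * g n).
Proof. by move=> [k1 h1] [k2 h2]; exists (k1 + k2) => n; rewrite expnD leq_mul. Qed.

Lemma polyb_comp f g : polyb f -> polyb g -> polyb (fun n => f (g n)).
Proof.
move=> [k1 h1] [k2 h2]; exists ((k2 + 2) * k1) => n; apply: leq_trans (h1 _) _.
rewrite expnM; case: k1 {h1} => // k1; rewrite leq_exp2r // expnD.
apply: leq_trans (_ : (n + 2) ^ k2 + 2 <= _); first by rewrite leq_add2r.
have p : 0 < (n + 2) ^ k2 by rewrite expn_gt0 addn2.
apply: leq_trans (_ : (n + 2) ^ k2 * 4 <= _).
  by rewrite -[4]/(1 + 3) mulnDr muln1 leq_add2l; apply: leq_trans (leq_pmull 3 p).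
by rewrite leq_mul2l -[4]/(2 ^ 2) leq_exp2r // leq_addl orbT.
Qed.

Lemma polyb_cost nv (c : cmd nv) : polyb (cost c).
Proof.
elim: c => [|x|x o|b|c1 IH1 c2 IH2|t c1 IH1 c2 IH2|i b c IH] /=.
1-4: exact: polyb_const.
- exact: polyb_add.
- by do ?apply: polyb_add => //; exact: polyb_const.
- apply: polyb_add; last exact: polyb_const.
  apply: polyb_mul; first exact: polyb_id.
  by apply: polyb_add => //; exact: polyb_const.
Qed.

Theorem program_poly_time nv (vzero vtop : 'I_nv) (c : cmd nv) (T : nat -> nat) :
  (forall w, prog_runs vzero vtop w c (state0 nv) (T (size w))) -> polyb T ->
  poly_time_computable (fun w => (exec vtop w c (state0 nv)).2).
Proof.
move=> hr pT.
have [a [k hk]] : exists a k, forall n, T n * (2 * (n + T n) + 3) + 1 <= poly_bound a k n.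
  apply: polyb_bound; apply: polyb_add; last exact: polyb_const.
  apply: polyb_mul => //; apply: polyb_add; last exact: polyb_const.
  by apply: polyb_mul; [exact: polyb_const | apply: polyb_add => //; exact: polyb_id].
exists (sweep_TM (comp vzero vtop c 0)), a, k => w.
have [t le [hh ht]] := program_halts (hr w).
have -> : tm_run (sweep_TM (comp vzero vtop c 0)) (poly_bound a k (size w)) w
    = tm_run (sweep_TM (comp vzero vtop c 0)) t w.
  have le' := leq_trans le (hk _).
  by rewrite -(subnK le') /tm_run iterD tm_halted.
by split.
Qed.

(** * What a program prints *)

Section Emission.
Variables (nv : nat) (vzero vtop : 'I_nv) (w : seq bool).
Notation var := 'I_nv.
Notation cmd := (cmd nv).
Notation env := (env nv).
Notation state := (state nv).
Notation exec := (exec vtop w).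
Implicit Types (c : cmd) (s : state) (e : env) (D : pred var).

Fixpoint silent c : bool :=
  match c with
  | CEmit _ => false
  | CSeq c1 c2 | CIf _ c1 c2 => silent c1 && silent c2
  | CFor _ _ c1 => silent c1
  | _ => true
  end.

Lemma exec_silent c s : silent c -> (exec c s).2 = s.2.
Proof.
elim: c s => [|x|x o|b|c1 IH1 c2 IH2|t c1 IH1 c2 IH2|i b c IH] s //=.
- by case/andP=> h1 h2; rewrite IH2 ?IH1.
- by case/andP=> h1 h2; case: ifP => _; rewrite ?IH1 ?IH2.
by move=> h; elim: (minn _ _) => //= j IHj; rewrite IH.
Qed.

(** [D] contains all variables on which [F] depends and none that [c] changes. Hence after one
    command the next one still sees the same environment on [D], and emissions concatenate. *)
Definition emits D c (F : env -> seq bool) :=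
  [/\ wf vzero vtop c,
      forall x, D x -> ~~ writes c x,
      forall e e', (forall x, D x -> e x = e' x) -> F e = F e' &
      forall s, (exec c s).2 = s.2 ++ F s.1].

Lemma emits_frame D c F s x : emits D c F -> D x -> (exec c s).1 x = s.1 x.
Proof. by case=> _ h _ _ /h; exact: exec_frame. Qed.

Lemma emits_skip D : emits D (CSkip nv) (fun=> [::]).
Proof. by split=> // s; rewrite cats0. Qed.

Lemma emits_emit D b : emits D (CEmit nv b) (fun=> [:: b]).
Proof. by split=> // s; rewrite cats1. Qed.

Lemma emits_seq D c1 c2 F1 F2 : emits D c1 F1 -> emits D c2 F2 ->
  emits D (CSeq c1 c2) (fun e => F1 e ++ F2 e).
Proof.
move=> h1 h2; have [f1 w1 d1 o1] := h1; have [f2 w2 d2 o2] := h2; split.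
- by rewrite /= f1.
- by move=> x Dx /=; rewrite negb_or w1 ?w2.
- by move=> e e' h; rewrite (d1 e e') // (d2 e e').
move=> s; rewrite /= o2 o1 catA; congr (_ ++ _).
by apply: d2 => x Dx; rewrite (emits_frame s h1).
Qed.

Definition atom_vars (t : atom nv) : seq var :=
  match t with AEq x y | ASucc x y => [:: x; y] | AIn x _ => [:: x] end.

Lemma aeval_dep D t e e' : all D (atom_vars t) -> (forall x, D x -> e x = e' x) ->
  aeval w t e = aeval w t e'.
Proof.
by case: t => [x y|x y|x o] /= /andP[Dx]; rewrite ?andbT => Dy h; rewrite !h.
Qed.

Lemma emits_if D t c1 c2 F1 F2 : all D (atom_vars t) -> emits D c1 F1 -> emits D c2 F2 ->
  emits D (CIf t c1 c2) (fun e => if aeval w t e then F1 e else F2 e).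
Proof.
move=> Dt [f1 w1 d1 o1] [f2 w2 d2 o2]; split.
- by rewrite /= f1.
- by move=> x Dx /=; rewrite negb_or w1 ?w2.
- by move=> e e' h; rewrite (aeval_dep Dt h) (d1 e e') // (d2 e e').
by move=> s /=; case: ifP.
Qed.

Lemma emits_for D i b c F : emits (predU1 i D) c F -> D b -> D vtop -> D vzero -> ~~ D i ->
  emits D (CFor i b c)
    (fun e => flatten [seq F (upd e i v) | v <- iota 0 (minn (e b) (e vtop))]).
Proof.
move=> h Db Dt Dz Di; have [fc wc dc oc] := h.
have nw x : D x -> ~~ writes c x by move=> Dx; rewrite wc //= Dx orbT.
have ne x : D x -> i != x by move=> Dx; apply: contraNneq Di => ->.
split.
- by rewrite /= fc wc /= ?eqxx // !nw // !ne.
- by move=> x Dx /=; rewrite negb_or nw // eq_sym ne.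
- move=> e e' he; rewrite !he //; congr flatten; apply: eq_map => v.
  by apply: dc => x /= /orP[/eqP->|Dx]; rewrite /upd ?eqxx // he.
move=> s; set N := minn _ _.
suff key j : j <= N ->
    let s' := iter j (fun s' => let s'' := exec c s' in setv s'' i (s''.1 i).+1) (setv s i 0) in
    [/\ s'.1 i = j, forall x, D x -> s'.1 x = s.1 x &
        s'.2 = s.2 ++ flatten [seq F (upd s.1 i v) | v <- iota 0 j]].
  by have [_ _ ->] := key N (leqnn _).
elim: j => [_|j IH ltj].
  split=> [|x Dx|] /=; rewrite ?cats0 //= /upd ?eqxx //.
  by case: eqP => // exi; rewrite -exi Dx in Di.
have [hi hD ho] := IH (ltnW ltj); rewrite iterS.
have -> : iota 0 j.+1 = iota 0 j ++ [:: j] by rewrite -addn1 iotaD.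
set s' := iter _ _ _ in hi hD ho *; rewrite /=.
split; first by rewrite /upd eqxx (emits_frame s' h) /= ?eqxx // hi.
  move=> x Dx; rewrite /upd; case: eqP => [exi|_]; first by rewrite -exi Dx in Di.
  by rewrite (emits_frame s' h) /= ?Dx ?orbT // hD.
rewrite oc ho map_cat flatten_cat catA; congr (_ ++ _).
rewrite /= cats0; apply: dc => x /= /orP[/eqP->|Dx]; rewrite /upd ?eqxx //.
by case: eqP => [->|_]; rewrite ?hi ?hD.
Qed.

Fixpoint seqs (cs : seq cmd) : cmd := if cs is c :: cs' then CSeq c (seqs cs') else CSkip nv.

Lemma emits_seqs (I : Type) (r : seq I) D (c : I -> cmd) (F : I -> env -> seq bool) :
  (forall i, emits D (c i) (F i)) ->
  emits D (seqs [seq c i | i <- r]) (fun e => flatten [seq F i e | i <- r]).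
Proof.
by move=> h; elim: r => [|i r IH] /=; [exact: emits_skip | exact: emits_seq].
Qed.

Definition emit_list (l : seq bool) : cmd := seqs [seq CEmit nv b | b <- l].

Lemma emits_list D l : emits D (emit_list l) (fun=> l).
Proof.
have := @emits_seqs _ l D (@CEmit nv) (fun b _ => [:: b]) (emits_emit D).
by rewrite flatten_seq1.
Qed.

Inductive form := FBool of bool | FAtom of atom nv | FNot of form | FAnd of form & form | FOr of form & form.

Fixpoint feval (f : form) e : bool :=
  match f with
  | FBool b => b
  | FAtom t => aeval w t e
  | FNot f => ~~ feval f e
  | FAnd f g => feval f e && feval g e
  | FOr f g => feval f e || feval g e
  end.

Fixpoint form_vars f : seq var :=
  match f with
  | FBool _ => [::]
  | FAtom t => atom_vars t
  | FNot f => form_vars f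
  | FAnd f g | FOr f g => form_vars f ++ form_vars g
  end.

(** Branches get duplicated, which is harmless: the size of the program does not depend on the
    input. *)
Fixpoint branch f c1 c2 : cmd :=
  match f with
  | FBool b => if b then c1 else c2
  | FAtom t => CIf t c1 c2
  | FNot f => branch f c2 c1
  | FAnd f g => branch f (branch g c1 c2) c2
  | FOr f g => branch f c1 (branch g c1 c2)
  end.

Lemma emits_branch D f c1 c2 F1 F2 : all D (form_vars f) -> emits D c1 F1 -> emits D c2 F2 ->
  emits D (branch f c1 c2) (fun e => if feval f e then F1 e else F2 e).
Proof.
have ext c F F' : F =1 F' -> emits D c F -> emits D c F'.
  by move=> eF [h0 h1 h2 h3]; split=> // [e e' /h2|s]; rewrite -!eF.
elim: f c1 c2 F1 F2 => [b|t|f IHf|f IHf g IHg|f IHf g IHg] c1 c2 F1 F2 /=.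
- by move=> _ h1 h2; case: b.
- exact: emits_if.
- by move=> h k1 k2; apply: ext (IHf _ _ _ _ h k2 k1) => e; case: (feval f e).
- rewrite all_cat => /andP[h1 h2] k1 k2; apply: ext (IHf _ _ _ _ h1 (IHg _ _ _ _ h2 k1 k2) k2).
  by move=> e; case: (feval f e).
rewrite all_cat => /andP[h1 h2] k1 k2; apply: ext (IHf _ _ _ _ h1 k1 (IHg _ _ _ _ h2 k1 k2)).
by move=> e; case: (feval f e).
Qed.

Definition adds D (z : var) c (m : env -> nat) :=
  [/\ forall x, D x -> ~~ writes c x,
      forall e e', (forall x, D x -> e x = e' x) -> m e = m e' &
      forall s, (exec c s).1 z = s.1 z + m s.1].

Definition incs (r : nat) (z : var) : cmd := iter r (fun c => CSeq c (CInc z)) (CSkip nv).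

Lemma adds_incs D r z : ~~ D z -> adds D z (incs r z) (fun=> r).
Proof.
move=> Dz; split=> //.
  move=> x Dx; elim: r => //= r IH; rewrite negb_or IH /=.
  by apply: contraNneq Dz => <-.
move=> s; elim: r => [|r IH] /=; first by rewrite addn0.
by rewrite /upd eqxx IH addnS.
Qed.

Lemma adds_for D z i b c m : adds D z c m -> D b -> D vtop -> ~~ D i -> z != i ->
  adds D z (CFor i b c) (fun e => minn (e b) (e vtop) * m e).
Proof.
move=> [wc dc ac] Db Dt Di zi; split.
- move=> x Dx /=; rewrite negb_or wc // andbT.
  by apply: contraNneq Di => <-.
- by move=> e e' h; rewrite !h // (dc e e').
move=> s; set N := minn _ _ => /=; rewrite -/N.
suff : let s' := iter N (fun s' => let s'' := exec c s' in setv s'' i (s''.1 i).+1) (setv s i 0) in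
    s'.1 z = s.1 z + N * m s.1 /\ forall x, D x -> s'.1 x = s.1 x by case.
elim: N => [|j IHj].
  split=> [|x Dx]; rewrite /= /upd ?(negbTE zi) ?addn0 //.
  by case: eqP => // exi; rewrite -exi Dx in Di.
move: IHj; rewrite iterS; set s' := iter j _ _ => -[hz hD]; split=> [|x Dx] /=.
  rewrite /upd (negbTE zi) ac hz mulSn -addnA; congr (_ + _); rewrite addnC; congr (_ + _).
  exact: dc.
rewrite /upd; case: eqP => [exi|_]; first by rewrite -exi Dx in Di.
by rewrite exec_frame ?hD // wc.
Qed.

Section Multiply.
Variables (r : nat) (z i j p q : var).
Definition mulc : cmd :=
  CSeq (CSet z (Some vzero)) (CFor i p (CFor j q (incs r z))).

Lemma exec_mulc s : uniq [:: z; i; j] -> all [predC [:: z; i; j]] [:: p; q; vtop] ->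
  s.1 vzero = 0 -> s.1 p <= s.1 vtop -> s.1 q <= s.1 vtop ->
  (exec mulc s).1 z = s.1 p * (s.1 q * r).
Proof.
rewrite /= !inE !negb_or !andbT => /andP[/andP[zi zj] ij] /and3P[/and3P[pz pi pj] /and3P[qz qi qj] /and3P[tz ti tj]] s0 lp lq.
pose D := pred3 p q vtop.
have aj : adds D z (CFor j q (incs r z)) (fun e => minn (e q) (e vtop) * r).
  apply: adds_for; rewrite /D /= ?eqxx ?orbT //.
    by apply: adds_incs; rewrite /= !negb_or eq_sym pz eq_sym qz eq_sym tz.
  by rewrite !negb_or eq_sym pj eq_sym qj eq_sym tj.
have ai : adds D z (CFor i p (CFor j q (incs r z))) (fun e => minn (e p) (e vtop) * (minn (e q) (e vtop) * r)).
  apply: adds_for; rewrite /D /= ?eqxx ?orbT //.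
  by rewrite !negb_or eq_sym pi eq_sym qi eq_sym ti.
have [_ _ e] := ai; rewrite /mulc [LHS]e /=.
by rewrite /upd eqxx s0 (negbTE pz) (negbTE qz) (negbTE tz) !(minn_idPl _).
Qed.

End Multiply.

Fixpoint doubled (l : seq bool) : seq bool := if l is b :: l' then b :: b :: doubled l' else [::].

Lemma doubledE l : flatten [seq [:: b; b] | b <- l] = doubled l.
Proof. by elim: l => //= b l ->. Qed.

Lemma bin_digitsS m : 0 < m ->
  bin_digits m = odd m :: (if 1 < m then bin_digits (m %/ 2) else [::]).
Proof.
move=> m0; rewrite /bin_digits; case: ltnP => [m1|m1]; last first.
  by have -> : m = 1 by apply/eqP; rewrite eqn_leq m1.
rewrite trunc_log2S // -divn2 /mkseq; set l := (trunc_log 2 _).+1.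
have -> : iota 0 l.+1 = 0 :: [seq 1 + i | i <- iota 0 l] by rewrite -(iotaDl 1 0).
rewrite map_cons -map_comp expn0 divn1; congr (_ :: _); apply: eq_map => i /=.
by rewrite add1n expnS divnMA.
Qed.

End Emission.

(** * Computing the reduction *)

Definition nvars := 15.
Definition v_zero : 'I_nvars := @Ordinal 15 0 isT.
Definition v_top : 'I_nvars := @Ordinal 15 1 isT.
Definition v_n : 'I_nvars := @Ordinal 15 2 isT.
Definition v_i : 'I_nvars := @Ordinal 15 3 isT.
Definition v_j : 'I_nvars := @Ordinal 15 4 isT.
Definition v_i' : 'I_nvars := @Ordinal 15 5 isT.
Definition v_j' : 'I_nvars := @Ordinal 15 6 isT.
Definition v_x : 'I_nvars := @Ordinal 15 7 isT.
Definition v_y : 'I_nvars := @Ordinal 15 8 isT.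
Definition v_f : 'I_nvars := @Ordinal 15 9 isT.
Definition v_r : 'I_nvars := @Ordinal 15 10 isT.
Definition v_a : 'I_nvars := @Ordinal 15 11 isT.
Definition v_b : 'I_nvars := @Ordinal 15 12 isT.
Definition v_z : 'I_nvars := @Ordinal 15 13 isT.

(** * Binary conversion, products and the initial powers *)

Section Program.
Variable w : seq bool.
Notation cmd := (cmd nvars).
Notation state := (state nvars).
Notation exec := (exec v_top w).
Implicit Types (s : state) (c : cmd).

(** Counts in pairs: [v_f] is the parity so far and [v_y] the number of complete pairs. *)
Definition halve_body : cmd :=
  CIf (AEq v_f v_zero) (CInc v_f) (CSeq (CSet v_f (Some v_zero)) (CInc v_y)).

Definition halve : cmd :=
  CSeq (CSeq (CSet v_y (Some v_zero)) (CSet v_f (Some v_zero))) (CFor v_a v_x halve_body).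

Definition emit2 (b : bool) : cmd := CSeq (CEmit nvars b) (CEmit nvars b).

Definition conv_body : cmd :=
  CIf (AEq v_x v_zero) (CSkip nvars)
   (CSeq halve
   (CSeq (CIf (AEq v_f v_zero) (emit2 false) (emit2 true)) (CSet v_x (Some v_y)))).

(* destroys [v_x] *)
Definition conv : cmd := CFor v_r v_top conv_body.

Lemma exec_halve s : s.1 v_zero = 0 -> s.1 v_x <= s.1 v_top ->
  (exec halve s).1 v_y = (s.1 v_x)./2 /\ (exec halve s).1 v_f = odd (s.1 v_x).
Proof.
move=> s0 le; rewrite /halve [exec _ _]/=.
set s1 := setv (setv s _ _) _ _.
have -> : minn (s1.1 v_x) (s1.1 v_top) = s.1 v_x by rewrite /s1 /= /upd /= (minn_idPl le).
set s2 := setv s1 v_a 0.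
suff: let s' := iter (s.1 v_x) (fun s' => let s'' := exec halve_body s' in setv s'' v_a (s''.1 v_a).+1) s2 in
   [/\ s'.1 v_y = (s.1 v_x)./2, s'.1 v_f = odd (s.1 v_x) & s'.1 v_zero = 0] by case.
elim: (s.1 v_x) => [|m IH]; first by rewrite /= /upd /= s0.
rewrite iterS; move: IH; set s' := iter m _ _ => -[hy hf hz] /=.
rewrite hz hf uphalf_half; case: (odd m) hf => hf /=; rewrite /upd /= ?hy ?hf hz; split=> //.
Qed.

Lemma exec_conv_body s : s.1 v_zero = 0 -> s.1 v_x <= s.1 v_top ->
  (exec conv_body s).1 v_x = (s.1 v_x)./2 /\
  (exec conv_body s).2 = s.2 ++ (if s.1 v_x == 0 then [::] else [:: odd (s.1 v_x); odd (s.1 v_x)]).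
Proof.
move=> s0 le; have [hy hf] := exec_halve s0 le.
have h2 : (exec halve s).2 = s.2 by exact: exec_silent.
have hz : (exec halve s).1 v_zero = 0 by rewrite exec_frame.
rewrite /conv_body; move: (halve) hy hf h2 hz => hv hy hf h2 hz.
rewrite [exec _ _]/= s0; case: eqP => [->|_]; first by rewrite cats0.
rewrite hf hz; case: (odd (s.1 v_x)) => /=; rewrite /upd /= hy h2.
  by rewrite -!cats1 -catA.
by rewrite -!cats1 -catA.
Qed.

(** Each round prints the lowest digit and halves the value, and rounds at value 0 do nothing. So
    [v_top] rounds are enough for any value up to [v_top]. *)
Lemma exec_conv s : s.1 v_zero = 0 -> 0 < s.1 v_x <= s.1 v_top ->
  (exec conv s).2 = s.2 ++ doubled (bin_digits (s.1 v_x)).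
Proof.
move=> s0 /andP[x0 le].
pose out x := if x == 0 then [::] else doubled (bin_digits x).
have -> : doubled (bin_digits (s.1 v_x)) = out (s.1 v_x) by rewrite /out gtn_eqF.
have outS x : out x = (if x == 0 then [::] else [:: odd x; odd x]) ++ out x./2.
  rewrite /out; case: x => // x; rewrite [RHS]/= bin_digitsS // divn2.
  by case: x => [|x] //; rewrite ltnS /=.
pose G s' := let s'' := exec conv_body s' in setv s'' v_r (s''.1 v_r).+1.
suff key m s1 : s1.1 v_zero = 0 -> s1.1 v_x <= m -> m <= s1.1 v_top ->
    (iter m G s1).2 = s1.2 ++ out (s1.1 v_x).
  have -> : exec conv s = iter (s.1 v_top) G (setv s v_r 0) by rewrite /conv [LHS]/= minnn.
  by rewrite key.
elim: m s1 => [|m IH] s1 s10 le1 le2.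
  by move: le1; rewrite leqn0 => /eqP->; rewrite cats0.
have [hx ho] := exec_conv_body s10 (leq_trans le1 le2).
have hz : (exec conv_body s1).1 v_zero = 0 by rewrite exec_frame.
have ht : (exec conv_body s1).1 v_top = s1.1 v_top by rewrite exec_frame.
have gx : (G s1).1 v_x = (s1.1 v_x)./2 by rewrite -hx /G; move: (conv_body) => cb.
have g2 : (G s1).2 = (exec conv_body s1).2 by [].
rewrite iterSr IH.
- by rewrite gx g2 ho -catA -outS.
- by rewrite /G; move: (conv_body) hz => cb hz; exact: hz.
- by rewrite gx; lia.
- by rewrite /G; move: (conv_body) ht => cb ht; rewrite /= /upd /= ht ltnW.
Qed.

Lemma writes_incs r (z x : 'I_nvars) : writes (incs r z) x -> x = z.
Proof. by elim: r => //= r IH /orP[/IH|/eqP]. Qed.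

Lemma wf_incs r (z : 'I_nvars) : wf v_zero v_top (incs r z).
Proof. by elim: r => //= r ->. Qed.

Definition mult (r : nat) (z p q : 'I_nvars) : cmd := mulc v_zero r z v_a v_b p q.

Lemma writes_mult r z p q x : writes (mult r z p q) x -> x \in [:: z; v_a; v_b].
Proof.
rewrite !inE /= => /or4P[->|->|->|/writes_incs->]; rewrite ?eqxx ?orbT //.
Qed.

Lemma wf_mult r (z p q : 'I_nvars) : z \in [:: v_z; v_x] -> p \in [:: v_n; v_top] ->
  q \in [:: v_n; v_top] -> wf v_zero v_top (mult r z p q).
Proof.
move=> hz hp hq; rewrite /mult /mulc /= wf_incs.
have nw x : x != z -> writes (incs r z) x = false.
  by move=> ne; apply/negbTE/negP=> /writes_incs e; rewrite e eqxx in ne.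
by move: hz hp hq; rewrite !inE => /orP[] /eqP ez /orP[] /eqP-> /orP[] /eqP->; rewrite ?nw ez.
Qed.

Lemma exec_mult r z p q s : z \in [:: v_z; v_x] -> p \in [:: v_n; v_top] ->
  q \in [:: v_n; v_top] -> s.1 v_zero = 0 -> s.1 v_n <= s.1 v_top ->
  (exec (mult r z p q) s).1 z = s.1 p * (s.1 q * r).
Proof.
move=> hz hp hq s0 le; apply: exec_mulc.
- by move: hz; rewrite !inE => /orP[] /eqP->.
- by move: hz hp hq; rewrite !inE => /orP[] /eqP-> /orP[] /eqP-> /orP[] /eqP->.
- exact: s0.
- by move: hp; rewrite !inE => /orP[] /eqP->.
- by move: hq; rewrite !inE => /orP[] /eqP->.
Qed.

Definition square : cmd := CSeq (mult 1 v_z v_top v_top) (CSet v_top (Some v_z)).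

Definition squares k c : cmd := iter k (fun c => CSeq c square) c.

Fixpoint squares_cost k x :=
  if k is k'.+1 then squares_cost k' x + (cost (mult 1 v_z v_top v_top) (x ^ (2 ^ k')) + 2) else 0.

Notation prog_runs := (prog_runs v_zero v_top w).

Lemma squares_spec k c s T : prog_runs c s T ->
  (exec c s).1 v_zero = 0 -> (exec c s).1 v_n <= (exec c s).1 v_top ->
  let s' := exec (squares k c) s in
  [/\ prog_runs (squares k c) s (T + squares_cost k ((exec c s).1 v_top)),
      s'.1 v_zero = 0, s'.1 v_n = (exec c s).1 v_n,
      s'.1 v_top = (exec c s).1 v_top ^ (2 ^ k) & s'.2 = (exec c s).2].
Proof.
move=> hr hz hn; elim: k => [|k] /=; first by rewrite addn0 expn0 expn1.
set s1 := exec (squares k c) s => -[r1 z1 n1 t1 o1].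
have n1t : s1.1 v_n <= s1.1 v_top.
  rewrite n1 t1; apply: leq_trans hn _; case: ((exec c s).1 v_top) => // m.
  by rewrite -[X in X <= _]expn1 leq_pexp2l // expn_gt0.
set s2 := exec (mult 1 v_z v_top v_top) s1.
have nw x : x \notin [:: v_z; v_a; v_b] -> s2.1 x = s1.1 x.
  by move=> hx; apply: exec_frame; apply: contra hx => /writes_mult.
have e2 : s2.1 v_z = s1.1 v_top * s1.1 v_top.
  by rewrite /s2 exec_mult // muln1.
split.
- rewrite addnA; apply: prog_runs_seq r1 _; apply: prog_runs_seq.
    apply: prog_runs_cost => //; rewrite ?wf_mult ?t1 //.
  exact: prog_runs_set.
- by rewrite /upd /= nw.
- by rewrite /upd /= nw // n1.
- by rewrite /upd /= e2 t1 -expnD addnn -mul2n expnS.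
- rewrite -o1. exact: (exec_silent v_top w (c := square) s1 isT).
Qed.

(** Repeated squaring of the input length plus 2. [v_n] becomes the number of cells of the board;
    [v_top] is raised further so that the loop cap exceeds the numbers of vertices and of agents. *)
Definition setup D E : cmd :=
  squares E (CSeq (squares D (CSeq (CSeq (CSet v_top None) (CInc v_top)) (CInc v_top)))
                  (CSet v_n (Some v_top))).

Definition setup_cost D E x :=
  (4 + squares_cost D (x + 2) + 2) + squares_cost E ((x + 2) ^ (2 ^ D)).

Lemma setup_spec D E : let s := exec (setup D E) (state0 nvars) in
  [/\ prog_runs (setup D E) (state0 nvars) (setup_cost D E (size w)),
      s.1 v_zero = 0, s.1 v_n = (size w + 2) ^ (2 ^ D),
      s.1 v_top = (s.1 v_n) ^ (2 ^ E) & s.2 = [::]].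
Proof.
set c0 := CSeq (CSeq (CSet v_top None) (CInc v_top)) (CInc v_top).
have r0 : prog_runs c0 (state0 nvars) 4.
  by apply: (prog_runs_seq (T1 := 3) (T2 := 1)); [apply: (prog_runs_seq (T1 := 2) (T2 := 1)) |];
    [exact: prog_runs_set | exact: prog_runs_inc..].
have e0 : (exec c0 (state0 nvars)).1 v_top = size w + 2 by rewrite /= /upd /= addn2.
have [|//|] := @squares_spec D c0 (state0 nvars) 4 r0 => //.
rewrite e0 => r1 z1 n1 t1 o1.
set c1 := squares D c0 in r1 z1 n1 t1 o1 *.
have r2 : prog_runs (CSeq c1 (CSet v_n (Some v_top))) (state0 nvars) (4 + squares_cost D (size w + 2) + 2).
  by apply: prog_runs_seq r1 _; exact: prog_runs_set.
have [||] := @squares_spec E _ _ _ r2.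
- by move: z1; rewrite /= /upd /=.
- by rewrite /= /upd /=.
rewrite -/(setup D E) [(exec (CSeq c1 _) _).1 v_top]/= /upd /= t1 => r3 z3 n3 t3 o3.
split=> //; first by rewrite t3 n3.
  by rewrite o3 o1.
Qed.

End Program.

Lemma polyb_exp f k : polyb f -> polyb (fun x => f x ^ k).
Proof.
move=> h; elim: k => [|k IH]; first exact: polyb_const.
by apply: (polyb_le (g := fun x => f x * f x ^ k)) => [x|]; [rewrite expnS | exact: polyb_mul].
Qed.

Lemma polyb_squares_cost k : polyb (squares_cost k).
Proof.
elim: k => [|k IH] /=; first exact: polyb_const.
apply: polyb_add => //; apply: polyb_add; last exact: polyb_const.
by apply: (polyb_comp (f := cost (mult 1 v_z v_top v_top))); [exact: polyb_cost | apply: polyb_exp; exact: polyb_id].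
Qed.

Lemma polyb_setup D : polyb (fun x => (x + 2) ^ (2 ^ D)).
Proof. by apply: polyb_exp; apply: polyb_add; [exact: polyb_id | exact: polyb_const]. Qed.

Lemma polyb_setup_cost D E : polyb (setup_cost D E).
Proof.
apply: polyb_add.
  apply: polyb_add; last exact: polyb_const.
  apply: polyb_add; first exact: polyb_const.
  apply: polyb_comp (polyb_squares_cost D) _; apply: polyb_add; [exact: polyb_id | exact: polyb_const].
exact: polyb_comp (polyb_squares_cost E) (polyb_setup D).
Qed.

Lemma enc_natE m : enc_nat m = doubled (bin_digits m) ++ [:: false; true].
Proof. by rewrite /enc_nat doubledE. Qed.

Fixpoint bin_value (l : seq bool) : nat := if l is b :: l' then b + (bin_value l').*2 else 0.

Lemma bin_digitsK : cancel bin_digits bin_value.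
Proof.
move=> m; have [k] := ubnP m; elim: k m => // k IH [|m] le //.
rewrite bin_digitsS //; case: ltnP => [m1|]; last by case: m {le}.
rewrite -[LHS]/(odd m.+1 + (bin_value (bin_digits (m.+1 %/ 2))).*2) divn2 IH; last by lia.
by rewrite odd_double_half.
Qed.

(** Read in pairs, digits are equal pairs, whereas the end mark is the unequal pair [false],
    [true]. *)
Lemma doubled_prefix l l' r r' :
  doubled l ++ [:: false; true] ++ r = doubled l' ++ [:: false; true] ++ r' ->
  l = l' /\ r = r'.
Proof.
elim: l l' => [|b l IH] [|b' l'] /=; first by case.
- by case: b' => // -[].
- by case: b => // -[].
by case=> -> _ /IH[-> ->].
Qed.

Lemma enc_nat_prefix m m' r r' : enc_nat m ++ r = enc_nat m' ++ r' -> m = m' /\ r = r'.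
Proof. by rewrite !enc_natE -!catA => /doubled_prefix[/(can_inj bin_digitsK)]. Qed.

Lemma enc_nat_pow2 k : enc_nat (2 ^ k) = nseq (2 * k) false ++ [:: true; true; false; true].
Proof.
rewrite enc_natE; have -> : bin_digits (2 ^ k) = nseq k false ++ [:: true].
  elim: k => // k IH; rewrite bin_digitsS ?expn_gt0 // expnS mulKn // IH oddM /=.
  by rewrite -{1}[1]/(2 * 0 + 1) ifT //; have := expn_gt0 2 k; lia.
by elim: k => // k IH; rewrite mulnS add2n /= IH.
Qed.

(** * The edge relation as a formula over counters *)

Section Formula.
Variable M : TM.
Notation Q := (mstate M).
Notation S := (msym M).
Notation kind := (kind Q S).
Notation form := (form nvars).

Definition feq (x y : 'I_nvars) : form := FAtom (AEq x y).
Definition fzero (x : 'I_nvars) : form := feq x v_zero.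
Definition fsucc (x y : 'I_nvars) : form := FAtom (ASucc x y).
Definition fbool (b : bool) : form := FBool nvars b.

Definition wfF (x : kind) (i j : 'I_nvars) : form :=
  FAnd (FOr (fbool (0 < arity x)) (fzero i)) (FOr (fbool (1 < arity x)) (fzero j)).

Definition input_symF (i : 'I_nvars) (c : S) : form :=
  FOr (FAnd (FAtom (AIn i None)) (fbool (c == Some (@tm_blank M))))
 (FOr (FAnd (FAtom (AIn i (Some true))) (fbool (c == Some (@tm_in M true))))
      (FAnd (FAtom (AIn i (Some false))) (fbool (c == Some (@tm_in M false))))).

(** [v_n] holds [n'.+1], so [fsucc i v_n] tests for the last cell; a move to the right needs no test
    of the board's end, since [i'] ranges over cells only. *)
Definition mruleF (q : Q) (b c : S) (q' : Q) (i i' : 'I_nvars) : form :=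
  match q, q' with
  | inr true, inr true => FAnd (fbool (c == b)) (fsucc i i')
  | inr true, inr false => FAnd (fbool (c == b)) (FAnd (feq i i') (fsucc i v_n))
  | inr false, inl q1 =>
    FAnd (fbool (q1 == @tm_q0 M)) (FAnd (input_symF i c) (FAnd (fzero i) (fzero i')))
  | inr false, inr false => FAnd (input_symF i c) (fsucc i' i)
  | inl q, inl q1 =>
    if @tm_halt M q then fbool false
    else if b is Some a then
      let: (q2, a2, mv) := @tm_delta M q a in
      FAnd (fbool ((q1 == q2) && (c == Some a2)))
        (if mv then fsucc i i' else FOr (fsucc i' i) (FAnd (fzero i) (fzero i')))
    else fbool false
  | _, _ => fbool false
  end.

Definition darcF (x x' : kind) (i j i' j' : 'I_nvars) : form :=
  match x, x' with
  | Kt, Ktheta | Kt, Kgamma | Kt, KV1 _ => fbool true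
  | KV1 g, KV2 g' | KV2 g, KE g' => FAnd (fbool (g == g')) (FAnd (feq i i') (feq j j'))
  | Ktheta, KB _ _ | Ktheta, Ks | Kgamma, KB _ _ | Kgamma, Ks
  | Kgamma, Khub | Kgamma, Khubs
  | Khub, KE (GX _ _) | Khub, KE GA | Khubs, KE GS
  | Ks, KE GS => fbool true
  | Ks, KT (Main q) => FAnd (fbool (q == minit M)) (fzero i')
  | KE GS, Kp _ => feq i i'
  | KT y, KB y' _ => FAnd (fbool (y == y')) (FAnd (feq i i') (fbool (~~ acc_main (@macc M) y)))
  | KB y c, KE (GX y' c') => FAnd (fbool (y == y')) (FAnd (fbool (c == c')) (feq i i'))
  | KE (GX y _), Kp _ => FAnd (feq j i') (FOr (fbool (shown y == None)) (FNot (feq i j)))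
  | KE (GX y _), KY => FOr (fbool (shown y == None)) (FNot (feq i j))
  | KE (GX y _), Km a | KE (GX y _), KX a =>
    FAnd (feq j i') (FAnd (feq i j) (fbool (shown y == Some a)))
  | KE GA, KY | KE GA, KX _ => fbool true
  | KE GA, KT y => fbool (acc_main (@macc M) y)
  | Km a, Kp b => FAnd (fbool (a == b)) (feq i i')
  | KX a, Kp b | Km a, Km b | KX a, KX b => FAnd (fbool (a != b)) (feq i i')
  | KX _, KY => fbool true
  | KT (Main q), KT (W1 q' _) => FAnd (fbool (q == q')) (feq i i')
  | KT (W1 q b), KT (W2 q' b' _) => FAnd (fbool (q == q')) (FAnd (fbool (b == b')) (feq i i'))
  | KT (W2 q b c), KT (Main q') => mruleF q b c q' i i'
  | _, _ => fbool false
  end.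

Definition hubF (x : kind) (i j : 'I_nvars) : form :=
  FAnd (fbool (x == Khub)) (FAnd (fzero i) (fzero j)).

Definition edgeF (x x' : kind) : form :=
  let wv := wfF x v_i v_j in let wv' := wfF x' v_i' v_j' in
  FOr (FAnd (FAnd wv wv') (FOr (darcF x x' v_i v_j v_i' v_j') (darcF x' x v_i' v_j' v_i v_j)))
 (FAnd (FNot (FAnd wv wv')) (FOr (FAnd wv (hubF x v_i v_j)) (FAnd wv' (hubF x' v_i' v_j')))).

Variables (w : seq bool) (n' : nat) (e : env nvars).
Notation n := n'.+1.
Notation vertex := (vertex Q S n').
Notation feval := (feval w).
Hypothesis e_zero : e v_zero = 0.
Hypothesis e_n : e v_n = n.

Lemma wfFE (x : kind) vi vj (i j : 'I_n) : e vi = i -> e vj = j ->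
  feval (wfF x vi vj) e = wfv (x, i, j).
Proof. by move=> hi hj; rewrite /= e_zero hi hj -!val_eqE. Qed.

Lemma input_symFE vi (i : 'I_n) c : e vi = i ->
  feval (input_symF vi c) e = (c == Some (input_sym M w i)).
Proof.
rewrite /= /onth_in /input_sym => ->; case: (i < size w); last by rewrite /= !orbF.
by case: (nth _ _ _); rewrite /= ?orbF.
Qed.

Lemma mruleFE q b c q' vi vi' (i i' : 'I_n) : e vi = i -> e vi' = i' ->
  feval (mruleF q b c q' vi vi') e = (mrule w q i b == Some (q', c, i')).
Proof.
move=> hi hi'.
have someE (x : Q) (y : S) (z : 'I_n) : (Some (x, y, z) == Some (q', c, i')) = [&& x == q', y == c & z == i'].
  by rewrite (inj_eq (@Some_inj _)) !xpair_eqE andbA.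
have succE (l l' : 'I_n) : (l' == l.+1 :> nat) = (l.+1 < n) && (inord l.+1 == l').
  case: ltnP => [lt|le]; first by rewrite -val_eqE /= inordK // eq_sym.
  by rewrite ltn_eqF // (leq_trans (ltn_ord l')).
have predE (l l' : 'I_n) : (l == l'.+1 :> nat) || (l == 0 :> nat) && (l' == 0 :> nat) = (inord l.-1 == l').
  rewrite -val_eqE /= inordK ?(leq_ltn_trans (leq_pred l)) //.
  by case: (val l) => [|m] //=; rewrite ?eqSS ?orbF // eq_sym.
have lastE (l : 'I_n) : (l == n' :> nat) = ~~ (l.+1 < n).
  by rewrite ltnS -leqNgt eqn_leq -ltnS ltn_ord.
case: q => [q|[]] /=.
- case: q' someE => [q'|[]] someE /=; case: (tm_halt q) => //; case: b => // a;
    case: (tm_delta q a) => -[q1 a1] mv.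
  + have -> k : (if k < n then Some (inl q1 : Q, Some a1, inord k : 'I_n) else None) ==
        Some (inl q', c, i') = [&& q' == q1, c == Some a1, k < n & inord k == i'].
      case: (k < n); last by rewrite !andbF.
      by rewrite someE (inj_eq inl_inj) (eq_sym q1) (eq_sym (Some a1)).
    rewrite /= andbA; congr (_ && _); case: mv; rewrite /= ?e_zero hi hi'; first exact: succE.
    by rewrite predE (leq_ltn_trans (leq_pred i)).
  + by case: (_ < _); rewrite ?someE.
  + by case: (_ < _); rewrite ?someE.
- rewrite lastE; case: q' someE => [q'|[]] someE /=; rewrite ?e_n ?hi ?hi'.
  + by case: ifP; rewrite ?someE.
  + by rewrite succE; case: ltnP => _; rewrite someE /= ?andbF // eq_sym.
  + rewrite /= ?eqSS [n' == _]eq_sym lastE; case: ltnP => _; rewrite someE /= ?andbF //.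
    by rewrite andbT eq_sym -val_eqE.
- have symE := input_symFE c hi; rewrite /= in symE.
  case: q' someE => [q'|[]] someE; rewrite /= ?symE ?e_zero ?hi ?hi'.
  + case: ifP => [/eqP i0|ne]; rewrite someE ?andbF //.
    by rewrite (inj_eq inl_inj) -[i == i']val_eqE /= i0 !(eq_sym _ 0) (eq_sym q') (eq_sym c).
  + by case: ifP; rewrite someE.
  + rewrite (eq_sym c); case: ifP => [/eqP i0|ne]; rewrite someE; first by rewrite i0 andbF.
    by rewrite /= -predE ne orbF.
Qed.

Lemma darcFE (x x' : kind) vi vj vi' vj' (i j i' j' : 'I_n) :
  e vi = i -> e vj = j -> e vi' = i' -> e vj' = j' ->
  feval (darcF x x' vi vj vi' vj') e = darc (@mrule M w n') (minit M) (@macc M) (x, i, j) (x', i', j').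
Proof.
move=> hi hj hi' hj'.
case: x => [| | | | | | |a|a|a|[q|q b|q b c]|y c|[| |y c]|[| |y c]|[| |y c]];
  case: x' => [| | | | | | |a'|a'|a'|[q'|q' b'|q' b' c']|y' c'|[| |y' c']|[| |y' c']|[| |y' c']] //=.
all: rewrite ?(mruleFE _ _ _ _ hi hi') ?e_zero ?hi ?hj ?hi' ?hj' //.
Qed.

Lemma hubFE (x : kind) vi vj (i j : 'I_n) : e vi = i -> e vj = j ->
  feval (hubF x vi vj) e = ((x, i, j) == (Khub, ord0, ord0)).
Proof. by move=> hi hj; rewrite /= e_zero hi hj !xpair_eqE andbA. Qed.

Lemma edgeFE (x x' : kind) (i j i' j' : 'I_n) :
  e v_i = i -> e v_j = j -> e v_i' = i' -> e v_j' = j' ->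
  feval (edgeF x x') e = medge w ((x, i, j) : vertex) (x', i', j').
Proof.
move=> hi hj hi' hj'; rewrite /medge /edge -(wfFE x hi hj) -(wfFE x' hi' hj').
rewrite -(darcFE x x' hi hj hi' hj') -(darcFE x' x hi' hj' hi hj).
rewrite -(hubFE x hi hj) -(hubFE x' hi' hj') /edgeF.
move: (wfF _ _ _) (wfF _ _ _) (darcF _ _ _ _ _ _) (darcF _ _ _ _ _ _) (hubF _ _ _) (hubF _ _ _).
by move=> f1 f2 f3 f4 f5 f6 /=; case: ifP; rewrite /= ?orbF.
Qed.

Section Variables_used.
Variable D : pred 'I_nvars.
Hypotheses (D0 : D v_zero) (Dn : D v_n).

Lemma mruleF_vars q b c q' i i' : D i -> D i' -> all D (form_vars (mruleF q b c q' i i')).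
Proof.
move=> Di Di'; case: q => [q|[]]; case: q' => [q'|[]] //=; rewrite ?Di ?Di' ?D0 ?Dn //.
case: (tm_halt q) => //; case: b => // a; case: (tm_delta q a) => -[q2 a2] [] /=.
  by rewrite Di Di'.
by rewrite Di Di' D0.
Qed.

Lemma darcF_vars x x' i j i' j' : D i -> D j -> D i' -> D j' ->
  all D (form_vars (darcF x x' i j i' j')).
Proof.
move=> Di Dj Di' Dj'.
case: x => [| | | | | | |a|a|a|[q|q b|q b c]|y c|[| |y c]|[| |y c]|[| |y c]];
  case: x' => [| | | | | | |a'|a'|a'|[q'|q' b'|q' b' c']|y' c'|[| |y' c']|[| |y' c']|[| |y' c']] //=.
all: by rewrite ?mruleF_vars ?D0 ?Di ?Dj ?Di' ?Dj'.
Qed.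

Lemma edgeF_vars x x' : D v_i -> D v_j -> D v_i' -> D v_j' -> all D (form_vars (edgeF x x')).
Proof.
by move=> Di Dj Di' Dj'; rewrite /= !all_cat !darcF_vars //= !(Di, Dj, Di', Dj', D0).
Qed.

End Variables_used.

End Formula.

Lemma nth_flatten_rows (T : Type) (x0 : T) m (ss : seq (seq T)) i j :
  all (fun r => size r == m) ss -> j < m -> i < size ss ->
  nth x0 (flatten ss) (i * m + j) = nth x0 (nth [::] ss i) j.
Proof.
elim: ss i => [|r ss IH] [|i] //= /andP[/eqP sr hs] ltj lti; rewrite nth_cat sr.
  by rewrite mul0n add0n ltj.
by rewrite mulSn -addnA ltnNge leq_addr /= addKn IH.
Qed.

Lemma size_flatten_const (A B : Type) (f : A -> seq B) m (r : seq A) :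
  (forall x, size (f x) = m) -> size (flatten [seq f x | x <- r]) = size r * m.
Proof. by move=> h; elim: r => //= x r IH; rewrite size_cat IH h mulSn. Qed.

(** * Adjacency matrices and the enumeration of the vertices *)

Section ListedGraph.
Variables (V : eqType) (vs : seq V) (e : rel V).
Hypotheses (vs_uniq : uniq vs) (vs_all : forall v, v \in vs).

Definition listed (x : 'I_(size vs)) : V := tnth (in_tuple vs) x.
Definition rank (v : V) : 'I_(size vs) := Ordinal (etrans (index_mem v vs) (vs_all v)).

Lemma listedK : cancel listed rank.
Proof.
move=> x; have v0 : V := listed x; apply: val_inj.
by rewrite /= /listed (tnth_nth v0) /= index_uniq.
Qed.

Lemma rankK : cancel rank listed.
Proof. by move=> v; rewrite /listed (tnth_nth v) /= nth_index. Qed.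

Definition adj_matrix : seq bool := flatten [seq [seq e v v' | v' <- vs] | v <- vs].

Lemma size_adj_matrix : size adj_matrix = size vs * size vs.
Proof.
by apply: size_flatten_const => v; rewrite size_map.
Qed.

Lemma mat_rel_adj_matrix x y : mat_rel adj_matrix x y = e (listed x) (listed y).
Proof.
rewrite /mat_rel nth_flatten_rows ?size_map ?ltn_ord //; last first.
  by apply/allP=> r /mapP[v _ ->]; rewrite size_map.
have v0 : V := listed x.
by rewrite /listed !(tnth_nth v0) !(nth_map v0) ?ltn_ord.
Qed.

End ListedGraph.

Lemma connect_pull (V V' : finType) (e : rel V) (e' : rel V') (f : V' -> V) (g : V -> V') :
  cancel f g -> cancel g f -> (forall x y, e' x y = e (f x) (f y)) ->
  forall x y, connect e (f x) (f y) -> connect e' x y.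
Proof.
move=> fK gK eE x y /connectP[p hp hy]; apply/connectP; exists (map g p).
  elim: p x hp {hy} => //= v p IH x /andP[h1 h2]; rewrite eE gK h1; apply: IH.
  by rewrite gK.
by apply: (can_inj fK); rewrite hy -[in RHS](fK x) last_map gK.
Qed.

Section Vertices.
Variables (K : finType) (n : nat).
(** The order is that of the printing loops. The kinds vary fastest, so the vertices with both
    indices 0 come first and the numbers of [s] and [t] do not depend on [n]. *)
Definition triples : seq (K * 'I_n * 'I_n) :=
  flatten [seq flatten [seq [seq (x, i, j) | x <- enum K] | j <- enum 'I_n] | i <- enum 'I_n].

Lemma flatten_triples (T : Type) (f : K * 'I_n * 'I_n -> seq T) :
  flatten [seq f v | v <- triples] = flatten [seq flatten [seq flatten
    [seq f (x, i, j) | x <- enum K] | j <- enum 'I_n] | i <- enum 'I_n].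
Proof.
have flatF (A B : Type) (g : A -> seq B) (ss : seq (seq A)) :
    flatten (map g (flatten ss)) = flatten [seq flatten (map g s) | s <- ss].
  by elim: ss => //= s ss IH; rewrite map_cat flatten_cat IH.
rewrite /triples flatF -map_comp; congr flatten; apply: eq_map => i /=.
rewrite flatF -map_comp; congr flatten; apply: eq_map => j /=.
by rewrite -map_comp.
Qed.

Lemma size_triples : size triples = n * (n * #|K|).
Proof.
rewrite /triples -[X in X * _]size_enum_ord; apply: size_flatten_const => i.
rewrite -[X in X * _]size_enum_ord; apply: size_flatten_const => j.
by rewrite size_map cardE.
Qed.

Lemma mem_triples v : v \in triples.
Proof.
case: v => -[x i] j; apply/flattenP; eexists; first by apply: map_f (mem_enum _ i).
apply/flattenP; eexists; first by apply: map_f (mem_enum _ j).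
by apply: (map_f (fun y => (y, i, j))); rewrite mem_enum.
Qed.

Lemma uniq_triples : uniq triples.
Proof.
apply: (leq_size_uniq (enum_uniq {: K * 'I_n * 'I_n})) => [v _|]; first exact: mem_triples.
by rewrite size_triples -cardE !card_prod card_ord; lia.
Qed.

End Vertices.

Lemma index_triples (K : finType) n' (x : K) :
  index (x, ord0, ord0) (triples K n'.+1) = index x (enum K).
Proof.
rewrite /triples enum_ordSl /= !index_cat.
rewrite (map_f (fun y => (y, ord0, ord0))) ?mem_cat ?mem_enum //=.
have inj : injective (fun y : K => (y, ord0 : 'I_n'.+1, ord0 : 'I_n'.+1)) by move=> y z [].
by rewrite (map_f (fun y => (y, ord0, ord0))) ?mem_enum // (index_map inj).
Qed.

(** * The program that prints the instance *)

Section Output.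
Variables (M : TM) (si ti : nat) (speed : option nat).
Notation kind := (kind (mstate M) (msym M)).
Notation cmd := (cmd nvars).
Notation env := (env nvars).
Notation state := (state nvars).
Notation kinds := (enum {: kind}).

Definition num_out : cmd := CSeq conv (emit_list nvars [:: false; true]).

Definition vertex_count : cmd := CSeq (mult #|{: kind}| v_x v_n v_n) num_out.

Definition agent_count : cmd :=
  CSeq (CSeq (CSeq (CSet v_x (Some v_n)) (CInc v_x)) (CInc v_x)) num_out.

(** [speed] is [None] for the problem without time. Otherwise the number printed is 2 to the power
    [C * n]: its binary digits are zeros, doubled by the encoding, and a final one. *)
Definition time_bound : cmd :=
  if speed is Some C then CSeq (CFor v_i v_n (emit_list nvars (nseq (2 * C) false)))
                               (emit_list nvars [:: true; true; false; true])
  else CSkip nvars.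

Definition matrix : cmd :=
  CFor v_i v_n (CFor v_j v_n (seqs [seq
    CFor v_i' v_n (CFor v_j' v_n (seqs [seq
      branch (edgeF x x') (CEmit nvars true) (CEmit nvars false) | x' <- kinds]))
    | x <- kinds])).

Definition output : cmd :=
  CSeq vertex_count (CSeq (emit_list nvars (enc_nat si ++ enc_nat ti))
    (CSeq agent_count (CSeq time_bound matrix))).

Variable w : seq bool.
Notation emits := (emits v_zero v_top w).
Notation exec := (exec v_top w).
Implicit Types (e : env) (s : state).

Definition consts : pred 'I_nvars := [in [:: v_zero; v_top; v_n]].

Definition loopF (i : 'I_nvars) (F : env -> seq bool) e : seq bool :=
  flatten [seq F (upd e i v) | v <- iota 0 (minn (e v_n) (e v_top))].

Definition kindsF (F : kind -> env -> seq bool) e : seq bool := flatten [seq F x e | x <- kinds].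

Definition bitF (x x' : kind) e : seq bool :=
  if feval w (edgeF x x') e then [:: true] else [:: false].

Definition matrixF : env -> seq bool :=
  loopF v_i (loopF v_j (kindsF (fun x => loopF v_i' (loopF v_j' (kindsF (bitF x)))))).

Lemma matrix_emits : emits consts matrix matrixF.
Proof.
do 2!apply: emits_for => //; apply: emits_seqs => x.
do 2!apply: emits_for => //; apply: emits_seqs => x'.
apply: emits_branch; [exact: edgeF_vars | exact: emits_emit..].
Qed.

Definition timeF e : seq bool :=
  if speed is Some C then loopF v_i (fun=> nseq (2 * C) false) e ++ [:: true; true; false; true]
  else [::].

Lemma time_emits : emits consts time_bound timeF.
Proof.
rewrite /time_bound /timeF; case: speed => [C|]; last exact: emits_skip.
apply: emits_seq (emits_list _ _ _ _ _); apply: emits_for => //.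
exact: emits_list.
Qed.

Section Values.
Variable n' : nat.
Notation n := n'.+1.

Lemma loopFE i (F : env -> seq bool) (G : 'I_n -> seq bool) e :
  e v_n = n -> n <= e v_top -> (forall l : 'I_n, F (upd e i l) = G l) ->
  loopF i F e = flatten [seq G l | l <- enum 'I_n].
Proof.
move=> en /minn_idPl et h; rewrite /loopF en et -val_enum_ord -map_comp.
by congr flatten; apply: eq_map => l /=.
Qed.

Lemma matrixFE e : e v_zero = 0 -> e v_n = n -> n <= e v_top ->
  matrixF e = adj_matrix (triples kind n) (@medge M w n').
Proof.
move=> e0 en et; rewrite /adj_matrix flatten_triples.
apply: loopFE => // i; apply: loopFE => // j; congr flatten; apply: eq_map => x.
rewrite -[RHS]flatten_seq1 -map_comp flatten_triples.
apply: loopFE => // i'; apply: loopFE => // j'; congr flatten; apply: eq_map => x'.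
rewrite /bitF (@edgeFE M w n' _ _ _ x x' i j i' j') //.
by rewrite /=; case: (medge _ _ _).
Qed.

Lemma timeFE e : e v_n = n -> n <= e v_top ->
  timeF e = if speed is Some C then enc_nat (2 ^ (C * n)) else [::].
Proof.
move=> en et; rewrite /timeF; case: speed => // C; rewrite enc_nat_pow2; congr (_ ++ _).
rewrite (@loopFE _ _ (fun=> nseq (2 * C) false)) // -[in RHS](size_enum_ord n).
elim: (enum _) => [|l r IH] /=; first by rewrite !muln0.
by rewrite IH mulnS mulnDr nseqD.
Qed.

Lemma exec_num_out s : s.1 v_zero = 0 -> 0 < s.1 v_x <= s.1 v_top ->
  (exec num_out s).2 = s.2 ++ enc_nat (s.1 v_x).
Proof.
move=> s0 sx; have e := @exec_conv w s s0 sx.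
rewrite /num_out; move: (conv) e => c e.
have [_ _ _ ->] := @emits_list nvars v_zero v_top w consts [:: false; true].
by rewrite e enc_natE catA.
Qed.

Lemma exec_seqE c1 c2 s : exec (CSeq c1 c2) s = exec c2 (exec c1 s). Proof. by []. Qed.

Lemma kinds_gt0 : 0 < #|{: kind}|. Proof. by apply/card_gt0P; exists Kt. Qed.

Lemma vertex_count_frame x : consts x -> ~~ writes vertex_count x.
Proof.
rewrite /consts !inE => cx; apply/norP; split; last by case/or3P: cx => /eqP->.
by apply: contraTN cx => /(@writes_mult _ v_x v_n v_n); rewrite !inE => /or3P[] /eqP->.
Qed.

Lemma vertex_count_spec s : s.1 v_zero = 0 -> s.1 v_n = n ->
  n * (n * #|{: kind}|) <= s.1 v_top ->
  (exec vertex_count s).2 = s.2 ++ enc_nat (n * (n * #|{: kind}|)).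
Proof.
move=> s0 sn sx; have nt : n <= s.1 v_top by have := kinds_gt0; nia.
rewrite /vertex_count exec_seqE.
have ex : (exec (mult #|{: kind}| v_x v_n v_n) s).1 v_x = n * (n * #|{: kind}|).
  by rewrite exec_mult // sn.
have fr x : x \notin [:: v_x; v_a; v_b] ->
    (exec (mult #|{: kind}| v_x v_n v_n) s).1 x = s.1 x.
  by move=> hx; apply: exec_frame; apply: contra hx => /writes_mult.
rewrite exec_num_out ?ex ?fr // ?sx ?muln_gt0 ?kinds_gt0 //; congr (_ ++ _).
apply: exec_silent; rewrite /mult /mulc /=.
by elim: #|_| => [|m IH] /=; rewrite ?andbT.
Qed.

Lemma agent_count_spec s : s.1 v_zero = 0 -> s.1 v_n = n -> n.+2 <= s.1 v_top ->
  (exec agent_count s).2 = s.2 ++ enc_nat n.+2.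
Proof.
move=> s0 sn sx; rewrite /agent_count exec_seqE.
set s1 := exec _ s; have ex : s1.1 v_x = n.+2 by rewrite /s1 /= /upd /= sn.
by rewrite exec_num_out ?ex.
Qed.

Lemma output_spec s : s.1 v_zero = 0 -> s.1 v_n = n -> n * (n * #|{: kind}|) <= s.1 v_top ->
  n.+2 <= s.1 v_top ->
  (exec output s).2 = s.2 ++ enc_nat (n * (n * #|{: kind}|)) ++ enc_nat si ++ enc_nat ti ++
    enc_nat n.+2 ++ (if speed is Some C then enc_nat (2 ^ (C * n)) else [::]) ++
    adj_matrix (triples kind n) (@medge M w n').
Proof.
move=> s0 sn sx sk; rewrite /output 4!exec_seqE.
have frame c s' x : (forall x, consts x -> ~~ writes c x) -> consts x -> (exec c s').1 x = s'.1 x.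
  by move=> h cx; apply: exec_frame; exact: h.
have o1 := vertex_count_spec s0 sn sx.
have f1 x : consts x -> (exec vertex_count s).1 x = s.1 x by apply: frame; exact: vertex_count_frame.
move: (exec vertex_count s) o1 f1 => s1 o1 f1.
have [_ w2 _ o2] := @emits_list _ v_zero v_top w consts (enc_nat si ++ enc_nat ti).
have f2 x : consts x -> (exec (emit_list nvars (enc_nat si ++ enc_nat ti)) s1).1 x = s1.1 x by exact: frame.
move: (exec _ s1) (o2 s1) f2 => s2 {}o2 f2.
have f2' x : consts x -> s2.1 x = s.1 x by move=> cx; rewrite f2 ?f1.
have o3 : (exec agent_count s2).2 = s2.2 ++ enc_nat n.+2 by apply: agent_count_spec; rewrite f2'.
have f3 x : consts x -> (exec agent_count s2).1 x = s.1 x.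
  move=> cx; rewrite -f2' //; apply: frame cx => y; rewrite /consts !inE.
  by case/or3P=> /eqP->.
move: (exec agent_count s2) o3 f3 => s3 o3 f3.
have [_ w4 _ o4] := time_emits.
have f4 x : consts x -> (exec time_bound s3).1 x = s.1 x by move=> cx; rewrite -f3 //; exact: frame.
move: (exec time_bound s3) (o4 s3) f4 => s4 {}o4 f4.
have [_ _ _ ->] := matrix_emits.
have nt : n <= s.1 v_top by apply: leq_trans sk; rewrite leqW.
rewrite matrixFE ?f4 // o4 timeFE ?f3 // o3 o2 o1.
by rewrite -!catA.
Qed.

Lemma output_runs s : s.1 v_zero = 0 ->
  prog_runs v_zero v_top w output s (cost output (s.1 v_top)).
Proof.
move=> s0; have [g2 w2 _ _] := @emits_list _ v_zero v_top w consts (enc_nat si ++ enc_nat ti).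
have [g4 w4 _ _] := time_emits; have [g5 w5 _ _] := matrix_emits.
have wr x : consts x -> ~~ writes output x.
  move=> cx; have h1 := vertex_count_frame cx.
  apply/norP; split=> //; apply/norP; split; first exact: w2.
  apply/norP; split; first by move: cx; rewrite /consts !inE => /or3P[] /eqP->.
  by apply/norP; split; [exact: w4 | exact: w5].
apply: prog_runs_cost => //; try exact: wr.
apply/andP; split; first exact: introT andP (conj (@wf_mult #|{: kind}| v_x v_n v_n isT isT isT) isT).
apply/andP; split; first exact: g2.
by apply/andP; split=> //; apply/andP; split; [exact: g4 | exact: g5].
Qed.

End Values.
End Output.

(** * Correctness of the printed instance *)

Section Instance.
Variables (M : TM) (w : seq bool) (n' t : nat).
Notation n := n'.+1.
Hypothesis t_halts : @tm_halt M (tm_run M t w).1.1.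
Hypothesis t_space : forall t', t' <= t -> (tm_run M t' w).2 <= n'.
Notation kind := (kind (mstate M) (msym M)).
Notation V := (vertex (mstate M) (msym M) n').
Notation edge := (@medge M w n').

Let vlist : seq V := triples kind n.
Let vlist_uniq : uniq vlist := uniq_triples kind n.
Let vlist_all (v : V) : v \in vlist := mem_triples v.
Let A := adj_matrix vlist edge.
Let phi := @listed V vlist.
Let psi := rank vlist_all.
Let phiK : cancel phi psi := listedK vlist_uniq vlist_all.
Let psiK : cancel psi phi := rankK vlist_all.
Let eE x y : mat_rel A x y = edge (phi x) (phi y) := mat_rel_adj_matrix edge x y.
Let s := psi (vs _ _ _).
Let r := psi (vt _ _ _).

Lemma instance_valid : valid_graph (size vlist) A.
Proof.
split; first exact: size_adj_matrix; split; last split.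
- by move=> x y; rewrite !eE medge_sym.
- by move=> x; rewrite eE medge_irr.
by move=> x y; apply: connect_pull phiK psiK eE _ _ _; exact: medge_connected.
Qed.

Definition instance (tail : seq bool) : seq bool :=
  enc_nat (size vlist) ++ enc_nat s ++ enc_nat r ++ enc_nat n.+2 ++ tail.

Lemma Rendezvous_instance : Rendezvous (instance A) <-> @tm_acc M (tm_run M t w).1.1.
Proof.
split=> [[N [s' [r' [k [B [eq [_ [_ win]]]]]]]]|ac].
  (* The language asserts only some decoding of the word; as the number codes are prefix-free, it is
     the intended one. *)
  move: eq => /enc_nat_prefix[eN eq]; subst N.
  move: eq => /enc_nat_prefix[/val_inj es /enc_nat_prefix[/val_inj er /enc_nat_prefix[ek eA]]].
  subst s' r' k B; apply: contraT => nac.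
  by case: (reduction_rejects t_halts t_space phiK psiK eE (psiK _) (psiK _) (negP nac)).
exists (size vlist), s, r, n.+2, A; split=> //; split; first exact: instance_valid.
split=> //; apply: facilitator_wins_inW.
exact: (reduction_accepts t_halts t_space phiK psiK eE (psiK _) (psiK _) (leqnn _) ac).
Qed.

Lemma Rendezvous_in_Time_instance tau :
  3 * #|{: cfg (mstate M) (msym M) n'}| + 11 <= tau ->
  Rendezvous_in_Time (instance (enc_nat tau ++ A)) <-> @tm_acc M (tm_run M t w).1.1.
Proof.
move=> le; split=> [[N [s' [r' [k [tau' [B [eq [_ [_ [_ win]]]]]]]]]]|ac].
  move: eq => /enc_nat_prefix[eN eq]; subst N.
  move: eq => /enc_nat_prefix[/val_inj es /enc_nat_prefix[/val_inj er /enc_nat_prefix[ek /enc_nat_prefix[et eA]]]].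
  subst s' r' k B; apply: contraT => nac.
  case: (reduction_rejects t_halts t_space phiK psiK eE (psiK _) (psiK _) (negP nac)).
  exact: facilitator_wins_inW win.
exists (size vlist), s, r, n.+2, tau, A; split=> //; split; first exact: instance_valid.
split=> //; split; first by lia.
exact: (reduction_accepts t_halts t_space phiK psiK eE (psiK _) (psiK _) le ac).
Qed.

End Instance.

(** * Numerical bounds *)

Lemma card_cfg_bound (Q S : finType) n' : 0 < #|Q| -> 0 < #|S| ->
  3 * #|{: cfg Q S n'}| + 11 <= 2 ^ ((#|Q| + #|S| + 10) * n'.+1).
Proof.
move=> Q0 S0; rewrite !card_prod card_ffun card_ord !mulnDl !expnD.
have lt2 m : m <= 2 ^ m by exact: ltnW (ltn_expl m _).
have pos : 0 < #|Q| * #|S| ^ n'.+1 * n'.+1 by rewrite !muln_gt0 expn_gt0 Q0 S0.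
(* The number of configurations is positive, so 3 times it plus 11 is at most 14 times it; 14 and
   [n'.+1] are absorbed by the powers with exponents [9 * n'.+1] and [n'.+1]. *)
apply: (@leq_trans (#|Q| * #|S| ^ n'.+1 * (14 * n'.+1))); first by nia.
apply: leq_mul; first apply: leq_mul.
- by apply: leq_trans (lt2 _) _; rewrite leq_exp2l // leq_pmulr.
- by rewrite expnM leq_exp2r.
rewrite -[10]/(9 + 1) mulnDl mul1n expnD leq_mul //.
by apply: (@leq_trans (2 ^ 9)) => //; rewrite leq_exp2l // leq_pmulr.
Qed.

Section BoardSize.
Variables (nk c k : nat).
Let D := c + k + 1.
Let E := nk + 2.

Definition board_size (x : nat) := (x + 2) ^ (2 ^ D).

(** The factor [c] costs exponent [c], and [x ^ k + 1] costs [k + 1], whence [D]. The exponent is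
    [2 ^ D] because the board size is obtained by squaring. *)
Lemma board_size_space x : poly_bound c k x < board_size x.
Proof.
have le (a b : nat) : a <= b -> (x + 2) ^ a <= (x + 2) ^ b by move=> h; rewrite leq_pexp2l // addn2.
apply: (@leq_trans ((x + 2) ^ D)); last by apply/le/ltnW/ltn_expl.
have hc : c < (x + 2) ^ c by apply: ltn_expl; lia.
have hk : x ^ k + 1 <= (x + 2) ^ k * (x + 2).
  have : x ^ k <= (x + 2) ^ k by case: (k) => // m; rewrite leq_exp2r ?leq_addr.
  have : 0 < (x + 2) ^ k by rewrite expn_gt0 addn2.
  by nia.
rewrite /poly_bound /D !expnD expn1 -mulnA.
have -> : c * x ^ k + c = c * (x ^ k + 1) by rewrite mulnDr muln1.
apply: (@leq_trans (c.+1 * (x ^ k + 1))); first by rewrite mulSn; lia.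
exact: leq_mul.
Qed.

Lemma board_size_gt1 x : 1 < board_size x.
Proof.
rewrite /board_size; apply: (@leq_trans ((x + 2) ^ 1)); first by rewrite expn1 addn2.
by rewrite leq_pexp2l ?expn_gt0 ?addn2.
Qed.

Lemma top_large n : 1 < n -> n * (n * nk) <= n ^ (2 ^ E).
Proof.
move=> n1; apply: (@leq_trans (n ^ E)); last by rewrite leq_pexp2l ?(ltnW n1) // ltnW // ltn_expl.
by rewrite /E expnD -mulnn mulnA mulnC; apply: leq_mul => //; exact: ltnW (ltn_expl nk n1).
Qed.

Lemma top_succ n : 1 < n -> n.+2 <= n ^ (2 ^ E).
Proof.
move=> n1; apply: (@leq_trans (n ^ 2)); first by rewrite -mulnn; nia.
rewrite leq_pexp2l ?(ltnW n1) // (leq_trans _ (ltnW (ltn_expl E (ltnSn 1)))) //.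
by rewrite /E leq_addl.
Qed.

End BoardSize.

(** * The reductions *)

Section Reduction.
Variables (M : TM) (c k : nat) (speed : option nat).
Notation kind := (kind (mstate M) (msym M)).
Notation nk := #|{: kind}|.
Let D := c + k + 1.
Let E := nk + 2.
Let si := index (Ks : kind) (enum {: kind}).
Let ti := index (Kt : kind) (enum {: kind}).
Let program : cmd nvars := CSeq (setup D E) (output M si ti speed).

Definition reduction (w : seq bool) : seq bool := (exec v_top w program (state0 nvars)).2.

Lemma reduction_poly_time : poly_time_computable reduction.
Proof.
pose T x := setup_cost D E x + cost (output M si ti speed) (board_size c k x ^ (2 ^ E)).
apply: (@program_poly_time nvars v_zero v_top program T) => [w|].
  have [r z n t _] := @setup_spec w D E; apply: prog_runs_seq r _.
  by rewrite /board_size -n -t; exact: output_runs.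
apply: polyb_add; first exact: polyb_setup_cost.
apply: polyb_comp (polyb_cost _) _; apply: polyb_exp; exact: polyb_setup.
Qed.

Lemma reductionE w : let n' := (board_size c k (size w)).-1 in
  reduction w = @instance M n' ((if speed is Some C then enc_nat (2 ^ (C * n'.+1)) else [::]) ++
    adj_matrix (triples kind n'.+1) (@medge M w n')).
Proof.
set n' := _.-1 => /=.
have nE : n'.+1 = board_size c k (size w) by rewrite /n' prednK // ltnW ?board_size_gt1.
have [_ z n t o] := @setup_spec w D E.
rewrite /reduction /program exec_seqE (@output_spec M si ti speed w n') //.
- rewrite o; congr (enc_nat _ ++ (enc_nat _ ++ (enc_nat _ ++ _))).
  + by rewrite size_triples.
  + by rewrite /= index_triples.
  + by rewrite /= index_triples.
- by rewrite n nE.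
- by rewrite t n -/(board_size c k _) nE top_large ?board_size_gt1.
- by rewrite t n -/(board_size c k _) nE top_succ ?board_size_gt1.
Qed.

End Reduction.

Theorem theorem4 : PSPACE_hard Rendezvous /\ PSPACE_hard Rendezvous_in_Time.
Proof.
(* The last cell has number [n'], one less than the board size, so the strict inequality of
   [board_size_space] is what keeps the head on the board. *)
have space M c k w t : (forall t', t' <= t -> (tm_run M t' w).2 <= poly_bound c k (size w)) ->
    forall t', t' <= t -> (tm_run M t' w).2 <= (board_size c k (size w)).-1.
  move=> sp t' /sp h; apply: leq_trans h _.
  by rewrite -ltnS prednK ?board_size_space // ltnW ?board_size_gt1.
split=> L [M [c [k hM]]].
  exists (reduction M c k None); split; first exact: reduction_poly_time.
  move=> w; have [t [ht [/space sp hL]]] := hM w.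
  rewrite reductionE /=.
  exact: iff_trans (iff_sym hL) (iff_sym (Rendezvous_instance ht sp)).
(* The rate in [card_cfg_bound]: it depends on [M] only, so it can be built into the program. *)
pose C := #|{: mstate M}| + #|{: msym M}| + 10.
exists (reduction M c k (Some C)); split; first exact: reduction_poly_time.
move=> w; have [t [ht [/space sp hL]]] := hM w.
rewrite reductionE; apply: iff_trans (iff_sym hL) (iff_sym (Rendezvous_in_Time_instance ht sp _)).
apply: card_cfg_bound; apply/card_gt0P; [by exists (minit M) | by exists None].
Qed.
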